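(* Let $0\le t<T<\infty$. Then the following statements are equivalent: (i) $G(t,T)$ is invertible. (ii) $U_{2n-1}=\mathbb{R}^n$. (iii) $\operatorname{rank}(\mathcal{A}_0,\mathcal{A}_1,\ldots,\mathcal{A}_{2n-1})=n$.
   Context: $W$ is a standard one-dimensional Brownian motion on a complete probability space, with $\mathbb F$ the usual augmentation of its natural filtration. Let $A,\bar A,C,\bar C\in\mathbb{R}^{n\times n}$ and $B,\bar B\in\mathbb{R}^{n\times m}$ be constant matrices, and put $\widehat A=A+\bar A$, $\widehat B=B+\bar B$, $\widehat C=C+\bar C$. For $t\ge0$, $\Phi_t$ is the $\mathbb{R}^{n\times n}$-valued solution of $$d\Phi_t(s)=-\{\Phi_t(s)A+[\mathbb{E}\Phi_t(s)]\bar A\}ds-\{\Phi_t(s)C+[\mathbb{E}\Phi_t(s)]\bar C\}dW(s),\ s\ge t,\quad \Phi_t(t)=I_n,$$ and $$G(t,T)=\mathbb{E}\int_t^T\big(\Phi_t(s)B+[\mathbb{E}\Phi_t(s)]\bar B\big)\big(\Phi_t(s)B+[\mathbb{E}\Phi_t(s)]\bar B\big)^\top ds.$$ Matrices, defined recursively by horizontal concatenation: $\mathcal{A}_0=\widehat B$, $\mathcal{B}_0=B$, $\mathcal{A}_{k+1}=(\widehat A\mathcal{A}_k,\widehat C\mathcal{B}_k)$, $\mathcal{B}_{k+1}=(A\mathcal{B}_k,C\mathcal{B}_k)$ for $k\in\mathbb{N}=\{0,1,2,\ldots\}$. Subspaces of $\mathbb{R}^n$: $V_0=\operatorname{im}B$,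 $U_0=\operatorname{im}\widehat B$, $V_{k+1}=AV_k+CV_k+V_0$, $U_{k+1}=\widehat A U_k+\widehat C V_k+U_0$ for $k\in\mathbb{N}$. *)

(* Defs.v *)
From HB Require Import structures.
From mathcomp Require Import all_boot all_order all_algebra.
From mathcomp Require Import all_classical all_reals all_analysis.

Set Implicit Arguments.
Unset Strict Implicit.
Unset Printing Implicit Defensive.

Import Order.TTheory GRing.Theory Num.Theory.
Import numFieldNormedType.Exports.

Local Open Scope classical_set_scope.
Local Open Scope ring_scope.

(* Processes are indexed by all of [R]; only the indices [0 <= s] matter. *)

Section filtrations.
Context {R : realType} {d : measure_display} {Omega : measurableType d}.
Variable P : probability Omega R.

Definition natural_filtration (W : R -> Omega -> R) (s : R) : set (set Omega) :=
  <<s \bigcup_(u in `[0, s]) preimage_set_system setT (W u) measurable >>.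

(* Smallest filtration that contains [F] and satisfies the usual conditions:
   right-continuous, with every P-null set in each of its members. *)
Definition usual_augmentation (F : R -> set (set Omega)) (s : R) :
    set (set Omega) :=
  \bigcap_(u in [set u : R | s < u]) <<s F u `|` [set N | P.-negligible N] >>.

(* The independence clause makes [W u - W s] independent of the whole past
   [sigma(W r, 0 <= r <= s)], i.e. the increments are mutually independent. *)
Definition brownian_motion (W : R -> Omega -> R) : Prop :=
  [/\ forall s : R, 0 <= s -> measurable_fun setT (W s),
      {ae P, forall w, W 0 w = 0},
      {ae P, forall w, {within `[0, +oo[, continuous (fun s => W s w)}},
      (forall (s u : R) (D : set R), 0 <= s -> s < u -> measurable D ->
         P ((W u \- W s) @^-1` D) = normal_prob 0 (Num.sqrt (u - s)) D)
    & (forall (s u : R) (E : set Omega) (D : set R), 0 <= s -> s < u ->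
         natural_filtration W s E -> measurable D ->
         P (E `&` (W u \- W s) @^-1` D) =
         (P E * P ((W u \- W s)%R @^-1` D))%E)].

End filtrations.

Section ito_integral.
Context {R : realType} {d : measure_display} {Omega : measurableType d}.
Variable P : probability Omega R.
Variable F : R -> set (set Omega).
Variable W : R -> Omega -> R.

Definition progressive (a b : R) (X : R -> Omega -> R) : Prop :=
  forall s : R, a <= s <= b ->
    measurable_fun (`[a, s] `*` [set: g_sigma_algebraType (F s)])
      (fun p : measurableTypeR R * g_sigma_algebraType (F s) => X p.1 p.2).

Definition L2_process (a b : R) (X : R -> Omega -> R) : Prop :=
  progressive a b X /\
  (\int[P]_w \int[lebesgue_measure]_(s in `[a, b]) ((X s w) ^+ 2)%:E < +oo)%E.

Record simple_process (a b : R) := SimpleProcess {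
  sp_size : nat;
  sp_time : nat -> R;
  sp_coef : nat -> Omega -> R;
  sp_time0 : sp_time 0 = a;
  sp_time_last : sp_time sp_size = b;
  sp_time_nondecreasing :
    forall i, (i < sp_size)%N -> sp_time i <= sp_time i.+1;
  sp_coef_measurable : forall i, (i < sp_size)%N ->
    measurable_fun [set: g_sigma_algebraType (F (sp_time i))] (sp_coef i);
  sp_coef_bounded : forall i, (i < sp_size)%N ->
    exists M : R, forall w, `|sp_coef i w| <= M }.

Definition sp_fun (a b : R) (H : simple_process a b) (s : R) (w : Omega) : R :=
  \sum_(i < sp_size H)
    sp_coef H i w * \1_(`]sp_time H i, sp_time H i.+1]) s.

Definition sp_integral (a b : R) (H : simple_process a b) (w : Omega) : R :=
  \sum_(i < sp_size H)
    sp_coef H i w * (W (sp_time H i.+1) w - W (sp_time H i) w).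

(* [I] is a version of the stochastic integral of [X] dW over [a, b]: the
   L2-limit of the integrals of simple processes approximating [X] in
   L2([a, b] x Omega). By the Ito isometry, [I] does not depend, up to a null
   set, on the approximating sequence. *)
Definition is_ito_integral (a b : R) (X : R -> Omega -> R) (I : Omega -> R) :
    Prop :=
  [/\ L2_process a b X, measurable_fun setT I &
      exists H : nat -> simple_process a b,
        (\int[P]_w \int[lebesgue_measure]_(s in `[a, b])
           ((sp_fun (H k) s w - X s w) ^+ 2)%:E @[k --> \oo] --> 0)%E /\
        ('E_P[fun w => ((sp_integral (H k) w - I w) ^+ 2)%R] @[k --> \oo]
           --> 0)%E].

End ito_integral.

Section matrix_processes.
Context {R : realType} {d : measure_display} {Omega : measurableType d}.
Variable P : probability Omega R.

Definition expect_mx {p q : nat} (X : Omega -> 'M[R]_(p, q)) : 'M[R]_(p, q) :=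
  \matrix_(i < p, j < q) fine 'E_P[fun w => X w i j].

Definition integral_mx {p q : nat} (a b : R) (f : R -> 'M[R]_(p, q)) :
    'M[R]_(p, q) :=
  \matrix_(i < p, j < q) \int[lebesgue_measure]_(s in `[a, b]) f s i j.

Definition mean_field {p q r : nat} (X : R -> Omega -> 'M[R]_(p, q))
    (M Mbar : 'M[R]_(q, r)) (s : R) (w : Omega) : 'M[R]_(p, r) :=
  X s w *m M + expect_mx (X s) *m Mbar.

(* Integral form, for s >= t, of the equation
     dPhi = -{Phi A + E[Phi] Abar} ds - {Phi C + E[Phi] Cbar} dW, Phi(t) = I_n.
   Since the paths of Phi are continuous, "for every s, almost surely" amounts
   to "almost surely, for every s". *)
Definition mf_sde_solution (W : R -> Omega -> R) {n : nat}
    (A Abar C Cbar : 'M[R]_n) (t : R) (Phi : R -> Omega -> 'M[R]_n) : Prop :=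
  let F := usual_augmentation P (natural_filtration W) in
  [/\ forall (s : R) i j, t <= s -> L2_process P F t s (fun r w => Phi r w i j),
      {ae P, forall w, forall i j,
         {within `[t, +oo[, continuous (fun s => Phi s w i j)}}
    & exists I : R -> Omega -> 'M[R]_n, forall s : R, t <= s ->
        (forall i j, is_ito_integral P F W t s
           (fun r w => (- mean_field Phi C Cbar r w) i j)
           (fun w => I s w i j)) /\
        {ae P, forall w,
           Phi s w =
           1%:M + integral_mx t s (fun r => - mean_field Phi A Abar r w)
           + I s w}].

Definition gramian {n m : nat} (B Bbar : 'M[R]_(n, m))
    (Phi : R -> Omega -> 'M[R]_n) (t T : R) : 'M[R]_n :=
  expect_mx (fun w => integral_mx t T (fun s =>
    mean_field Phi B Bbar s w *m (mean_field Phi B Bbar s w)^T)).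

End matrix_processes.

Section kalman_matrices.
Context {R : realType} {n m : nat}.
Variables (A Abar C Cbar : 'M[R]_n) (B Bbar : 'M[R]_(n, m)).

(* Common number of columns, [2 ^ k * m], of [calA k] and [calB k]. *)
Fixpoint cal_width (k : nat) : nat :=
  if k is k'.+1 then (cal_width k' + cal_width k')%N else m.

Fixpoint calB (k : nat) : 'M[R]_(n, cal_width k) :=
  match k with
  | 0 => B
  | k'.+1 => row_mx (A *m calB k') (C *m calB k')
  end.

Fixpoint calA (k : nat) : 'M[R]_(n, cal_width k) :=
  match k with
  | 0 => B + Bbar
  | k'.+1 => row_mx ((A + Abar) *m calA k') ((C + Cbar) *m calB k')
  end.

Definition kalman_mx (N : nat) :
    'M[R]_(n, \sum_(k < N) cal_width k) :=
  \mxrow_(k < N) calA k.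

Definition mulmx_lfun {p q : nat} (M : 'M[R]_(p, q)) :
    'Hom('cV[R]_q, 'cV[R]_p) := linfun (mulmx M).

Fixpoint V_space (k : nat) : {vspace 'cV[R]_n} :=
  match k with
  | 0 => limg (mulmx_lfun B)
  | k'.+1 => (mulmx_lfun A @: V_space k' + mulmx_lfun C @: V_space k'
              + limg (mulmx_lfun B))%VS
  end.

Fixpoint U_space (k : nat) : {vspace 'cV[R]_n} :=
  match k with
  | 0 => limg (mulmx_lfun (B + Bbar))
  | k'.+1 => (mulmx_lfun (A + Abar) @: U_space k'
              + mulmx_lfun (C + Cbar) @: V_space k'
              + limg (mulmx_lfun (B + Bbar)))%VS
  end.

End kalman_matrices.

(* Main.v *)
(** For a row vector [x], the process [x Phi(s)] splits into its mean and its
    centred part, which are orthogonal in L2; hence [x G = 0] iff, for almost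
    every [s] in [t, T], [x E[Phi(s)] (B + Bbar) = 0] and
    [x (Phi(s) - E[Phi(s)]) B = 0] almost surely.

    Suppose that [y(s) = x (Phi(s) - E[Phi(s)]) v] vanishes on [t, T). Then the
    martingale part [J] of [y] equals a time integral [D]. By the Ito isometry
    [E (J(u) - J(s))^2 = g(u) - g(s)], while Cauchy-Schwarz bounds
    [E (D(u) - D(s))^2] by [(u - s) (al(u) - al(s))]; subdividing [[s, u]] gives
    [g = 0]. Therefore both integrands vanish, i.e. the same property holds for
    [A v] and [C v], and [x E[Phi(s)] (C + Cbar) v = 0]. Likewise
    [x E[Phi(s)] u = 0] on [t, T) propagates to [(A + Abar) u]. Starting from the
    columns of [B] and [B + Bbar], one obtains [x E[Phi(s)] U_k = 0], and
    [s = t] gives [x U_k = 0] for all [k].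

    Conversely, if [x] annihilates [U_(2n-1)], where both chains of subspaces
    have become stationary, then the quantities [x E[Phi(s)] u] and
    [x (Phi(s) - E[Phi(s)]) v], for [u] and [v] in bases of the limit spaces,
    solve a closed homogeneous linear system with zero initial value, so that
    they vanish by Gronwall's lemma applied to their second moments. *)

Require Import Defs.
From mathcomp Require Import all_boot all_order all_algebra.
From mathcomp Require Import all_classical all_reals all_analysis.
From mathcomp Require Import measurable_realfun zify ring lra.

Set Implicit Arguments.
Unset Strict Implicit.
Unset Printing Implicit Defensive.

Import Order.TTheory GRing.Theory Num.Theory.
Import numFieldNormedType.Exports.
Local Open Scope classical_set_scope.
Local Open Scope ring_scope.

(** * Square-integrable functions *)

Section square_integrable.
Context {R : realType} {d : measure_display} {T : measurableType d}.
Variable mu : {measure set T -> \bar R}.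
Implicit Types f g h : T -> R.

(** The stochastic integral is given only as an L2 limit at each fixed upper time, up to a null set.
    Hence nothing is used about it beyond its mean and its covariances: the matrix equation is
    tested as [x M v], right multiplication by a coefficient becomes an action on [v], and each
    claim becomes one about inner products of scalar processes. That a martingale which is also a
    time integral must vanish is therefore not read off from quadratic variation along paths; it
    follows by comparing the variance of an increment, which is additive in time, with a bound that
    carries an additional factor [u - s]. Two chains of subspaces occur because the bar matrices
    multiply the mean alone: fluctuations are moved by [A] and [C], the mean by [A + Abar], and
    [C + Cbar] is the link through which a null fluctuation constrains the mean. Norms in L2 of time
    and chance ignore null sets of times. Statements at every time are recovered from countably many
    good times and continuity, on intervals that leave room to the right. *)

Definition sq_integrable f :=
  measurable_fun setT f /\ mu.-integrable setT (fun x => ((f x) ^+ 2)%:E).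

(** A real-valued integral sends infinite values to 0, hence the square-integrability hypotheses in
    the bilinear laws below. *)
Definition inner f g : R := \int[mu]_x (f x * g x).

Lemma sq_integrable_ltP f : measurable_fun setT f ->
  (\int[mu]_x ((f x) ^+ 2)%:E < +oo)%E <-> sq_integrable f.
Proof.
move=> mf; have msq : measurable_fun setT (fun x => ((f x) ^+ 2)%:E).
  exact/measurable_EFinP/measurable_funX.
split=> [lt_oo|[_ /integrableP[_]]].
  split=> //; apply/integrableP; split=> //.
  by under eq_integral do rewrite gee0_abs ?lee_fin ?sqr_ge0//.
by under eq_integral do rewrite gee0_abs ?lee_fin ?sqr_ge0//.
Qed.

Lemma integrable_mul f g : sq_integrable f -> sq_integrable g ->
  mu.-integrable setT (fun x => (f x * g x)%:E).
Proof.
move=> [mf sf] [mg sg].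
apply: (@le_integrable _ _ _ mu setT _ _
  (fun x => ((f x) ^+ 2)%:E + ((g x) ^+ 2)%:E)%E) => //.
- exact/measurable_EFinP/measurable_funM.
- move=> x _; rewrite -EFinD /= lee_fin (@ger0_norm _ (_ + _)) ?addr_ge0 ?sqr_ge0//.
  rewrite normrM -(real_normK (num_real (f x))) -(real_normK (num_real (g x))).
  by have := normr_ge0 (f x); have := normr_ge0 (g x); nra.
- exact: integrableD.
Qed.

Lemma sq_integrableD f g : sq_integrable f -> sq_integrable g ->
  sq_integrable (f \+ g).
Proof.
move=> sf sg; have := integrable_mul sf sg.
case: sf sg => mf sf [mg sg] sfg; split; first exact: measurable_funD.
have -> : (fun x => ((f \+ g) x ^+ 2)%:E) = (fun x => ((f x ^+ 2)%:E +
    (g x ^+ 2)%:E) + ((f x * g x)%:E + (f x * g x)%:E))%E.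
  by apply/funext => x /=; rewrite -!EFinD; congr (_%:E); ring.
by apply: integrableD => //; exact: integrableD.
Qed.

Lemma sq_integrableZ (k : R) f : sq_integrable f ->
  sq_integrable (fun x => k * f x).
Proof.
move=> [mf sf]; split; first exact: measurable_funM.
have -> : (fun x => ((k * f x) ^+ 2)%:E) =
    (fun x => (k ^+ 2)%:E * ((f x) ^+ 2)%:E)%E.
  by apply/funext => x; rewrite -EFinM exprMn.
exact: integrableZl.
Qed.

Lemma sq_integrableN f : sq_integrable f -> sq_integrable (\- f).
Proof.
move=> /(sq_integrableZ (-1)); congr sq_integrable.
by apply/funext => x; rewrite mulN1r.
Qed.

Lemma sq_integrableB f g : sq_integrable f -> sq_integrable g ->
  sq_integrable (f \- g).
Proof. by move=> sf /sq_integrableN sg; exact: sq_integrableD. Qed.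

Lemma sq_integrable0 : sq_integrable (cst 0).
Proof.
split; first exact: measurable_cst.
have -> : (fun x : T => ((cst 0 x : R) ^+ 2)%:E) = cst 0%E.
  by apply/funext => x; rewrite /= expr0n.
exact: integrable0.
Qed.

Lemma sq_integrable_sum (I : Type) (r : seq I) (Q : pred I) (f : I -> T -> R) :
  (forall i, Q i -> sq_integrable (f i)) ->
  sq_integrable (fun x => \sum_(i <- r | Q i) f i x).
Proof.
move=> sf; elim: r => [|i r IH].
  by under [X in sq_integrable X]funext do rewrite big_nil; exact: sq_integrable0.
under [X in sq_integrable X]funext do rewrite big_cons.
case Qi : (Q i) => //.
by apply: sq_integrableD => //; exact: sf.
Qed.

Lemma innerC f g : inner f g = inner g f.
Proof. by apply: eq_Rintegral => x _; rewrite mulrC. Qed.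

Lemma innerDl f g h : sq_integrable f -> sq_integrable g -> sq_integrable h ->
  inner (f \+ g) h = inner f h + inner g h.
Proof.
move=> sf sg sh; rewrite /inner -RintegralD//; try exact: integrable_mul.
by apply: eq_Rintegral => x _; rewrite /= mulrDl.
Qed.

Lemma innerZl (k : R) f g : sq_integrable f -> sq_integrable g ->
  inner (fun x => k * f x) g = k * inner f g.
Proof.
move=> sf sg; rewrite /inner -RintegralZl//; last exact: integrable_mul.
by apply: eq_Rintegral => x _; rewrite mulrA.
Qed.

Lemma innerNl f g : sq_integrable f -> sq_integrable g ->
  inner (\- f) g = - inner f g.
Proof.
move=> sf sg; rewrite -mulN1r -innerZl//; congr inner.
by apply/funext => x; rewrite mulN1r.
Qed.

Lemma innerBl f g h : sq_integrable f -> sq_integrable g -> sq_integrable h ->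
  inner (f \- g) h = inner f h - inner g h.
Proof.
move=> sf sg sh; rewrite -innerNl// -innerDl//; exact: sq_integrableN.
Qed.

Lemma innerBr f g h : sq_integrable f -> sq_integrable g -> sq_integrable h ->
  inner h (f \- g) = inner h f - inner h g.
Proof. by move=> *; rewrite !(innerC h) innerBl. Qed.

Lemma inner0l f : inner (cst 0) f = 0.
Proof.
rewrite /inner; under eq_Rintegral do rewrite mul0r.
by rewrite /Rintegral integral0.
Qed.

Lemma inner_suml (I : Type) (r : seq I) (f : I -> T -> R) g :
  (forall i, sq_integrable (f i)) -> sq_integrable g ->
  inner (fun x => \sum_(i <- r) f i x) g = \sum_(i <- r) inner (f i) g.
Proof.
move=> sf sg; elim: r => [|i r IH].
  rewrite big_nil -[RHS](inner0l g); congr inner.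
  by apply/funext => x; rewrite big_nil.
rewrite big_cons -IH -innerDl//; last exact: sq_integrable_sum.
by congr inner; apply/funext => x; rewrite big_cons.
Qed.

Lemma inner_sumr (I : Type) (r : seq I) (f : I -> T -> R) g :
  (forall i, sq_integrable (f i)) -> sq_integrable g ->
  inner g (fun x => \sum_(i <- r) f i x) = \sum_(i <- r) inner g (f i).
Proof.
move=> sf sg; rewrite innerC inner_suml//.
by apply: eq_bigr => i _; exact: innerC.
Qed.

Lemma inner_ge0 f : 0 <= inner f f.
Proof. by apply: Rintegral_ge0 => x _; rewrite -expr2 sqr_ge0. Qed.

Lemma inner_sqE f : sq_integrable f ->
  (\int[mu]_x ((f x) ^+ 2)%:E)%E = (inner f f)%:E.
Proof.
move=> [mf sf]; rewrite /inner /Rintegral fineK.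
  by apply: eq_integral => x _; rewrite expr2.
under eq_integral do rewrite -expr2.
exact: integrable_fin_num.
Qed.

Lemma inner_sqD f g : sq_integrable f -> sq_integrable g ->
  inner (f \+ g) (f \+ g) = inner f f + inner f g *+ 2 + inner g g.
Proof.
move=> sf sg; have sfg := sq_integrableD sf sg.
rewrite innerDl// !(innerC _ (f \+ g)) !innerDl// (innerC g f); ring.
Qed.

Lemma inner_sqB f g : sq_integrable f -> sq_integrable g ->
  inner (f \- g) (f \- g) = inner f f - inner f g *+ 2 + inner g g.
Proof.
move=> sf sg; have sfg := sq_integrableB sf sg.
rewrite innerBl// !innerBr// (innerC g f); ring.
Qed.

(** Expand the nonnegative square norms of [e f + g] and [e f - g] and divide by [e]. The free
    weight makes one factor small at the expense of the other, which serves limits as well as the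
    Cauchy-Schwarz inequality. *)
Lemma inner_le f g (e : R) : 0 < e -> sq_integrable f -> sq_integrable g ->
  `|inner f g| *+ 2 <= e * inner f f + e^-1 * inner g g.
Proof.
move=> e0 sf sg; have e1 : e * e^-1 = 1 by rewrite mulfV ?gt_eqF.
have he : 0 < e^-1 by rewrite invr_gt0.
have sef := sq_integrableZ e sf.
have := inner_ge0 ((fun x => e * f x) \- g).
have := inner_ge0 ((fun x => e * f x) \+ g).
rewrite inner_sqD// inner_sqB//.
rewrite !innerZl// (innerC f (fun x => e * f x)) innerZl//.
set a := inner f f; set b := inner g g; set c := inner f g => h1 h2.
have h1' : 0 <= e^-1 * (e * (e * a) + (e * c) *+ 2 + b).
  by rewrite mulr_ge0// ltW.
have h2' : 0 <= e^-1 * (e * (e * a) - (e * c) *+ 2 + b).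
  by rewrite mulr_ge0// ltW.
have E1 : e^-1 * (e * (e * a) + (e * c) *+ 2 + b) =
    (e * e^-1) * (e * a) + (e * e^-1) * c *+ 2 + e^-1 * b by ring.
have E2 : e^-1 * (e * (e * a) - (e * c) *+ 2 + b) =
    (e * e^-1) * (e * a) - (e * e^-1) * c *+ 2 + e^-1 * b by ring.
rewrite E1 e1 !mul1r in h1'; rewrite E2 e1 !mul1r in h2'.
by rewrite real_normrEsign ?num_real//; case: (c < 0); rewrite ?expr0 ?expr1; lra.
Qed.

Lemma inner_eq0_ae f : sq_integrable f -> inner f f = 0 ->
  {ae mu, forall x, f x = 0}.
Proof.
move=> [mf sf] f0.
have := inner_sqE (conj mf sf); rewrite f0 => h.
have mf2 : measurable_fun setT (fun x => ((f x) ^+ 2)%:E).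
  exact/measurable_EFinP/measurable_funX.
have := (@ae_eq_integral_abs _ _ _ mu setT measurableT _ mf2).1.
move=> /(_ _)/wrap[|]; first by rewrite -[RHS]h; apply: eq_integral => x _;
  rewrite gee0_abs ?lee_fin ?sqr_ge0.
apply: filterS => x /(_ I) [] /eqP; rewrite sqrf_eq0 => /eqP //.
Qed.

Lemma sq_integrable_ae f g : measurable_fun setT g -> sq_integrable f ->
  {ae mu, forall x, f x = g x} -> sq_integrable g.
Proof.
move=> mg [mf sf] fg; apply/sq_integrable_ltP => //.
have /sq_integrable_ltP-/(_ mf) : sq_integrable f by [].
congr (_ < _)%E; apply: ae_eq_integral => //.
- exact/measurable_EFinP/measurable_funX.
- exact/measurable_EFinP/measurable_funX.
- by apply: filterS fg => x -> _.
Qed.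

Lemma inner_aeE f g f' g' :
  sq_integrable f -> sq_integrable g -> sq_integrable f' -> sq_integrable g' ->
  {ae mu, forall x, f x = f' x} -> {ae mu, forall x, g x = g' x} ->
  inner f g = inner f' g'.
Proof.
move=> sf sg sf' sg' ff' gg'; rewrite /inner /Rintegral; congr fine.
apply: ae_eq_integral => //.
- exact: (measurable_int mu (integrable_mul sf sg)).
- exact: (measurable_int mu (integrable_mul sf' sg')).
- by apply: filterS2 ff' gg' => x -> -> _.
Qed.

Lemma inner_cvg (F G : nat -> T -> R) f g :
  (forall k, sq_integrable (F k)) -> (forall k, sq_integrable (G k)) ->
  sq_integrable f -> sq_integrable g ->
  inner (F k \- f) (F k \- f) @[k --> \oo] --> (0 : R) ->
  inner (G k \- g) (G k \- g) @[k --> \oo] --> (0 : R) ->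
  inner (F k) (G k) @[k --> \oo] --> inner f g.
Proof.
move=> sF sG sf sg cF cG; apply/cvgrPdist_le => e e0.
pose M := 1 + inner f f + inner g g.
have M0 : 0 < M by have := inner_ge0 f; have := inner_ge0 g; rewrite /M; lra.
(* The two linear error terms get the weights [r^-1] and [r], so that the fixed norms of [f] and [g]
   contribute at most [e] to the doubled error; [del] makes each of the four remaining contributions
   at most [e / 4]. *)
pose r := e / M; have r0 : 0 < r by rewrite divr_gt0.
pose del := Num.min (Num.min (r * e) e) 1 / 4.
have de : 0 < del.
  by rewrite divr_gt0// !lt_min ltr01 e0 mulr_gt0.
move/cvgrPdist_le/(_ _ de) : cF => cF; move/cvgrPdist_le/(_ _ de) : cG => cG.
near=> k.
have hF : inner (F k \- f) (F k \- f) <= del.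
  have : `|0 - inner (F k \- f) (F k \- f)| <= del by near: k.
  by rewrite sub0r normrN ger0_norm// inner_ge0.
have hG : inner (G k \- g) (G k \- g) <= del.
  have : `|0 - inner (G k \- g) (G k \- g)| <= del by near: k.
  by rewrite sub0r normrN ger0_norm// inner_ge0.
have sFf := sq_integrableB (sF k) sf; have sGg := sq_integrableB (sG k) sg.
have -> : inner f g - inner (F k) (G k) =
  - (inner (F k \- f) (G k \- g) + inner (F k \- f) g + inner f (G k \- g)).
  rewrite !innerBl// !innerBr//; ring.
rewrite normrN.
have h1 := inner_le ltr01 sFf sGg.
have ir0 : 0 < r^-1 by rewrite invr_gt0.
have h2 := inner_le ir0 sFf sg.
have h3 := inner_le r0 sf sGg.
rewrite invrK invr1 !mul1r in h1 h2.
have := ler_normD (inner (F k \- f) (G k \- g) + inner (F k \- f) g)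
  (inner f (G k \- g)).
have := ler_normD (inner (F k \- f) (G k \- g)) (inner (F k \- f) g).
have hr : r * inner f f + r * inner g g <= e.
  have <- : r * M = e by rewrite /r divfK ?gt_eqF.
  by rewrite -mulrDr ler_wpM2l ?(ltW r0)// /M; lra.
have dm : del <= e / 4.
  by rewrite ler_pM2r// /del !ge_min lexx orbT.
have dr : r^-1 * del <= e / 4.
  rewrite ler_pdivrMl// mulrA ler_pM2r// !ge_min; lra.
have h4 : r^-1 * inner (F k \- f) (F k \- f) <= r^-1 * del by rewrite ler_pM2l.
have h5 : r^-1 * inner (G k \- g) (G k \- g) <= r^-1 * del by rewrite ler_pM2l.
lra.
Unshelve. all: by end_near.
Qed.

Lemma sq_integrable_mul_bounded (f g : T -> R) (M : R) :
  measurable_fun setT f -> (forall x, `|f x| <= M) -> sq_integrable g ->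
  sq_integrable (fun x => f x * g x).
Proof.
move=> mf fM [mg sg]; split; first exact: measurable_funM.
apply: (@le_integrable _ _ _ mu setT _ _ (fun x => (M ^+ 2)%:E * (g x ^+ 2)%:E)%E) => //.
- by apply/measurable_EFinP; apply: measurable_funX; exact: measurable_funM.
- move=> x _; rewrite -EFinM /= lee_fin; apply: le_trans (ler_norm _).
  rewrite exprMn (ger0_norm (mulr_ge0 (sqr_ge0 (f x)) (sqr_ge0 (g x)))).
  rewrite ler_wpM2r ?sqr_ge0// -(real_normK (num_real (f x))).
  by rewrite ler_pXn2r ?nnegrE// (le_trans _ (fM x)).
- exact: integrableZl.
Qed.

Lemma inner_lincomb (I J : Type) (r : seq I) (q : seq J) (c : I -> R) (e : J -> R)
    (f : I -> T -> R) (g : J -> T -> R) :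
  (forall i, sq_integrable (f i)) -> (forall j, sq_integrable (g j)) ->
  inner (fun x => \sum_(i <- r) c i * f i x) (fun x => \sum_(j <- q) e j * g j x) =
  \sum_(i <- r) \sum_(j <- q) c i * e j * inner (f i) (g j).
Proof.
move=> sf sg.
have scf i := sq_integrableZ (c i) (sf i); have seg j := sq_integrableZ (e j) (sg j).
rewrite inner_suml//; last by apply: sq_integrable_sum => j _; exact: seg.
apply: eq_bigr => i _; rewrite inner_sumr//; apply: eq_bigr => j _.
by rewrite innerZl// innerC innerZl// innerC mulrA.
Qed.

Lemma inner_triangle f g : sq_integrable f -> sq_integrable g ->
  inner (f \+ g) (f \+ g) <= 2 * inner f f + 2 * inner g g.
Proof.
move=> sf sg; rewrite inner_sqD//; have := inner_ge0 (f \- g).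
by rewrite inner_sqB//; lra.
Qed.

End square_integrable.

(** * Moments of the normal distribution *)

Section eq_integral_test.
Context {R : realType} {d0 d1 d2 : measure_display} {T0 : measurableType d0}
  {T1 : measurableType d1} {T2 : measurableType d2}.
Local Open Scope ereal_scope.
Import HBNNSimple.

(** A simple function is constant on finitely many level sets, so that only integrals of [p] over
    preimages under [phi] remain, where an equality known on sets can be inserted. *)
Lemma integral_nnsfun_comp {d : measure_display} {T : measurableType d}
    (mu : {measure set T -> \bar R}) (phi : T -> T0) (p : T -> R)
    (g : {nnsfun T0 >-> R}) :
  measurable_fun setT phi -> measurable_fun setT p -> (forall x, 0 <= p x)%R ->
  \int[mu]_x (g (phi x) * p x)%:E =
  \sum_(y \in range g)
    y%:E * \int[mu]_(x in phi @^-1` (g @^-1` [set y])) (p x)%:E.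
Proof.
move=> mphi mp p0.
have mgy y : measurable (phi @^-1` (g @^-1` [set y])).
  by rewrite -[X in measurable X]setTI; exact: mphi.
transitivity (\int[mu]_x \sum_(y \in range g)
    (y * \1_(g @^-1` [set y]) (phi x) * p x)%:E).
  apply: eq_integral => x _.
  by rewrite fsumEFin//; rewrite -mulr_fsuml// -fimfunE.
rewrite ge0_integral_fsum//; last 2 first.
- move=> y; apply/measurable_EFinP; apply: measurable_funM => //.
  by apply: measurable_funM => //; exact: measurableT_comp.
- move=> y x _; rewrite EFinM; apply: mule_ge0; last by rewrite lee_fin.
  by rewrite EFinM; exact: nnfun_muleindic_ge0.
apply: eq_fsbigr => y /set_mem -[x0 _ <-{y}].
rewrite -ge0_integralZl//.
- rewrite [RHS]integral_mkcond; apply: eq_integral => x _.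
  rewrite patchE indicE/=.
  have -> : (phi x \in g @^-1` [set g x0]) =
      (x \in phi @^-1` (g @^-1` [set g x0])) by [].
  by case: ifPn; rewrite ?mulr1 ?mulr0 ?mul0r ?EFinM.
- by apply: measurable_funTS; exact/measurable_EFinP.
- by move=> x _; rewrite lee_fin.
- by rewrite lee_fin.
Qed.

Lemma integral_test_cvg {d : measure_display} {T : measurableType d}
    (mu : {measure set T -> \bar R}) (phi : T -> T0) (p : T -> R)
    (xi : T0 -> R) (mxi : measurable_fun setT (EFin \o xi)) :
  measurable_fun setT phi -> measurable_fun setT p -> (forall x, 0 <= p x)%R ->
  (forall x, 0 <= xi x)%R ->
  \int[mu]_x (nnsfun_approx measurableT mxi n (phi x) * p x)%:E
    @[n --> \oo] --> \int[mu]_x (xi (phi x) * p x)%:E.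
Proof.
move=> mphi mp p0 xi0; set g := nnsfun_approx measurableT mxi.
have -> : (fun x => (xi (phi x) * p x)%:E) =
    (fun x => limn (fun n => (g n (phi x) * p x)%:E)).
  apply/funext => x; apply/esym/cvg_lim => //.
  have -> : (fun n => (g n (phi x) * p x)%:E) =
      (fun n => (g n (phi x))%:E * (p x)%:E) by apply/funext => n; rewrite EFinM.
  rewrite EFinM; apply: cvgeZr => //.
  by apply: (cvg_nnsfun_approx measurableT mxi) => // z _; rewrite lee_fin.
apply: cvg_monotone_convergence => //.
- move=> n; apply/measurable_EFinP; apply: measurable_funM => //.
  exact: measurableT_comp.
- by move=> n x _; rewrite lee_fin mulr_ge0.
- move=> x _ a b ab; rewrite lee_fin ler_wpM2r//.
  exact/lefP/nd_nnsfun_approx.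
Qed.

(* An equality of integrals tested on measurable sets [E] extends to nonnegative
   measurable test functions [xi]. The maps [phi1], [phi2] allow [xi] to be
   measurable for a smaller sigma-algebra only. *)
Lemma eq_integral_test (mu1 : {measure set T1 -> \bar R})
    (mu2 : {measure set T2 -> \bar R}) (phi1 : T1 -> T0) (phi2 : T2 -> T0)
    (p1 : T1 -> R) (p2 : T2 -> R) (xi : T0 -> R) :
  measurable_fun setT phi1 -> measurable_fun setT phi2 ->
  measurable_fun setT p1 -> measurable_fun setT p2 ->
  (forall x, 0 <= p1 x)%R -> (forall x, 0 <= p2 x)%R ->
  (forall E, measurable E ->
    \int[mu1]_(x in phi1 @^-1` E) (p1 x)%:E =
    \int[mu2]_(x in phi2 @^-1` E) (p2 x)%:E) ->
  measurable_fun setT xi -> (forall x, 0 <= xi x)%R ->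
  \int[mu1]_x (xi (phi1 x) * p1 x)%:E = \int[mu2]_x (xi (phi2 x) * p2 x)%:E.
Proof.
move=> mphi1 mphi2 mp1 mp2 p10 p20 E12 mxi xi0.
have mxi' : measurable_fun setT (EFin \o xi) by exact/measurable_EFinP.
have h1 := integral_test_cvg (mu := mu1) mxi' mphi1 mp1 p10 xi0.
have h2 := integral_test_cvg (mu := mu2) mxi' mphi2 mp2 p20 xi0.
rewrite -(cvg_lim _ h1)// -(cvg_lim _ h2)//; congr (limn _).
apply/funext => n; rewrite !integral_nnsfun_comp//.
by apply: eq_fsbigr => y _; congr (_ * _)%E; exact: E12.
Qed.

End eq_integral_test.

Section normal_moments.
Context {R : realType}.
Notation mu := (@lebesgue_measure R).

(** The fundamental theorem of calculus on symmetric intervals, followed by dominated convergence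
    with [|f|] as the dominating function. *)
Lemma integralT_antiderivative0 (f F : R -> R) :
  continuous f -> mu.-integrable setT (EFin \o f) ->
  (forall x : R, is_derive x (1 : R) F (f x)) ->
  F n.+1%:R - F (- n.+1%:R) @[n --> \oo] --> (0 : R) ->
  (\int[mu]_x (f x)%:E = 0)%E.
Proof.
move=> cf intf dF F0.
pose f_ n := (EFin \o f) \_ `[- n.+1%:R, n.+1%:R].
have mf : measurable_fun setT (EFin \o f) by exact: measurable_int intf.
have f_cvg : (\int[mu]_x f_ n x @[n --> \oo] --> \int[mu]_x (f x)%:E)%E.
  have [] // := @dominated_convergence _ _ _ mu setT measurableT f_ (EFin \o f)
    (fun x => `|(f x)%:E|%E).
  - move=> n; have mI : measurable `[- n.+1%:R, n.+1%:R : R] by exact: measurable_itv.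
    exact/(measurable_restrictT (EFin \o f) mI)/measurable_funTS.
  - apply: aeW => x _; apply: cvg_near_cst; near=> n.
    rewrite /f_ patchE ifT// inE/= in_itv/= -ler_norml.
    have : `|x| <= n%:R by near: n; exact: nbhs_infty_ger.
    by move=> /le_trans; apply; rewrite ler_nat.
  - exact: integrable_abse.
  - by apply: aeW => x n _; rewrite /f_ patchE; case: ifPn => // _; rewrite abse0.
have f_E n : (\int[mu]_x f_ n x = (F n.+1%:R - F (- n.+1%:R))%:E)%E.
  rewrite /f_ -integral_mkcond EFinB (continuous_FTC2 (F := F))//.
  - by rewrite gtrN.
  - exact: continuous_subspaceT.
  - have cF x : {for x, continuous F}.
      exact/differentiable_continuous/derivable1_diffP.
    split; first by move=> x _; exact: ex_derive.
    + exact/cvg_at_right_filter/cF.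
    + exact/cvg_at_left_filter/cF.
  - by move=> x _; rewrite derive1E derive_val.
move: f_cvg; under eq_fun do rewrite f_E; move=> f_cvg.
have F0' : ((F n.+1%:R - F (- n.+1%:R))%:E @[n --> \oo] --> 0%:E)%E.
  by apply: cvg_EFin; [exact: nearW|exact: F0].
by rewrite (cvg_unique _ f_cvg F0').
Unshelve. all: by end_near. Qed.

Lemma integral_normal_prob (m s : R) (f : R -> R) :
  measurable_fun setT f -> (forall x, 0 <= f x) ->
  (\int[normal_prob m s]_x (f x)%:E =
   \int[mu]_x (f x * normal_pdf m s x)%:E)%E.
Proof.
move=> mf f0.
under eq_integral do rewrite -(mulr1 (f _)).
apply: (eq_integral_test (phi1 := id) (phi2 := id) (p1 := cst 1)) => //.
- exact: measurable_normal_pdf.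
- by move=> x; exact: normal_pdf_ge0.
- by move=> E mE; rewrite !preimage_id (@integral_cst _ _ _ _ _ mE 1%E) mul1e.
Qed.

Variable s : R.
Hypothesis s0 : 0 < s.
Let pdf := normal_pdf 0 s.

Let pdfE x : pdf x = normal_peak s * expR (- x ^+ 2 / (s ^+ 2 *+ 2)).
Proof. by rewrite /pdf normal_pdfE ?gt_eqF// /normal_fun subr0. Qed.

Let is_derive_pdf (x : R) : is_derive x (1 : R) pdf (- x / s ^+ 2 * pdf x).
Proof.
have -> : pdf = (fun x => normal_peak s * expR (- x ^+ 2 / (s ^+ 2 *+ 2))).
  by apply/funext => y; rewrite pdfE.
apply: is_derive_eq; rewrite /GRing.scale/=; field.
by rewrite gt_eqF.
Qed.

Let pdf_ge0 x : 0 <= pdf x.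
Proof. exact: normal_pdf_ge0. Qed.

Let measurable_pdf : measurable_fun setT pdf.
Proof. exact: measurable_normal_pdf. Qed.

(** With [a = x^2 / (4 s^2)] the exponent of the density is [- 2 a]. One factor [exp (- a)] absorbs
    [a] because [a <= exp a]; the other one remains. *)
Let sqr_pdf_le x : x ^+ 2 * pdf x <=
  4 * s ^+ 2 * normal_peak s * expR (- x ^+ 2 / (4 * s ^+ 2)).
Proof.
have s2 : 0 < s ^+ 2 by rewrite exprn_gt0.
set a := x ^+ 2 / (4 * s ^+ 2).
have -> : - x ^+ 2 / (4 * s ^+ 2) = - a by rewrite mulNr.
have x2 : x ^+ 2 = a * (4 * s ^+ 2) by rewrite divfK// mulf_neq0 ?gt_eqF.
rewrite pdfE.
have -> : - x ^+ 2 / (s ^+ 2 *+ 2) = - a + - a.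
  by rewrite x2; field; rewrite gt_eqF.
rewrite expRD x2 expRN.
have ea : 0 < expR a by exact: expR_gt0.
have : a * (expR a)^-1 <= 1.
  by rewrite ler_pdivrMr// mul1r; have := expR_ge1Dx a; lra.
have /ltW : 0 < (expR a)^-1 by rewrite invr_gt0.
move: (expR a)^-1 => e e0 ae1; clear x2 ea; clearbody a.
have -> : a * (4 * s ^+ 2) * (normal_peak s * (e * e)) =
  4 * s ^+ 2 * normal_peak s * e * (a * e) by ring.
rewrite ler_piMr//; apply: mulr_ge0 => //; apply: mulr_ge0; last first.
  exact: normal_peak_ge0.
by rewrite mulr_ge0// ltW.
Qed.

Let integrable_sqr_pdf : mu.-integrable setT (fun x => (x ^+ 2 * pdf x)%:E).
Proof.
(* The Gaussian left over in [sqr_pdf_le] is, up to normalisation, the density with deviation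
   [s']. *)
pose s' := s * Num.sqrt 2.
have s'4 : s' ^+ 2 *+ 2 = 4 * s ^+ 2 by rewrite exprMn sqr_sqrtr//; ring.
have s'0 : 0 < s' by rewrite mulr_gt0// sqrtr_gt0.
pose c := 4 * s ^+ 2 * normal_peak s / normal_peak s'.
apply: (@le_integrable _ _ _ mu setT _ _ (fun x => c%:E * (normal_pdf 0 s' x)%:E)%E) => //.
- by apply/measurable_EFinP/measurable_funM => //; exact: measurable_funX.
- move=> x _; rewrite -EFinM/= lee_fin.
  rewrite (ger0_norm (mulr_ge0 (sqr_ge0 x) (pdf_ge0 x))).
  apply: le_trans (ler_norm _).
  apply: (le_trans (sqr_pdf_le x)).
  rewrite normal_pdfE ?gt_eqF// /normal_fun subr0 s'4 /c -!mulrA mulKf; last first.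
    by rewrite gt_eqF// normal_peak_gt0// gt_eqF.
  by rewrite !mulrA.
- by apply: integrableZl => //; exact: integrable_normal_pdf.
Qed.

Let integrable_pdf : mu.-integrable setT (fun x => (pdf x)%:E).
Proof. exact: integrable_normal_pdf. Qed.

Let integrable_id_pdf : mu.-integrable setT (fun x => (x * pdf x)%:E).
Proof.
apply: (@le_integrable _ _ _ mu setT _ _
  (fun x => (x ^+ 2 * pdf x)%:E + (pdf x)%:E)%E) => //.
- by apply/measurable_EFinP/measurable_funM.
- move=> x _; rewrite -EFinD/= lee_fin normrM (ger0_norm (pdf_ge0 x)).
  apply: le_trans (ler_norm _).
  rewrite -[X in _ + X]mul1r -mulrDl ler_wpM2r//.
  by rewrite -(real_normK (num_real x)); have := normr_ge0 x; nra.
- exact: integrableD.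
Qed.

Let continuous_pdf : continuous pdf.
Proof. by apply: continuous_normal_pdf; rewrite gt_eqF. Qed.

Lemma normal_prob_sqr :
  (\int[normal_prob 0 s]_x (x ^+ 2)%:E = (s ^+ 2)%:E)%E.
Proof.
have s2 : 0 < s ^+ 2 by rewrite exprn_gt0.
rewrite (@integral_normal_prob 0 s (fun x => x ^+ 2)); last 2 first.
- exact: measurable_funX.
- by move=> x; rewrite sqr_ge0.
(* Integration by parts: since the derivative of [pdf] is [- x / s^2] times [pdf], the function
   [- s^2 x pdf x] is a primitive of the integrand. *)
have h : (\int[mu]_x (x ^+ 2 * pdf x - s ^+ 2 * pdf x)%:E = 0)%E.
  apply: (@integralT_antiderivative0 _ (fun x => - s ^+ 2 * (x * pdf x))).
  - move=> x; apply: (@cvgB _ R^o); apply: cvgM.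
    + exact: sqr_continuous.
    + exact: continuous_pdf.
    + exact: cvg_cst.
    + exact: continuous_pdf.
  - have -> : EFin \o (fun x => x ^+ 2 * pdf x - s ^+ 2 * pdf x) =
        (fun x => (x ^+ 2 * pdf x)%:E - (s ^+ 2)%:E * (pdf x)%:E)%E.
      by apply/funext => x; rewrite /= EFinB EFinM.
    apply: integrableB => //.
    exact: integrableZl.
  - move=> x; have dpdf := is_derive_pdf x.
    apply: is_derive_eq; rewrite /GRing.scale/=; field.
    by rewrite gt_eqF.
  (* Boundary terms: [sqr_pdf_le] yields [x^2 pdf x <= C], hence [x pdf x <= C / x]. *)
  - set C := 4 * s ^+ 2 * normal_peak s.
    have C0 : 0 <= C by rewrite !mulr_ge0// ?normal_peak_ge0// ltW.
    apply: (@squeeze_cvgr _ _ _ _ (fun n => - (2 * s ^+ 2 * C) * n.+1%:R^-1) (fun n => 0)).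
    + near=> n; have n0 : 0 < n.+1%:R :> R by [].
      have pE : pdf (- n.+1%:R) = pdf n.+1%:R by rewrite !pdfE sqrrN.
      have := sqr_pdf_le n.+1%:R; rewrite -/C => h.
      have {}h : n.+1%:R ^+ 2 * pdf n.+1%:R <= C.
        apply: (le_trans h); rewrite ler_piMr// -[leRHS]expR0 ler_expR mulNr.
        by rewrite oppr_le0 divr_ge0 ?sqr_ge0// mulr_ge0// sqr_ge0.
      have {}h : n.+1%:R * pdf n.+1%:R <= C * n.+1%:R^-1.
        by rewrite ler_pdivlMr//; apply: le_trans h; rewrite expr2; lra.
      have h0 : 0 <= n.+1%:R * pdf n.+1%:R by rewrite mulr_ge0.
      rewrite pE; set u := n.+1%:R * pdf n.+1%:R in h h0 *.
      have -> : - s ^+ 2 * u - - s ^+ 2 * (- n.+1%:R * pdf n.+1%:R) = - (2 * s ^+ 2 * u).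
        by rewrite /u; ring.
      rewrite oppr_le0 mulNr lerN2 -mulrA; apply/andP; split.
        by rewrite -[leRHS]mulrA -[in leRHS]mulrA ler_pM2l// ler_pM2l.
      by rewrite !mulr_ge0// ltW.
    + rewrite -[X in _ --> X](mulr0 (- (2 * s ^+ 2 * C))).
      apply: cvgMr; exact: cvg_harmonic.
    + exact: cvg_cst.
have : (\int[mu]_x ((x ^+ 2 * pdf x)%:E - (s ^+ 2 * pdf x)%:E) = 0)%E by rewrite -h.
have iZ : mu.-integrable setT (fun x => (s ^+ 2 * pdf x)%:E).
  by under eq_fun do rewrite EFinM; exact: integrableZl.
rewrite integralB//=.
under [X in (_ - X)%E]eq_integral do rewrite EFinM.
rewrite integralZl// integral_normal_pdf mule1 => /eqP.
rewrite sube_eq ?add0e// ?fin_num_adde_defr//; first by move/eqP.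
exact: (integrable_fin_num _ integrable_sqr_pdf).
Unshelve. all: by end_near. Qed.

(** Vanishing of the mean, in the form of two integrals of nonnegative functions because the law and
    the independence of increments are tested on such functions. The primitive [- s^2 pdf] is even,
    so its boundary differences are zero. *)
Lemma normal_prob_pos_neg :
  (\int[normal_prob 0 s]_x (Num.max x 0)%:E =
   \int[normal_prob 0 s]_x (Num.max (- x) 0)%:E)%E.
Proof.
have h : (\int[mu]_x (x * pdf x)%:E = 0)%E.
  apply: (@integralT_antiderivative0 _ (fun x => - s ^+ 2 * pdf x)).
  - by move=> x; apply: cvgM; [exact: cvg_id|exact: continuous_pdf].
  - exact: integrable_id_pdf.
  - move=> x; have dpdf := is_derive_pdf x.
    apply: is_derive_eq; rewrite /GRing.scale/=; field.
    by rewrite gt_eqF.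
  - under eq_fun do rewrite !pdfE sqrrN subrr; exact: cvg_cst.
rewrite (@integral_normal_prob 0 s (fun x => Num.max x 0)); last 2 first.
- exact: measurable_maxr.
- by move=> x; rewrite le_max lexx orbT.
rewrite (@integral_normal_prob 0 s (fun x => Num.max (- x) 0)); last 2 first.
- by apply: measurable_maxr => //; exact: measurable_funN.
- by move=> x; rewrite le_max lexx orbT.
have maxle (x y : R) : `|Num.max x 0 * y| <= `|x * y|.
  rewrite !normrM ler_wpM2r// ger0_norm ?le_max ?lexx ?orbT//.
  by rewrite ge_max normr_ge0 ler_norm.
have i1 : mu.-integrable setT (fun x => (Num.max x 0 * pdf x)%:E).
  apply: le_integrable integrable_id_pdf => //.
    by apply/measurable_EFinP/measurable_funM => //; exact: measurable_maxr.
  by move=> x _; rewrite /= lee_fin.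
have i2 : mu.-integrable setT (fun x => (Num.max (- x) 0 * pdf x)%:E).
  apply: le_integrable integrable_id_pdf => //.
    apply/measurable_EFinP/measurable_funM => //.
    by apply: measurable_maxr => //; exact: measurable_oppr.
  by move=> x _; rewrite /= lee_fin (le_trans (maxle _ _))// mulNr normrN.
have : (\int[mu]_x ((Num.max x 0 * pdf x)%:E - (Num.max (- x) 0 * pdf x)%:E) = 0)%E.
  rewrite -h; apply: eq_integral => x _; rewrite -EFinB -mulrBl; congr (_ * _)%:E.
  have [x0|/ltW x0] := leP x 0.
    by rewrite (@max_l _ _ (- x) 0) ?oppr_ge0//; ring.
  by rewrite (@max_r _ _ (- x) 0) ?oppr_le0//; ring.
rewrite integralB//= => /eqP.
rewrite sube_eq ?add0e// ?fin_num_adde_defr//; first by move/eqP.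
exact: (integrable_fin_num _ i1).
Qed.

End normal_moments.

(** * Brownian increments and the augmented filtration *)

Lemma integral_cstE {R : realType} {d : measure_display} {T : measurableType d}
    (mu : {measure set T -> \bar R}) (D : set T) (k : R) : measurable D ->
  (\int[mu]_(x in D) (cst k x)%:E = k%:E * mu D)%E.
Proof. by move=> mD; rewrite -(integral_cst mu mD). Qed.

Section bounded.
Context {R : realType} {d : measure_display} {T : measurableType d}.
Variable P : probability T R.

Lemma sq_integrable_cst (k : R) : sq_integrable P (cst k).
Proof. by split=> //; exact: (finite_measure_integrable_cst P (k ^+ 2)). Qed.

Lemma integrable_sq_integrable (f : T -> R) : sq_integrable P f ->
  P.-integrable setT (EFin \o f).
Proof.
move=> sf; have s1 : sq_integrable P (cst 1).
  exact: sq_integrable_cst.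
have := integrable_mul sf s1.
by congr (_.-integrable _ _); apply/funext => x; rewrite /= mulr1.
Qed.

Lemma sq_integrable_bounded (f : T -> R) (M : R) :
  measurable_fun setT f -> (forall x, `|f x| <= M) -> sq_integrable P f.
Proof.
move=> mf fM; have := sq_integrable_mul_bounded mf fM (sq_integrable_cst 1).
by congr sq_integrable; apply/funext => x; rewrite mulr1.
Qed.

Lemma sq_integrable_le (f g : T -> R) : measurable_fun setT g ->
  (forall x, `|g x| <= `|f x|) -> sq_integrable P f -> sq_integrable P g.
Proof.
move=> mg gf sf; apply/(sq_integrable_ltP P mg).
have /(sq_integrable_ltP P sf.1) := sf; apply: le_lt_trans.
apply: ge0_le_integral => //.
- by move=> w _; rewrite lee_fin sqr_ge0.
- by apply/measurable_EFinP; exact: measurable_funX.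
- by apply/measurable_EFinP; apply: measurable_funX; exact: sf.1.
- move=> w _; rewrite lee_fin -(real_normK (num_real (g _))).
  by rewrite -[leRHS](real_normK (num_real _)) ler_pXn2r ?nnegrE.
Qed.

Lemma sq_integrable_pos (f : T -> R) : sq_integrable P f ->
  sq_integrable P (fun x => Num.max (f x) 0).
Proof.
move=> sf; apply: (sq_integrable_le _ _ sf) => [|x].
  by apply: measurable_maxr => //; exact: sf.1.
by rewrite ger0_norm ?ge_max ?normr_ge0 ?ler_norm// le_max lexx orbT.
Qed.

Lemma sq_integrable_indic (E : set T) : measurable E -> sq_integrable P (\1_E).
Proof.
move=> mE; apply: (@sq_integrable_bounded _ 1) => // x.
by rewrite indicE; case: (_ \in _); rewrite ?normr1 ?normr0.
Qed.

Lemma sq_integrable_indicM (E : set T) (f : T -> R) : measurable E ->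
  sq_integrable P f -> sq_integrable P (fun x => \1_E x * f x).
Proof.
move=> mE; apply: (@sq_integrable_mul_bounded _ _ _ _ _ _ 1) => // x.
by rewrite indicE; case: (_ \in _); rewrite ?normr1 ?normr0.
Qed.

Lemma inner_indicM_le (E : set T) (f : T -> R) : measurable E ->
  sq_integrable P f ->
  inner P (fun x => \1_E x * f x) (fun x => \1_E x * f x) <= inner P f f.
Proof.
move=> mE sf; apply: le_Rintegral => //.
- by apply: integrable_mul; exact: sq_integrable_indicM.
- exact: integrable_mul.
- move=> x _; rewrite indicE; case: (_ \in _); rewrite ?mul1r// mul0r mul0r.
  by rewrite -expr2 sqr_ge0.
Qed.

Lemma integral_inner_indic (E : set T) (f : T -> R) : measurable E ->
  sq_integrable P f -> (\int[P]_(x in E) (f x)%:E = (inner P \1_E f)%:E)%E.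
Proof.
move=> mE sf; have iE := integrable_mul (sq_integrable_indic mE) sf.
rewrite /inner /Rintegral fineK; last exact: integrable_fin_num iE.
rewrite [LHS]integral_mkcond; apply: eq_integral => x _.
by rewrite patchE indicE; case: (_ \in _); rewrite ?mul1r ?mul0r.
Qed.

End bounded.

Lemma max0_subE {R : realDomainType} (x : R) : x = Num.max x 0 - Num.max (- x) 0.
Proof.
have [x0|/ltW x0] := leP x 0.
  by rewrite (@max_l _ _ (- x) 0) ?oppr_ge0// sub0r opprK.
by rewrite (@max_r _ _ (- x) 0) ?oppr_le0// subr0.
Qed.

Section brownian.
Context {R : realType} {d : measure_display} {Omega : measurableType d}.
Variable P : probability Omega R.
Hypothesis hP : measure_is_complete P.
Variable W : R -> Omega -> R.
Hypothesis hW : brownian_motion P W.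

Notation NF := (natural_filtration W).
Notation F := (usual_augmentation P NF).

Lemma measurable_brownian (s : R) : 0 <= s -> measurable_fun setT (W s).
Proof. by case: hW => h _ _ _ _; exact: h. Qed.

Lemma natural_filtration_measurable (s : R) : NF s `<=` measurable.
Proof.
apply: smallest_sub; first exact: sigma_algebra_measurable.
move=> A [u]; rewrite /= in_itv/= => /andP[u0 us] [B mB <-].
by apply: measurable_brownian.
Qed.

Lemma augmentation_le (s u : R) : s <= u -> F s `<=` F u.
Proof. by move=> su E h v /= uv; apply: h; rewrite /= (le_lt_trans su). Qed.

Lemma augmentation_measurable (s : R) : F s `<=` measurable.
Proof.
move=> E /(_ (s + 1)); rewrite /= ltrDl ltr01 => /(_ isT).
move: E; apply: smallest_sub; first exact: sigma_algebra_measurable.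
by move=> A [|] ; [exact: natural_filtration_measurable|exact: hP].
Qed.

(** The sets that agree almost everywhere with a member of [NF s] form a sigma-algebra. It contains
    [NF s], and every null set through the empty set. *)
Lemma augmented_ae (s : R) (E : set Omega) :
  <<s NF s `|` [set N | P.-negligible N] >> E ->
  exists2 E', NF s E' & {ae P, forall w, E w <-> E' w}.
Proof.
move: E; apply: smallest_sub; first split.
- by exists set0; [exact: sigma_algebra0|exact: aeW].
- move=> A [A' sA' AA']; exists (~` A').
    by rewrite -setTD; exact: sigma_algebraCD.
  apply: filterS AA' => w AA'; rewrite /= /setD/=; tauto.
- move=> A hA; have /choice[A' hA'] : forall i, exists A', NF s A' /\
      {ae P, forall w, A i w <-> A' w}.
    by move=> i; have [A' ? ?] := hA i; exists A'.
  exists (\bigcup_i A' i).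
    by apply: sigma_algebra_bigcup => i; have [] := hA' i.
  have : {ae P, forall w, forall i, A i w <-> A' i w}.
    by apply/ae_foralln => i; have [] := hA' i.
  apply: filterS => w h; split=> -[i _ Ai]; exists i => //; exact/h.
- move=> A [sA|nA]; first by exists A => //; exact: aeW.
  exists set0; first exact: sigma_algebra0.
  by apply: negligibleS nA => w /= h; apply: contrapT => nAw; apply: h.
Qed.

(** The price of right-continuity: an event of the augmented filtration at [s] is compared with a
    natural one only at strictly later times [u]. *)
Lemma augmentation_ae (s u : R) (E : set Omega) : s < u -> <<s F s >> E ->
  exists2 E', NF u E' & {ae P, forall w, E w <-> E' w}.
Proof.
move=> su sE; apply: augmented_ae; move: E sE; apply: smallest_sub.
  exact: smallest_sigma_algebra.
by move=> E; exact.
Qed.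

Lemma brownian_law (s u : R) (h : R -> R) : 0 <= s -> s < u ->
  measurable_fun setT h -> (forall x, 0 <= h x) ->
  (\int[P]_w (h (W u w - W s w))%:E =
   \int[normal_prob 0 (Num.sqrt (u - s))]_x (h x)%:E)%E.
Proof.
move=> s0 su mh h0; case: hW => mW _ _ law _.
have u0 : 0 <= u by rewrite (le_trans s0)// ltW.
under eq_integral do rewrite -(mulr1 (h _)).
under [RHS]eq_integral do rewrite -(mulr1 (h _)).
have mD : measurable_fun setT (W u \- W s) by apply: measurable_funB; exact: mW.
have := @eq_integral_test _ _ _ _ _ _ _ P (normal_prob 0 (Num.sqrt (u - s)))
  (W u \- W s) id (cst 1) (cst 1) h; apply => //.
move=> D mD'; rewrite integral_cstE; last first.
  by rewrite -[X in measurable X]setTI; exact: mD.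
rewrite mul1e; apply: (etrans (law _ _ _ s0 su mD')).
rewrite preimage_id -[LHS]mul1e; apply/esym.
exact: (@integral_cstE _ _ _ (normal_prob 0 (Num.sqrt (u - s))) _ 1 mD').
Qed.

(** Independence read as the equality of two weighted laws of the increment, with weight [\1_E] on
    one side and the constant [P E] on the other; on preimages of Borel sets this is the
    independence clause. *)
Lemma brownian_indep (s u : R) (h : R -> R) (E : set Omega) : 0 <= s -> s < u ->
  NF s E -> measurable_fun setT h -> (forall x, 0 <= h x) ->
  (\int[P]_w (h (W u w - W s w) * \1_E w)%:E =
   P E * \int[P]_w (h (W u w - W s w))%:E)%E.
Proof.
move=> s0 su sE mh h0; case: hW => mW _ _ _ ind.
have u0 : 0 <= u by rewrite (le_trans s0)// ltW.
have mE := natural_filtration_measurable sE.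
have mD : measurable_fun setT (W u \- W s) by apply: measurable_funB; exact: mW.
have PE : (fine (P E))%:E = P E by rewrite fineK// fin_num_measure.
transitivity (\int[P]_w (h (W u w - W s w) * fine (P E))%:E)%E; last first.
  under eq_integral do rewrite EFinM muleC.
  rewrite ge0_integralZl ?PE//.
  - by apply/measurable_EFinP/measurableT_comp.
  - by move=> x _; rewrite lee_fin.
apply: (eq_integral_test (xi := h) (phi1 := W u \- W s) (phi2 := W u \- W s) (p1 := \1_E)
  (p2 := cst (fine (P E)))) => //.
  by move=> w; rewrite fine_ge0.
move=> D mD'.
have mDD : measurable ((W u \- W s) @^-1` D).
  by rewrite -[X in measurable X]setTI; exact: mD.
rewrite integral_indic// integral_cstE// PE -ind//.
Qed.

Lemma brownian_sqr (s u : R) : 0 <= s -> s <= u ->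
  (\int[P]_w ((W u w - W s w) ^+ 2)%:E = (u - s)%:E)%E.
Proof.
move=> s0; rewrite le_eqVlt => /predU1P[<-|su].
  rewrite subrr (eq_integral (cst 0%E)) ?integral0// => w _.
  by rewrite subrr expr0n.
rewrite (brownian_law (h := fun x => x ^+ 2))//; last first.
  by move=> x; exact: sqr_ge0.
by rewrite normal_prob_sqr ?sqr_sqrtr ?sqrtr_gt0 ?subr_gt0// subr_ge0 ltW.
Qed.

Lemma sq_integrable_brownian (s u : R) : 0 <= s -> s <= u ->
  sq_integrable P (W u \- W s).
Proof.
move=> s0 su; apply/sq_integrable_ltP.
  by apply: measurable_funB; apply: measurable_brownian => //; exact: le_trans su.
by rewrite brownian_sqr// ltry.
Qed.

Lemma inner_brownian (s u : R) : 0 <= s -> s <= u ->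
  inner P (W u \- W s) (W u \- W s) = u - s.
Proof.
move=> s0 su; apply: EFin_inj; rewrite -inner_sqE ?brownian_sqr//.
exact: sq_integrable_brownian.
Qed.

End brownian.

Section increments.
Context {R : realType} {d : measure_display} {Omega : measurableType d}.
Variable P : probability Omega R.
Hypothesis hP : measure_is_complete P.
Variable W : R -> Omega -> R.
Hypothesis hW : brownian_motion P W.

Notation NF := (natural_filtration W).
Notation F := (usual_augmentation P NF).

Definition adapted (s : R) (xi : Omega -> R) : Prop :=
  measurable_fun [set: g_sigma_algebraType (F s)] xi.

Lemma sigma_augmentation_measurable (s : R) :
  <<s F s >> `<=` @measurable _ Omega.
Proof.
apply: smallest_sub; first exact: sigma_algebra_measurable.
exact: (augmentation_measurable hP hW).
Qed.

Lemma adapted_measurable (s : R) (xi : Omega -> R) :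
  adapted s xi -> measurable_fun setT xi.
Proof.
move=> axi _ B mB.
by apply: (@sigma_augmentation_measurable s); exact: (axi measurableT _ mB).
Qed.

Lemma adapted_le (s u : R) (xi : Omega -> R) : s <= u ->
  adapted s xi -> adapted u xi.
Proof.
move=> su axi _ B mB.
have : <<s F s >> ([set: Omega] `&` xi @^-1` B) by exact: (axi measurableT _ mB).
by apply: sub_sigma_algebra2; exact: augmentation_le.
Qed.

Lemma adapted_brownian (s u : R) : 0 <= s -> s <= u -> adapted u (W s).
Proof.
move=> s0 su _ B mB; apply: sub_sigma_algebra => v /= uv.
apply: sub_sigma_algebra; left; apply: sub_sigma_algebra.
exists s; first by rewrite /= in_itv/= s0 (le_trans su)// ltW.
by exists B.
Qed.

Lemma adaptedM (s : R) (xi eta : Omega -> R) :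
  adapted s xi -> adapted s eta -> adapted s (fun w => xi w * eta w).
Proof. exact: measurable_funM. Qed.

Lemma adaptedB (s : R) (xi eta : Omega -> R) :
  adapted s xi -> adapted s eta -> adapted s (xi \- eta).
Proof. exact: measurable_funB. Qed.

(** Independence is at hand for nonnegative functions of the increment, so the first moment is
    obtained from its positive and negative parts, which have equal integrals under the centred
    normal law. *)
Lemma natural_increment (s u : R) (E : set Omega) : 0 <= s -> s < u -> NF s E ->
  inner P \1_E (W u \- W s) = 0 /\
  inner P (fun w => \1_E w * (W u w - W s w)) (fun w => \1_E w * (W u w - W s w))
    = fine (P E) * (u - s).
Proof.
move=> s0 su sE; have mE := natural_filtration_measurable hW sE.
have sD := sq_integrable_brownian hW s0 (ltW su).
have mD := sD.1.
have PE : (fine (P E))%:E = P E by rewrite fineK// fin_num_measure.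
have s1E := sq_integrable_indic P mE.
split; last first.
  apply: EFin_inj; rewrite -inner_sqE; last exact: sq_integrable_indicM.
  rewrite EFinM PE -(brownian_sqr hW s0 (ltW su)) -(brownian_indep hW (h := fun x => x ^+ 2))//.
    apply: eq_integral => w _; rewrite exprMn mulrC; congr (_ * _)%:E.
    by rewrite indicE; case: (_ \in _); rewrite ?expr1n ?expr0n.
  by move=> x; exact: sqr_ge0.
have sp := sq_integrable_pos sD; have sm := sq_integrable_pos (sq_integrableN sD).
have -> : W u \- W s = (fun w => Num.max (W u w - W s w) 0) \-
    (fun w => Num.max (- (W u w - W s w)) 0).
  by apply/funext => w; exact: max0_subE.
rewrite innerBr//; apply/eqP; rewrite subr_eq0; apply/eqP.
rewrite /inner /Rintegral; congr fine.
under eq_integral do rewrite mulrC.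
under [RHS]eq_integral do rewrite mulrC.
have mh1 : measurable_fun setT (fun x : R => Num.max x 0) by exact: measurable_maxr.
have mh2 : measurable_fun setT (fun x : R => Num.max (- x) 0).
  by apply: measurable_maxr => //; exact: measurable_oppr.
have h0 (x : R) : 0 <= Num.max x 0 by rewrite le_max lexx orbT.
rewrite (brownian_indep hW s0 su sE mh1)// (brownian_indep hW s0 su sE mh2)//.
congr (_ * _)%E; rewrite (brownian_law hW s0 su mh1)//.
rewrite (brownian_law hW s0 su mh2)//; apply: normal_prob_pos_neg.
by rewrite sqrtr_gt0 subr_gt0.
Qed.

(* A set of the augmented sigma-algebra at time [s] agrees a.e. with a set of the
   natural one at any later time [v k], hence is independent of [W u - W (v k)];
   then let [v k] decrease to [s]. *)
Lemma augmented_increment (s u : R) (E : set Omega) : 0 <= s -> s < u ->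
  <<s F s >> E ->
  inner P \1_E (W u \- W s) = 0 /\
  inner P (fun w => \1_E w * (W u w - W s w)) (fun w => \1_E w * (W u w - W s w))
    = fine (P E) * (u - s).
Proof.
move=> s0 su sE.
have mE := sigma_augmentation_measurable sE.
(* The denominators start at 2, which keeps every [v k] strictly between [s] and [u]. *)
pose v (k : nat) := s + (u - s) / k.+2%:R.
have us0 : 0 < u - s by rewrite subr_gt0.
have sv k : s < v k by rewrite ltrDl divr_gt0.
have vu k : v k < u.
  by rewrite /v -ltrBrDl ltr_pdivrMr// ltr_pMr// ltr1n.
have v0 k : 0 <= v k by rewrite (le_trans s0)// ltW.
have cv : v k - s @[k --> \oo] --> (0 : R).
  have -> : (fun k => v k - s) = (fun k => (u - s) / k.+2%:R).
    by apply/funext => k; rewrite /v addrAC subrr add0r.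
  rewrite -[X in _ --> X](mulr0 (u - s)); apply: cvgMr.
  by have := @cvg_harmonic R; rewrite -(cvg_shiftS (harmonic : nat -> R)).
have sWs := sq_integrable_brownian hW s0 (ltW su).
have sWv k := sq_integrable_brownian hW (v0 k) (ltW (vu k)).
pose f w := \1_E w * (W u w - W s w).
pose g k w := \1_E w * (W u w - W (v k) w).
have sf : sq_integrable P f by exact: sq_integrable_indicM.
have sg k : sq_integrable P (g k) by exact: (sq_integrable_indicM mE (sWv k)).
(* The difference is minus [\1_E] times [W (v k) - W s], whose square norm is at most [v k - s]. *)
have gf : inner P (g k \- f) (g k \- f) @[k --> \oo] --> (0 : R).
  apply: (@squeeze_cvgr _ _ _ _ (fun=> 0) (fun k => v k - s)) => //.
    apply: nearW => k; rewrite inner_ge0/= -(inner_brownian hW s0 (ltW (sv k))).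
    have -> : g k \- f = (fun w => \1_E w * (- (W (v k) w - W s w))).
      by apply/funext => w; rewrite /f /g/=; ring.
    have sWvs := sq_integrable_brownian hW s0 (ltW (sv k)).
    have sN := sq_integrableN sWvs.
    apply: (le_trans (inner_indicM_le mE sN)).
    by rewrite innerNl// innerC innerNl// opprK.
  exact: cvg_cst.
have E' k : exists2 E', NF (v k) E' & {ae P, forall w, E w <-> E' w}.
  exact: augmentation_ae sE.
have ind_ae (A : set Omega) : {ae P, forall w, E w <-> A w} ->
    {ae P, forall w, \1_E w = \1_A w :> R}.
  apply: filterS => w EA; rewrite !indicE.
  suff -> : (w \in E) = (w \in A) by [].
  by apply/idP/idP; rewrite !inE => h; apply/EA.
have s1 (A : set Omega) := @sq_integrable_indic _ _ _ P A.
have h1 k : inner P \1_E (W u \- W (v k)) = 0.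
  have [A nA EA] := E' k; have mA := natural_filtration_measurable hW nA.
  have [<- _] := natural_increment (v0 k) (vu k) nA.
  by apply: inner_aeE => //; [exact: s1|exact: s1|exact: ind_ae|exact: aeW].
have h2 k : inner P (g k) (g k) = fine (P E) * (u - v k).
  have [A nA EA] := E' k; have mA := natural_filtration_measurable hW nA.
  have -> : P E = P A.
    have := ind_ae A EA; move=> h.
    rewrite -(setIT E) -(setIT A) -!integral_indic//.
    apply: ae_eq_integral => //; try exact/measurable_EFinP/measurable_indic.
    by apply: filterS h => w -> _.
  have [_ <-] := natural_increment (v0 k) (vu k) nA.
  have sA := sq_integrable_indicM mA (sWv k).
  have h : {ae P, forall w, g k w = \1_A w * (W u w - W (v k) w)}.
    by apply: filterS (ind_ae A EA) => w; rewrite /g => ->.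
  exact: (inner_aeE (sg k) (sg k) sA sA h h).
(* The first moment is the inner product with the constant 1, so L2 convergence carries it to the
   limit as well. *)
have c1 : inner P (cst 1) (g k) @[k --> \oo] --> inner P (cst 1) f.
  apply: inner_cvg => //; try by move=> *; exact: sq_integrable_cst.
  have -> : cst 1 \- cst 1 = cst 0 :> (Omega -> R).
    by apply/funext => w; rewrite /= subrr.
  by under eq_fun do rewrite inner0l; exact: cvg_cst.
have h1E k : inner P (cst 1) (g k) = 0.
  rewrite -(h1 k); apply: eq_Rintegral => w _; by rewrite /g mul1r.
split.
  have <- : inner P (cst 1) f = inner P \1_E (W u \- W s).
    by apply: eq_Rintegral => w _; rewrite /f mul1r.
  move: c1; under eq_fun do rewrite h1E; move=> c1.
  by apply/esym; apply: (cvg_unique _ _ c1) => //; exact: cvg_cst.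
have c2 := inner_cvg sg sg sf sf gf gf.
move: c2; under eq_fun do rewrite h2; move=> c2.
have c3 : fine (P E) * (u - v k) @[k --> \oo] --> fine (P E) * (u - s).
  apply: cvgMr.
  have -> : (fun k => u - v k) = (fun k => (u - s) - (v k - s)).
    by apply/funext => k; ring.
  rewrite -[X in _ --> X]subr0; apply: (@cvgB _ R^o) => //; exact: cvg_cst.
exact: (cvg_unique _ c2 c3).
Qed.

Lemma measurable_id_augmentation (s : R) :
  measurable_fun setT (id : Omega -> g_sigma_algebraType (F s)).
Proof.
move=> _ B mB; rewrite setTI preimage_id.
exact: (@sigma_augmentation_measurable s).
Qed.

(** On events of the sigma-algebra at [s], the positive and negative parts of the increment have the
    same integral. [eq_integral_test] extends this to nonnegative adapted functions, with these
    parts as the two densities; splitting [xi] does the rest. *)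
Lemma adapted_increment0 (s u : R) (xi : Omega -> R) : 0 <= s -> s <= u ->
  adapted s xi -> sq_integrable P xi -> inner P xi (W u \- W s) = 0.
Proof.
move=> s0; rewrite le_eqVlt => /predU1P[<-|su] axi sxi.
  have -> : W s \- W s = cst 0 by apply/funext => w; rewrite /= subrr.
  by rewrite innerC inner0l.
have sD := sq_integrable_brownian hW s0 (ltW su).
have sp := sq_integrable_pos sD; have sm := sq_integrable_pos (sq_integrableN sD).
have DE : W u \- W s = (fun w => Num.max (W u w - W s w) 0) \-
    (fun w => Num.max (- (W u w - W s w)) 0).
  by apply/funext => w; exact: max0_subE.
have h0 (x : R) : 0 <= Num.max x 0 by rewrite le_max lexx orbT.
have key (h : Omega -> R) : adapted s h -> (forall x, 0 <= h x) ->
    sq_integrable P h -> inner P h (W u \- W s) = 0.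
  move=> ah hge0 sh; rewrite DE innerBr//; apply/eqP; rewrite subr_eq0; apply/eqP.
  rewrite /inner /Rintegral; congr fine.
  have mid := @measurable_id_augmentation s.
  have := @eq_integral_test _ _ _ _ (g_sigma_algebraType (F s)) Omega Omega P P
    id id (fun w => Num.max (W u w - W s w) 0)
    (fun w => Num.max (- (W u w - W s w)) 0) h mid mid sp.1 sm.1; apply => //.
  move=> E mE; have sE : <<s F s >> E by [].
  have mE' := sigma_augmentation_measurable sE.
  rewrite !preimage_id !integral_inner_indic//; congr EFin.
  have [h1 _] := augmented_increment s0 su sE.
  apply/eqP; rewrite -subr_eq0 -innerBr// -?DE; first exact/eqP.
  exact: sq_integrable_indic.
have axp : adapted s (fun w => Num.max (xi w) 0) by exact: measurable_maxr.
have axm : adapted s (fun w => Num.max (- xi w) 0).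
  apply: measurable_maxr => //; exact: measurable_funN.
have sxp := sq_integrable_pos sxi.
have sxm := sq_integrable_pos (sq_integrableN sxi).
have -> : xi = (fun w => Num.max (xi w) 0) \- (fun w => Num.max (- xi w) 0).
  by apply/funext => w; exact: max0_subE.
by rewrite innerBl// !key ?subrr.
Qed.

(** Boundedness of [xi] keeps [xi (W u - W s)] in L2 without fourth moments of the increment. It
    also replaces the splitting of [xi] by its sign: [xi + M] and [M] are nonnegative, and their two
    identities are subtracted. *)
Lemma adapted_increment_sqr (s u M : R) (xi : Omega -> R) : 0 <= s -> s <= u ->
  adapted s xi -> (forall w, `|xi w| <= M) ->
  inner P (fun w => xi w * (W u w - W s w)) (W u \- W s) =
  (u - s) * inner P (cst 1) xi.
Proof.
move=> s0; rewrite le_eqVlt => /predU1P[<-|su] axi xiM.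
  have -> : W s \- W s = cst 0 by apply/funext => w; rewrite /= subrr.
  by rewrite innerC inner0l subrr mul0r.
have sD := sq_integrable_brownian hW s0 (ltW su).
have mD2 : measurable_fun setT (fun w => (W u w - W s w) ^+ 2).
  by apply: measurable_funX; exact: sD.1.
have us0 : 0 <= u - s by rewrite subr_ge0 ltW.
have key (h : Omega -> R) (M' : R) : adapted s h -> (forall x, 0 <= h x) ->
    (forall w, `|h w| <= M') ->
    inner P (fun w => h w * (W u w - W s w)) (W u \- W s) =
    (u - s) * inner P (cst 1) h.
  move=> ah hge0 hM; have sh := sq_integrable_bounded P (adapted_measurable ah) hM.
  rewrite -innerZl//; last exact: sq_integrable_cst.
  rewrite /inner /Rintegral; congr fine.
  have mid := @measurable_id_augmentation s.
  under eq_integral do rewrite -mulrA -expr2.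
  under [RHS]eq_integral do rewrite mulr1 mulrC.
  have := @eq_integral_test _ _ _ _ (g_sigma_algebraType (F s)) Omega Omega P P
    id id (fun w => (W u w - W s w) ^+ 2) (cst (u - s)) h mid mid mD2; apply => //.
    by move=> w; rewrite sqr_ge0.
  move=> E mE; have sE : <<s F s >> E by [].
  have mE' := sigma_augmentation_measurable sE.
  rewrite !preimage_id integral_cstE//.
  have [_ h2] := augmented_increment s0 su sE.
  have sED := sq_integrable_indicM mE' sD.
  apply: (@etrans _ _ ((u - s)%:E * (fine (P E))%:E)%E); last first.
    by congr (_ * _)%E; rewrite fineK// fin_num_measure.
  rewrite -EFinM mulrC -h2 -inner_sqE// integral_mkcond; apply: eq_integral => w _.
  rewrite patchE indicE; case: (_ \in _); rewrite ?mul1r// mul0r expr0n//.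
(* The bound is evaluated at the default [point] of [Omega]. *)
have M0 : 0 <= M.
  by apply: le_trans (xiM point).
have sxi := sq_integrable_bounded P (adapted_measurable axi) xiM.
have sxD := sq_integrable_mul_bounded (adapted_measurable axi) xiM sD.
have s1 := sq_integrable_cst P 1.
have sMc := sq_integrable_cst P M.
have aM : adapted s (cst M) by exact: measurable_cst.
have aXM : adapted s (xi \+ cst M) by exact: measurable_funD.
have kM := key (cst M) M aM (fun=> M0).
have kX := key (xi \+ cst M) (M + M) aXM.
have XE : (fun w => (xi \+ cst M) w * (W u w - W s w)) =
    (fun w => xi w * (W u w - W s w)) \+ (fun w => M * (W u \- W s) w).
  by apply/funext => w /=; rewrite mulrDl.
rewrite XE innerDl// in kX; last exact: sq_integrableZ.
rewrite [inner P (cst 1) (_ \+ _)]innerC innerDl// !(innerC _ _ (cst 1)) in kX.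
rewrite mulrDr -kM in kX; last by move=> w; rewrite ger0_norm.
apply: (addIr _ (kX _ _)) => w /=.
  by have := xiM w; rewrite ler_norml => /andP[]; lra.
by apply: (le_trans (ler_normD _ _)); rewrite (ger0_norm M0) lerD2r.
Qed.

End increments.

(** * The Ito isometry *)

Section tensor.
Context {R : realType} {d1 d2 : measure_display}
  {T1 : measurableType d1} {T2 : measurableType d2}.
Variables (m1 : {sigma_finite_measure set T1 -> \bar R})
  (m2 : {sigma_finite_measure set T2 -> \bar R}).
Notation Q := (m1 \x m2)%E.

Lemma sq_integrable_tensor (f : T1 -> R) (g : T2 -> R) :
  sq_integrable m1 f -> sq_integrable m2 g ->
  sq_integrable Q (fun p => f p.1 * g p.2).
Proof.
move=> sf sg; have mfg : measurable_fun setT (fun p : T1 * T2 => f p.1 * g p.2).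
  by apply: measurable_funM; [apply: measurableT_comp sf.1 _|
    apply: measurableT_comp sg.1 _].
apply/(sq_integrable_ltP Q mfg).
rewrite fubini_tonelli1; last 2 first.
- by apply/measurable_EFinP; exact: measurable_funX.
- by move=> p; rewrite lee_fin sqr_ge0.
have -> : fubini_F m2 (fun p : T1 * T2 => ((f p.1 * g p.2) ^+ 2)%:E) =
    (fun x => (inner m2 g g)%:E * (f x ^+ 2)%:E)%E.
  apply/funext => x; rewrite /fubini_F -inner_sqE//= muleC.
  rewrite -ge0_integralZl//; last 3 first.
  - by apply/measurable_EFinP; apply: measurable_funX; exact: sg.1.
  - by move=> y _; rewrite lee_fin sqr_ge0.
  - by rewrite lee_fin sqr_ge0.
  by apply: eq_integral => y _; rewrite -EFinM exprMn.
rewrite ge0_integralZl//; last 3 first.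
- by apply/measurable_EFinP; apply: measurable_funX; exact: sf.1.
- by move=> x _; rewrite lee_fin sqr_ge0.
- by rewrite lee_fin inner_ge0.
by rewrite inner_sqE// -EFinM ltry.
Qed.

Lemma inner_tensor (f f' : T1 -> R) (g g' : T2 -> R) :
  sq_integrable m1 f -> sq_integrable m1 f' ->
  sq_integrable m2 g -> sq_integrable m2 g' ->
  inner Q (fun p => f p.1 * g p.2) (fun p => f' p.1 * g' p.2) =
  inner m1 f f' * inner m2 g g'.
Proof.
move=> sf sf' sg sg'.
have iQ := integrable_mul (sq_integrable_tensor sf sg) (sq_integrable_tensor sf' sg').
rewrite {1}/inner /Rintegral -integral12_prod_meas1//.
have -> : fubini_F m2 (fun p : T1 * T2 => (f p.1 * g p.2 * (f' p.1 * g' p.2))%:E) =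
    (fun x => (inner m2 g g')%:E * (f x * f' x)%:E)%E.
  apply/funext => x; rewrite /fubini_F/= muleC /inner /Rintegral fineK; last first.
    exact: integrable_fin_num (integrable_mul sg sg').
  rewrite -integralZl//; last exact: integrable_mul.
  by apply: eq_integral => y _; rewrite -EFinM; congr EFin; ring.
rewrite integralZl//; last exact: integrable_mul.
rewrite fineM//; last exact: integrable_fin_num (integrable_mul sf sf').
by rewrite mulrC.
Qed.

End tensor.

(** Length of the intersection of []a, b]] and []a', b']]; the maximum with 0 accounts for disjoint
    intervals. *)
Definition overlap {R : realType} (a b a' b' : R) : R :=
  Num.max 0 (Num.min b b' - Num.max a a').

Section overlap_theory.
Context {R : realType}.
Notation leb := (@lebesgue_measure R).

Lemma overlapC (a b a' b' : R) : overlap a b a' b' = overlap a' b' a b.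
Proof. by rewrite /overlap (minC b) (maxC a). Qed.

Lemma sq_integrable_itv (a b : R) : sq_integrable leb (\1_`]a, b] : R -> R).
Proof.
have mI : measurable (`]a, b] : set R) by exact: measurable_itv.
apply/sq_integrable_ltP; first exact: measurable_indic.
have -> : (\int[leb]_x ((\1_`]a, b] x : R) ^+ 2)%:E = leb `]a, b])%E.
  rewrite -[in RHS](setIT `]a, b]%classic) -integral_indic//.
  by apply: eq_integral => x _; rewrite indicE; case: (_ \in _);
    rewrite ?expr1n ?expr0n.
by rewrite lebesgue_measure_itv/=; case: ifP => // _; rewrite -EFinB ltry.
Qed.

Lemma inner_itv (a b a' b' : R) :
  inner leb (\1_`]a, b] : R -> R) (\1_`]a', b'] : R -> R) = overlap a b a' b'.
Proof.
have E : `]a, b]%classic `&` `]a', b']%classic =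
    `]Num.max a a', Num.min b b']%classic :> set R.
  apply/seteqP; split=> x /=; rewrite !in_itv/= gt_max le_min.
    by move=> [/andP[-> ->] /andP[-> ->]].
  by move=> /andP[/andP[-> ->] /andP[-> ->]].
transitivity (fine (leb (`]a, b]%classic `&` `]a', b']%classic))).
  rewrite /inner /Rintegral; congr fine.
  rewrite -(setIT (_ `&` _)) -integral_indic//; last first.
    by apply: measurableI; exact: measurable_itv.
  by apply: eq_integral => x _; rewrite indicI.
rewrite E lebesgue_measure_itv/= lte_fin /overlap.
case: ltP => h; first by rewrite /= (@max_r _ _ 0)// subr_ge0 ltW.
by rewrite /= (@max_l _ _ 0)// subr_le0.
Qed.

End overlap_theory.

(** * Covariances of stochastic integrals of simple processes *)

Section isometry.
Context {R : realType} {d : measure_display} {Omega : measurableType d}.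
Variable P : probability Omega R.
Hypothesis hP : measure_is_complete P.
Variable W : R -> Omega -> R.
Hypothesis hW : brownian_motion P W.

Notation NF := (natural_filtration W).
Notation F := (usual_augmentation P NF).
Notation leb := (@lebesgue_measure R).
Notation Q := (leb \x P)%E.
Notation adapted := (adapted P W).

Definition weighted (c : Omega -> R) (a b : R) (w : Omega) : R :=
  c w * (W b w - W a w).

Lemma sq_integrable_weighted (c : Omega -> R) (M a b : R) : 0 <= a -> a <= b ->
  adapted a c -> (forall w, `|c w| <= M) -> sq_integrable P (weighted c a b).
Proof.
move=> a0 ab ac cM; apply: (sq_integrable_mul_bounded _ cM).
  exact: (adapted_measurable hP hW ac).
exact: (sq_integrable_brownian hW).
Qed.

Lemma adapted_weighted (c : Omega -> R) (a b : R) : 0 <= a -> a <= b ->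
  adapted a c -> adapted b (weighted c a b).
Proof.
move=> a0 ab ac; apply: adaptedM; first exact: adapted_le ac.
apply: adaptedB; apply: adapted_brownian => //.
exact: le_trans ab.
Qed.

(** The weight [c] is moved over to [xi]: the product is again adapted at [a] and, as [c] is
    bounded, still in L2. *)
Lemma inner_weighted0 (xi c : Omega -> R) (M a b : R) : 0 <= a -> a <= b ->
  adapted a xi -> sq_integrable P xi ->
  adapted a c -> (forall w, `|c w| <= M) -> inner P xi (weighted c a b) = 0.
Proof.
move=> a0 ab axi sxi ac cM.
rewrite -(@adapted_increment0 _ _ _ _ hP _ hW a b (fun w => c w * xi w))//.
- by apply: eq_Rintegral => w _; rewrite /weighted/=; ring.
- exact: adaptedM.
- apply: (sq_integrable_mul_bounded _ cM) => //.
  exact: (adapted_measurable hP hW ac).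
Qed.

Lemma weightedD (c : Omega -> R) (a b e : R) :
  weighted c a e = weighted c a b \+ weighted c b e.
Proof. by apply/funext => w; rewrite /weighted/=; ring. Qed.

(** Cut the longer integral at [b]. Its later piece is orthogonal to whatever is known at [b], and
    the common piece is [adapted_increment_sqr] for the product of the two weights. *)
Lemma inner_weighted_start (c c' : Omega -> R) (M M' s b b' : R) :
  0 <= s -> s <= b -> b <= b' ->
  adapted s c -> (forall w, `|c w| <= M) ->
  adapted s c' -> (forall w, `|c' w| <= M') ->
  inner P (weighted c s b) (weighted c' s b') = (b - s) * inner P c c'.
Proof.
move=> s0 sb bb' ac cM ac' cM'.
have b0 : 0 <= b by rewrite (le_trans s0).
have ac'b : adapted b c' by exact: adapted_le ac'.
have s1 := sq_integrable_weighted s0 sb ac cM.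
have s2 := sq_integrable_weighted s0 sb ac' cM'.
have s3 := sq_integrable_weighted b0 bb' ac'b cM'.
have a1 := adapted_weighted s0 sb ac.
rewrite (weightedD c' s b b') innerC innerDl// (innerC _ (weighted c' b b')).
rewrite (inner_weighted0 b0 bb' a1 s1 ac'b cM') addr0.
have -> : inner P c c' = inner P (cst 1) (fun w => c w * c' w).
  by apply: eq_Rintegral => w _; rewrite /= mul1r.
rewrite -(@adapted_increment_sqr _ _ _ _ hP _ hW s b (M * M'))//.
- by apply: eq_Rintegral => w _; rewrite /weighted/=; ring.
- exact: adaptedM.
- by move=> w; rewrite normrM ler_pM.
Qed.

(** Whatever the first integral collects before [a'] belongs to the past of the second one and drops
    out; the remainder starts at the common time [a']. *)
Lemma inner_weighted_le (c c' : Omega -> R) (M M' a b a' b' : R) :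
  0 <= a -> a <= b -> a <= a' -> a' <= b' ->
  adapted a c -> (forall w, `|c w| <= M) ->
  adapted a' c' -> (forall w, `|c' w| <= M') ->
  inner P (weighted c a b) (weighted c' a' b') =
  overlap a b a' b' * inner P c c'.
Proof.
move=> a0 ab aa' ab' ac cM ac' cM'.
have a'0 : 0 <= a' by rewrite (le_trans a0).
have aca' : adapted a' c by exact: adapted_le ac.
have s1 := sq_integrable_weighted a0 ab ac cM.
have s2 := sq_integrable_weighted a'0 ab' ac' cM'.
rewrite /overlap (max_r aa'); have [ba'|a'b] := leP b a'.
  rewrite (inner_weighted0 a'0 ab' _ s1 ac' cM'); last first.
    by apply: (adapted_le ba'); exact: adapted_weighted.
  by rewrite max_l ?mul0r// subr_le0 ge_min ba'.
have s3 := sq_integrable_weighted a0 aa' ac cM.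
have s4 := sq_integrable_weighted a'0 (ltW a'b) aca' cM.
rewrite (weightedD c a a' b) innerDl//.
rewrite (inner_weighted0 a'0 ab' (adapted_weighted a0 aa' ac) s3 ac' cM') add0r.
rewrite max_r; last by rewrite subr_ge0 le_min ab' ltW.
have [bb'|/ltW b'b] := leP b b'.
  exact: (inner_weighted_start a'0 (ltW a'b) bb' aca' cM ac' cM').
rewrite innerC (innerC _ c).
exact: (inner_weighted_start a'0 ab' b'b ac' cM' aca' cM).
Qed.

Lemma inner_weighted (c c' : Omega -> R) (M M' a b a' b' : R) :
  0 <= a -> a <= b -> 0 <= a' -> a' <= b' ->
  adapted a c -> (forall w, `|c w| <= M) ->
  adapted a' c' -> (forall w, `|c' w| <= M') ->
  inner P (weighted c a b) (weighted c' a' b') =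
  overlap a b a' b' * inner P c c'.
Proof.
move=> a0 ab a'0 ab' ac cM ac' cM'; have [aa'|/ltW a'a] := leP a a'.
  exact: (inner_weighted_le a0 ab aa' ab' ac cM ac' cM').
rewrite innerC overlapC (innerC _ c).
exact: (inner_weighted_le a'0 ab' a'a ab ac' cM' ac cM).
Qed.

Section simple.
Variables (a b : R) (H : simple_process F a b).
Hypothesis a0 : 0 <= a.

Lemma sp_time_ge (i : nat) : (i <= sp_size H)%N -> a <= sp_time H i.
Proof.
elim: i => [_|i IH iH]; first by rewrite sp_time0.
by apply: (le_trans (IH (ltnW iH))); exact: sp_time_nondecreasing.
Qed.

Lemma sp_time_le (i : nat) : (i <= sp_size H)%N -> sp_time H i <= b.
Proof.
move=> iH; rewrite -[leRHS](sp_time_last H).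
suff h (k j : nat) : (j + k = sp_size H)%N -> sp_time H j <= sp_time H (sp_size H).
  by apply: (h (sp_size H - i)%N); rewrite subnKC.
elim: k j => [|k IH] j; first by rewrite addn0 => ->.
rewrite addnS -addSn => jk; apply: le_trans (IH _ jk).
by apply: sp_time_nondecreasing; rewrite -jk addSn ltnS leq_addr.
Qed.

Let t0 (i : 'I_(sp_size H)) : 0 <= sp_time H i.
Proof. by apply: (le_trans a0); apply: sp_time_ge; exact: ltnW. Qed.

Let tS (i : 'I_(sp_size H)) : sp_time H i <= sp_time H i.+1.
Proof. exact: sp_time_nondecreasing. Qed.

Lemma sp_integralE : sp_integral W H =
  (fun w => \sum_(i < sp_size H) weighted (sp_coef H i) (sp_time H i) (sp_time H i.+1) w).
Proof. by []. Qed.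

Lemma sq_integrable_sp_term (i : 'I_(sp_size H)) :
  sq_integrable P (weighted (sp_coef H i) (sp_time H i) (sp_time H i.+1)).
Proof.
have [M cM] := sp_coef_bounded (ltn_ord i).
exact: (sq_integrable_weighted (t0 i) (tS i) (sp_coef_measurable (ltn_ord i)) cM).
Qed.

Lemma sq_integrable_sp_integral : sq_integrable P (sp_integral W H).
Proof.
rewrite sp_integralE; apply: sq_integrable_sum => i _.
exact: sq_integrable_sp_term.
Qed.

Lemma inner_cst_sp_integral : inner P (cst 1) (sp_integral W H) = 0.
Proof.
rewrite sp_integralE inner_sumr; last 2 first.
- exact: sq_integrable_sp_term.
- exact: sq_integrable_cst.
apply: big1 => i _; have [M cM] := sp_coef_bounded (ltn_ord i).
apply: (inner_weighted0 (t0 i) (tS i) _ _ (sp_coef_measurable (ltn_ord i)) cM).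
  exact: measurable_cst.
exact: sq_integrable_cst.
Qed.

(** Each summand is written as a function of time multiplied by a function of chance, the shape that
    [inner_tensor] factorises. *)
Definition sp_uncurry (p : measurableTypeR R * Omega) : R :=
  \sum_(i < sp_size H) \1_`]sp_time H i, sp_time H i.+1] p.1 * sp_coef H i p.2.

Lemma sp_uncurryE (s : R) (w : Omega) : sp_uncurry (s, w) = sp_fun H s w.
Proof. by apply: eq_bigr => i _; rewrite mulrC. Qed.

Lemma sp_fun_out (s : R) (w : Omega) : s \notin `[a, b] -> sp_fun H s w = 0.
Proof.
move=> sab; apply: big1 => i _; rewrite indicE memNset ?mulr0//=.
apply: contra_not (negP sab); rewrite !in_itv/= => /andP[h1 h2].
rewrite (le_trans _ (ltW h1)) ?(le_trans h2)//.
  exact: sp_time_le.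
by apply: sp_time_ge; exact: ltnW.
Qed.

Lemma sq_integrable_sp_coef (i : 'I_(sp_size H)) : sq_integrable P (sp_coef H i).
Proof.
have [M cM] := sp_coef_bounded (ltn_ord i).
apply: (sq_integrable_bounded P _ cM).
exact: (adapted_measurable hP hW (sp_coef_measurable (ltn_ord i))).
Qed.

Lemma sq_integrable_sp_uncurry_term (i : 'I_(sp_size H)) : sq_integrable Q
  (fun p => \1_`]sp_time H i, sp_time H i.+1] p.1 * sp_coef H i p.2).
Proof.
apply: (sq_integrable_tensor (m1 := leb) (f := \1_`]sp_time H i, sp_time H i.+1])).
  exact: sq_integrable_itv.
exact: sq_integrable_sp_coef.
Qed.

Lemma sq_integrable_sp_uncurry : sq_integrable Q sp_uncurry.
Proof.
by apply: sq_integrable_sum => i _; exact: sq_integrable_sp_uncurry_term.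
Qed.

End simple.

(** The two partitions are unrelated and no common refinement is formed: summand by summand, the
    overlap of two time intervals is both the factor in the covariance of the weighted increments
    and the inner product of the two indicators. *)
Lemma inner_sp_integral (a b a' b' : R) (H : simple_process F a b)
    (H' : simple_process F a' b') : 0 <= a -> 0 <= a' ->
  inner P (sp_integral W H) (sp_integral W H') =
  inner Q (sp_uncurry H) (sp_uncurry H').
Proof.
move=> a0 a'0.
rewrite !sp_integralE inner_suml; last 2 first.
- exact: sq_integrable_sp_term.
- exact: sq_integrable_sp_integral.
rewrite /sp_uncurry inner_suml; last 2 first.
- exact: sq_integrable_sp_uncurry_term.
- exact: sq_integrable_sp_uncurry.
apply: eq_bigr => i _; rewrite inner_sumr; last 2 first.
- exact: sq_integrable_sp_term.
- exact: sq_integrable_sp_term.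
rewrite inner_sumr; last 2 first.
- exact: sq_integrable_sp_uncurry_term.
- exact: sq_integrable_sp_uncurry_term.
apply: eq_bigr => j _.
have [M cM] := sp_coef_bounded (ltn_ord i).
have [M' cM'] := sp_coef_bounded (ltn_ord j).
have t0 : 0 <= sp_time H i.
  by apply: (le_trans a0); apply: sp_time_ge; exact: ltnW.
have t'0 : 0 <= sp_time H' j.
  by apply: (le_trans a'0); apply: sp_time_ge; exact: ltnW.
have tS : sp_time H i <= sp_time H i.+1 by exact: sp_time_nondecreasing.
have t'S : sp_time H' j <= sp_time H' j.+1 by exact: sp_time_nondecreasing.
rewrite (inner_weighted t0 tS t'0 t'S (sp_coef_measurable (ltn_ord i)) cM
  (sp_coef_measurable (ltn_ord j)) cM') -inner_itv.
have s1 := sq_integrable_sp_coef i; have s2 := sq_integrable_sp_coef j.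
exact: (esym (inner_tensor (sq_integrable_itv _ _) (sq_integrable_itv _ _) s1 s2)).
Qed.

End isometry.

Lemma cauchy_schwarz {R : realType} {d : measure_display} {T : measurableType d}
    (mu : {measure set T -> \bar R}) (f g : T -> R) :
  sq_integrable mu f -> sq_integrable mu g ->
  inner mu f g ^+ 2 <= inner mu f f * inner mu g g.
Proof.
move=> sf sg; set c := inner mu f g.
have a0 := inner_ge0 mu f; have b0 := inner_ge0 mu g.
have [->|c0] := eqVneq c 0; first by rewrite expr0n/= mulr_ge0.
have nc : 0 < `|c| by rewrite normr_gt0.
rewrite -(real_normK (num_real c)).
have := a0; rewrite le_eqVlt => /predU1P[a00|ap]; last first.
  (* This weight turns the first term of [inner_le] into [|c|], which cancels one of the two copies
     on the left. *)
  have e0 : 0 < `|c| / inner mu f f by rewrite divr_gt0.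
  have := inner_le e0 sf sg; rewrite divfK ?gt_eqF// -/c mulr2n lerD2l => h.
  rewrite expr2 -ler_pdivlMr//; apply: (le_trans h); rewrite invf_div.
  by rewrite mulrAC.
(* If [f] has norm zero, only the term with [e^-1] survives; this weight makes it smaller than
   [|c|], a contradiction. *)
have e0 : 0 < (inner mu g g + 1) / `|c| by rewrite divr_gt0// ltr_wpDl.
have := inner_le e0 sf sg; rewrite -/c -a00 mulr0 add0r invf_div => h.
exfalso; have : `|c| / (inner mu g g + 1) * inner mu g g < `|c|.
  rewrite mulrAC -mulrA gtr_pMr// ltr_pdivrMr ?mul1r ?ltrDl//.
  by rewrite ltr_wpDl.
by rewrite ltNge => /negP; apply; apply: le_trans h; rewrite mulr2n lerDl.
Qed.

(** * Processes on a time window and their time integrals *)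

Section window.
Context {R : realType} {d : measure_display} {Omega : measurableType d}.
Variable P : probability Omega R.
Notation leb := (@lebesgue_measure R).
Notation Q := (leb \x P)%E.

(* Cutting a process off outside [a, b] makes it a function on the whole product
   space, so that L2([a, b] x Omega) needs no separate theory. *)
Definition window (a b : R) (X : R -> Omega -> R)
  (p : measurableTypeR R * Omega) : R := X p.1 p.2 * \1_`[a, b] p.1.

Lemma windowE (a b : R) (X : R -> Omega -> R) : window a b X =
  ((fun p => X p.1 p.2) : measurableTypeR R * Omega -> R) \_ (`[a, b] `*` setT).
Proof.
apply/funext => -[r w]; rewrite /window patchE indicE/=.
have -> : ((r, w) \in (`[a, b] `*` [set: Omega])) = (r \in (`[a, b]%classic : set R)).
  by apply/idP/idP; rewrite !inE/= => // -[].
by case: (_ \in _); rewrite ?mulr1 ?mulr0.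
Qed.

Lemma measurable_window (a b : R) (X : R -> Omega -> R) :
  measurable_fun setT (window a b X) <->
  measurable_fun (`[a, b] `*` setT)
    (fun p : measurableTypeR R * Omega => X p.1 p.2).
Proof.
have mD : measurable (`[a, b] `*` setT : set (measurableTypeR R * Omega)).
  by apply: measurableX => //; exact: measurable_itv.
by rewrite windowE; split=> /(measurable_restrictT _ mD).
Qed.

Lemma integral_window_sqr (a b : R) (X : R -> Omega -> R) :
  measurable_fun setT (window a b X) ->
  (\int[Q]_p ((window a b X p) ^+ 2)%:E =
   \int[P]_w \int[leb]_(s in `[a, b]) ((X s w) ^+ 2)%:E)%E.
Proof.
move=> mX; rewrite fubini_tonelli2; last 2 first.
- by apply/measurable_EFinP; exact: measurable_funX.
- by move=> p; rewrite lee_fin sqr_ge0.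
apply: eq_integral => w _; rewrite /fubini_G [RHS]integral_mkcond.
apply: eq_integral => s _; rewrite /window patchE indicE/=.
by case: (_ \in _); rewrite ?mulr1// mulr0 expr0n.
Qed.

End window.

Section time_integral.
Context {R : realType} {d : measure_display} {Omega : measurableType d}.
Variable P : probability Omega R.
Notation leb := (@lebesgue_measure R).
Notation Q := (leb \x P)%E.

Lemma sq_integrable_seg (a b : R) : sq_integrable leb (\1_`[a, b] : R -> R).
Proof.
have mI : measurable (`[a, b] : set R) by exact: measurable_itv.
apply/sq_integrable_ltP; first exact: measurable_indic.
have -> : (\int[leb]_x ((\1_`[a, b] x : R) ^+ 2)%:E = leb `[a, b])%E.
  rewrite -[in RHS](setIT `[a, b]%classic) -integral_indic//.
  by apply: eq_integral => x _; rewrite indicE; case: (_ \in _);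
    rewrite ?expr1n ?expr0n.
by rewrite lebesgue_measure_itv/=; case: ifP => // _; rewrite -EFinB ltry.
Qed.

Lemma inner_seg (a b : R) : a <= b ->
  inner leb (\1_`[a, b] : R -> R) (\1_`[a, b] : R -> R) = b - a.
Proof.
move=> ab; apply: EFin_inj; rewrite -inner_sqE; last exact: sq_integrable_seg.
have mI : measurable (`[a, b] : set R) by exact: measurable_itv.
have -> : (\int[leb]_x ((\1_`[a, b] x : R) ^+ 2)%:E = leb `[a, b])%E.
  rewrite -[in RHS](setIT `[a, b]%classic) -integral_indic//.
  by apply: eq_integral => x _; rewrite indicE; case: (_ \in _);
    rewrite ?expr1n ?expr0n.
rewrite lebesgue_measure_itv/= lte_fin; case: ltP => //.
move=> ba; have -> : a = b by apply/eqP; rewrite eq_le ab ba.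
by rewrite subrr.
Qed.

Variables (a b : R) (X : R -> Omega -> R).
Hypothesis ab : a <= b.
Hypothesis sX : sq_integrable Q (window a b X).

Lemma measurable_window_section (s : R) : measurable_fun setT (fun w => window a b X (s, w)).
Proof. by apply: measurableT_comp; [exact: sX.1|exact: measurable_pair1]. Qed.

Lemma measurable_window_path (w : Omega) :
  measurable_fun setT (fun s : measurableTypeR R => window a b X (s, w)).
Proof. by apply: measurableT_comp; [exact: sX.1|exact: measurable_pair2]. Qed.

Lemma integrable_window : Q.-integrable setT (EFin \o window a b X).
Proof.
have s1 : sq_integrable Q (fun p => \1_`[a, b] p.1 * cst 1 p.2).
  apply: (sq_integrable_tensor (m1 := leb) (f := \1_`[a, b])).
    exact: sq_integrable_seg.
  exact: sq_integrable_cst.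
have := integrable_mul sX s1; congr (_.-integrable _ _); apply/funext => p /=.
rewrite /window indicE; case: (_ \in _); rewrite ?mulr1 ?mulr0//= ?mulr1//.
Qed.

Lemma Rintegral_window (w : Omega) :
  \int[leb]_(s in `[a, b]) X s w = fine (\int[leb]_s (window a b X (s, w))%:E).
Proof.
rewrite /Rintegral; congr fine; rewrite integral_mkcond; apply: eq_integral => s _.
by rewrite patchE /window indicE; case: (_ \in _); rewrite ?mulr1 ?mulr0.
Qed.

Lemma ae_sq_integrable_path :
  {ae P, forall w, sq_integrable leb (fun s => window a b X (s, w))}.
Proof.
have := ae_integrable2 sX.2; apply: filterS => w h.
by split=> //; exact: measurable_window_path.
Qed.

Lemma ae_sq_integrable_section :
  {ae leb, forall s, sq_integrable P (fun w => window a b X (s, w))}.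
Proof.
have := ae_integrable1 sX.2; apply: filterS => s h.
by split=> //; exact: measurable_window_section.
Qed.

Lemma measurable_time_integral :
  measurable_fun setT (fun w => \int[leb]_(s in `[a, b]) X s w).
Proof.
under eq_fun do rewrite Rintegral_window.
apply: measurableT_comp => //.
exact: (measurable_fubini_G integrable_window).
Qed.

Lemma time_integral_inner (w : Omega) :
  \int[leb]_(s in `[a, b]) X s w =
  inner leb (fun s => window a b X (s, w)) (\1_`[a, b]).
Proof.
rewrite Rintegral_window /inner /Rintegral; congr fine; apply: eq_integral => s _.
by rewrite /window/= indicE; case: (_ \in _); rewrite ?mulr1 ?mulr0.
Qed.

(** Cauchy-Schwarz against the indicator of [[a, b]] along each path, then integration over [Omega].
    The paths are known to be square-integrable almost surely, so the integrands are compared almost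
    everywhere. *)
Lemma time_integral_sq_le :
  (\int[P]_w ((\int[leb]_(s in `[a, b]) X s w) ^+ 2)%:E <=
   ((b - a) * inner Q (window a b X) (window a b X))%:E)%E.
Proof.
rewrite EFinM -inner_sqE// fubini_tonelli2; last 2 first.
- by apply/measurable_EFinP; apply: measurable_funX; exact: sX.1.
- by move=> p; rewrite lee_fin sqr_ge0.
have mG : measurable_fun setT
    (fubini_G leb (fun p : measurableTypeR R * Omega => (window a b X p ^+ 2)%:E)).
  apply: measurable_fun_fubini_tonelli_G.
    by apply/measurable_EFinP; apply: measurable_funX; exact: sX.1.
  by move=> p; rewrite lee_fin sqr_ge0.
have G0 w : (0 <= fubini_G leb (fun p : measurableTypeR R * Omega => (window a b X p ^+ 2)%:E) w)%E.
  by apply: integral_ge0 => s _; rewrite lee_fin sqr_ge0.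
have ba0 : 0 <= b - a by rewrite subr_ge0.
have -> : ((b - a)%:E * \int[P]_w fubini_G leb
      (fun p : measurableTypeR R * Omega => (window a b X p ^+ 2)%:E) w =
    \int[P]_w ((b - a)%:E * fubini_G leb
      (fun p : measurableTypeR R * Omega => (window a b X p ^+ 2)%:E) w))%E.
  by rewrite ge0_integralZl// lee_fin.
apply: ae_ge0_le_integral => //.
- by move=> w _; rewrite lee_fin sqr_ge0.
- apply/measurable_EFinP; apply: measurable_funX.
  exact: measurable_time_integral.
- by move=> w _; rewrite mule_ge0// lee_fin.
- exact: measurable_funeM.
have := ae_sq_integrable_path; apply: filterS => w sw _.
rewrite time_integral_inner /fubini_G (inner_sqE sw) -EFinM lee_fin mulrC.
rewrite -(inner_seg ab); apply: cauchy_schwarz => //.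
exact: sq_integrable_seg.
Qed.

Lemma sq_integrable_time_integral :
  sq_integrable P (fun w => \int[leb]_(s in `[a, b]) X s w).
Proof.
apply/sq_integrable_ltP; first exact: measurable_time_integral.
exact: le_lt_trans time_integral_sq_le (ltry _).
Qed.

Lemma inner_time_integral_le :
  inner P (fun w => \int[leb]_(s in `[a, b]) X s w)
    (fun w => \int[leb]_(s in `[a, b]) X s w) <=
  (b - a) * inner Q (window a b X) (window a b X).
Proof.
rewrite -lee_fin -inner_sqE; first exact: time_integral_sq_le.
exact: sq_integrable_time_integral.
Qed.

End time_integral.

(** * Stochastic integrals as limits in L2 *)

Section ito.
Context {R : realType} {d : measure_display} {Omega : measurableType d}.
Variable P : probability Omega R.
Hypothesis hP : measure_is_complete P.
Variable W : R -> Omega -> R.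
Hypothesis hW : brownian_motion P W.

Notation NF := (natural_filtration W).
Notation F := (usual_augmentation P NF).
Notation leb := (@lebesgue_measure R).
Notation Q := (leb \x P)%E.

Lemma L2_process_window (a b : R) (X : R -> Omega -> R) : a <= b ->
  L2_process P F a b X -> sq_integrable Q (window a b X).
Proof.
move=> ab [pX fX].
have mX : measurable_fun setT (window a b X).
  apply/measurable_window.
  have /pX : a <= b <= b by rewrite ab lexx.
  set g := (fun p : measurableTypeR R * g_sigma_algebraType (F b) => X p.1 p.2).
  move=> mg.
  (* The identity, with the second factor viewed under the coarser sigma-algebra at [b]: progressive
     measurability at the last time gives joint measurability. *)
  pose phi (p : measurableTypeR R * Omega) :
    measurableTypeR R * g_sigma_algebraType (F b) := (p.1, p.2).
  have mphi : measurable_fun setT phi.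
    apply: measurable_fun_pair => //.
    apply: (measurableT_comp (f := (id : Omega -> g_sigma_algebraType (F b)))).
      exact: (@measurable_id_augmentation _ _ _ _ hP _ hW b).
    exact: measurable_snd.
  change (measurable_fun (`[a, b] `*` [set: Omega]) (g \o phi)).
  apply: (measurable_comp _ _ mg (measurable_funTS mphi)).
    by apply: measurableX => //; exact: measurable_itv.
  by move=> _ [p [pab _] <-].
by apply/(sq_integrable_ltP Q mX); rewrite integral_window_sqr.
Qed.

Lemma inner_cvg0 {d' : measure_display} {T : measurableType d'}
    (mu : {measure set T -> \bar R}) (f : nat -> T -> R) :
  (forall k, sq_integrable mu (f k)) ->
  (\int[mu]_x ((f k x) ^+ 2)%:E @[k --> \oo] --> 0)%E ->
  inner mu (f k) (f k) @[k --> \oo] --> (0 : R).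
Proof.
move=> sf; under eq_fun do rewrite inner_sqE//.
by move=> /fine_cvgP[].
Qed.

Lemma ito_approximation (a b : R) (X : R -> Omega -> R) (I : Omega -> R) :
  0 <= a -> a <= b -> is_ito_integral P F W a b X I ->
  sq_integrable P I /\
  exists H : nat -> simple_process F a b,
    inner Q (sp_uncurry (H k) \- window a b X) (sp_uncurry (H k) \- window a b X)
      @[k --> \oo] --> (0 : R) /\
    inner P (sp_integral W (H k) \- I) (sp_integral W (H k) \- I)
      @[k --> \oo] --> (0 : R).
Proof.
move=> a0 ab [LX mI [H [HX HI]]].
have sX := L2_process_window ab LX.
have sH k := sq_integrable_sp_integral hP hW (H k) a0.
have uE k : ('E_P[fun w => ((sp_integral W (H k) w - I w) ^+ 2)%R] =
  \int[P]_w ((sp_integral W (H k) w - I w) ^+ 2)%:E)%E by rewrite unlock.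
have mHI k : measurable_fun setT (sp_integral W (H k) \- I).
  by apply: measurable_funB => //; exact: (sH k).1.
(* [is_ito_integral] states that [I] is measurable; membership in L2 is inherited from one
   approximating integral at finite distance. *)
have [k0 hk0] : exists k, sq_integrable P (sp_integral W (H k) \- I).
  have : \forall k \near \oo, ('E_P[fun w => ((sp_integral W (H k) w - I w) ^+ 2)%R] < 1)%E.
    move/fine_cvgP : HI => [fin lim].
    move/cvgrPdist_lt : lim => /(_ _ ltr01); move: fin.
    apply: filterS2 => k fk; rewrite sub0r normrN => h.
    by rewrite -(fineK fk) lte_fin (le_lt_trans (ler_norm _)).
  move=> [k _ /(_ k (leqnn k)) h]; exists k.
  apply/(sq_integrable_ltP P (mHI k)).
  by move: h; rewrite (uE k) => /lt_trans; apply; rewrite ltry.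
have sI : sq_integrable P I.
  have -> : I = sp_integral W (H k0) \- (sp_integral W (H k0) \- I).
    by apply/funext => w /=; rewrite opprB addrC subrK.
  exact: sq_integrableB.
split=> //; exists H; split; apply: inner_cvg0.
- move=> k; apply: sq_integrableB => //.
  exact: (sq_integrable_sp_uncurry hP hW).
- suff -> : (fun k => \int[Q]_p (((sp_uncurry (H k) \- window a b X) p) ^+ 2)%:E)%E =
      (fun k => \int[P]_w \int[leb]_(s in `[a, b])
        ((sp_fun (H k) s w - X s w) ^+ 2)%:E)%E by exact: HX.
  apply/funext => k; rewrite fubini_tonelli2; last 2 first.
  + apply/measurable_EFinP; apply: measurable_funX; apply: measurable_funB.
      exact: (sq_integrable_sp_uncurry hP hW (H k)).1.
    exact: sX.1.
  + by move=> p; rewrite lee_fin sqr_ge0.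
  apply: eq_integral => w _; rewrite /fubini_G [RHS]integral_mkcond.
  apply: eq_integral => s _; rewrite patchE /window/= sp_uncurryE indicE.
  case: ifPn => sab; first by rewrite mulr1.
  rewrite sp_fun_out ?mulr0 ?subrr ?expr0n//; move: sab; rewrite notin_setE/=.
  by move/negP.
- by move=> k; exact: sq_integrableB.
- by move: HI; under eq_fun do rewrite uE.
Qed.

(** Both sides are limits of one sequence, the inner products of the simple approximants. The
    bilinear form with two different windows gives covariances between matrix entries and between
    different times. *)
Theorem ito_isometry (a b a' b' : R) (X X' : R -> Omega -> R) (I I' : Omega -> R) :
  0 <= a -> a <= b -> 0 <= a' -> a' <= b' ->
  is_ito_integral P F W a b X I -> is_ito_integral P F W a' b' X' I' ->
  inner P I I' = inner Q (window a b X) (window a' b' X').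
Proof.
move=> a0 ab a'0 ab' hI hI'.
have sX : sq_integrable Q (window a b X) by apply: L2_process_window => //; case: hI.
have sX' : sq_integrable Q (window a' b' X') by apply: L2_process_window => //; case: hI'.
have [sI [H [HX HI]]] := ito_approximation a0 ab hI.
have [sI' [H' [HX' HI']]] := ito_approximation a'0 ab' hI'.
have sH k := sq_integrable_sp_integral hP hW (H k) a0.
have sH' k := sq_integrable_sp_integral hP hW (H' k) a'0.
have sU k := sq_integrable_sp_uncurry hP hW (H k).
have sU' k := sq_integrable_sp_uncurry hP hW (H' k).
have c1 := inner_cvg sH sH' sI sI' HI HI'.
have := inner_cvg sU sU' sX sX' HX HX'.
under eq_fun do rewrite -(inner_sp_integral hP hW)//.
by move=> c2; exact: (cvg_unique _ c1 c2).
Qed.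

Lemma ito_mean0 (a b : R) (X : R -> Omega -> R) (I : Omega -> R) :
  0 <= a -> a <= b -> is_ito_integral P F W a b X I -> inner P (cst 1) I = 0.
Proof.
move=> a0 ab hI; have [sI [H [_ HI]]] := ito_approximation a0 ab hI.
have sH k := sq_integrable_sp_integral hP hW (H k) a0.
have s1 : sq_integrable P (cst 1) := sq_integrable_cst P 1.
have c1 : inner P (cst 1 \- cst 1) (cst 1 \- cst 1) @[_ --> \oo] --> (0 : R).
  have -> : cst 1 \- cst 1 = cst 0 :> (Omega -> R).
    by apply/funext => w; rewrite /= subrr.
  by rewrite inner0l; exact: cvg_cst.
have := inner_cvg (fun=> s1) sH s1 sI c1 HI.
under eq_fun do rewrite (inner_cst_sp_integral hP hW)//.
by move=> c2; apply/esym; apply: (cvg_unique _ _ c2) => //; exact: cvg_cst.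
Qed.

End ito.

(** * Real analysis *)

Section real_analysis.
Context {R : realType}.
Notation leb := (@lebesgue_measure R).

Lemma Rintegral_monomial (t s : R) (k : nat) : t <= s ->
  leb.-integrable `[t, s] (EFin \o (fun x => (x - t) ^+ k / k`!%:R)) /\
  \int[leb]_(r in `[t, s]) ((r - t) ^+ k / k`!%:R) =
    (s - t) ^+ k.+1 / k.+1`!%:R.
Proof.
move=> ts; have ck : continuous (fun x : R => (x - t) ^+ k / k`!%:R).
  move=> x; apply: cvgM; last exact: cvg_cst.
  apply: (cvg_comp (fun x => x - t) (fun x => x ^+ k)).
    by apply: (@cvgB _ R^o) => //; [exact: cvg_id|exact: cvg_cst].
  exact: exprn_continuous.
split.
  apply: continuous_compact_integrable; first exact: segment_compact.
  exact: continuous_subspaceT.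
move: ts; rewrite le_eqVlt => /predU1P[<-|ts].
  by rewrite set_itv1 Rintegral_set1 subrr expr0n/= mul0r.
pose G (x : R) := (x - t) ^+ k.+1 / k.+1`!%:R.
have dG (x : R) : is_derive x (1 : R) G ((x - t) ^+ k / k`!%:R).
  have -> : G = k.+1`!%:R^-1 \*: ((fun x : R => x - t) ^+ k.+1).
    by apply/funext => y; rewrite /G exprfctE/= mulrC.
  apply: is_derive_eq; rewrite /GRing.scale/= factS natrM.
  have : k`!%:R != 0 :> R by rewrite pnatr_eq0 -lt0n fact_gt0.
  have : k.+1%:R != 0 :> R by rewrite pnatr_eq0.
  move: (k`!%:R) (k.+1%:R) => F K K0 F0.
  by field; rewrite K0 F0.
have cG (x : R) : {for x, continuous G}.
  exact/differentiable_continuous/derivable1_diffP.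
rewrite /Rintegral (continuous_FTC2 (F := G))//.
- by rewrite -EFinB /= /G subrr expr0n/= mul0r subr0.
- exact: continuous_subspaceT.
- split; first by move=> x _; exact: ex_derive.
  + exact/cvg_at_right_filter/cG.
  + exact/cvg_at_left_filter/cG.
- by move=> x _; rewrite derive1E derive_val.
Qed.

(** Iterating the inequality bounds [phi s] by a fixed multiple of [(c (s - t))^k / k!] for every
    [k], and the terms of the exponential series tend to 0. As [phi] is merely integrable, iteration
    takes the place of a differential inequality. *)
Lemma gronwall0 (phi : R -> R) (c t T : R) : 0 <= c -> t <= T ->
  (forall s, t <= s <= T -> 0 <= phi s) ->
  leb.-integrable `[t, T] (EFin \o phi) ->
  (forall s, t <= s <= T -> phi s <= c * \int[leb]_(r in `[t, s]) phi r) ->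
  forall s, t <= s <= T -> phi s = 0.
Proof.
move=> c0 tT phi0 iphi hphi.
have isub s : t <= s <= T -> leb.-integrable `[t, s] (EFin \o phi).
  move=> /andP[ts sT]; apply: integrableS iphi => //.
  by apply: subset_itvl; rewrite bnd_simp.
(* The bound for [k = 0]: since [phi] is nonnegative, its integral only grows when the interval is
   enlarged to [[t, T]]. *)
pose L := c * \int[leb]_(r in `[t, T]) phi r.
have step k : forall s, t <= s <= T -> phi s <= L * (c ^+ k * ((s - t) ^+ k / k`!%:R)).
  elim: k => [|k IH] s tsT; have /andP[ts sT] := tsT.
    rewrite !expr0 fact0 invr1 !mulr1; apply: (le_trans (hphi s tsT)).
    rewrite ler_wpM2l// -subr_ge0 Rintegral_itvB//; [|by rewrite bnd_simp..].
    apply: Rintegral_ge0 => r /=; rewrite in_itv/= => /andP[sr rT].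
    by apply: phi0; rewrite rT andbT (le_trans ts)// ltW.
  apply: (le_trans (hphi s tsT)).
  have [ik Ik] := Rintegral_monomial k ts.
  have iLk : leb.-integrable `[t, s]
      (EFin \o (fun x => L * c ^+ k * ((x - t) ^+ k / k`!%:R))).
    have -> : EFin \o (fun x => L * c ^+ k * ((x - t) ^+ k / k`!%:R)) =
        (fun x => (L * c ^+ k)%:E * ((x - t) ^+ k / k`!%:R)%:E)%E.
      by apply/funext => r; rewrite /= EFinM.
    exact: integrableZl.
  have : \int[leb]_(r in `[t, s]) phi r <=
      \int[leb]_(r in `[t, s]) (L * c ^+ k * ((r - t) ^+ k / k`!%:R)).
    apply: le_Rintegral => //; first exact: isub.
    move=> r /=; rewrite in_itv/= => /andP[tr rs]; rewrite -mulrA.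
    by apply: IH; rewrite tr (le_trans rs).
  rewrite RintegralZl// Ik => /(ler_wpM2l c0)/le_trans; apply.
  by rewrite le_eqVlt; apply/orP; left; apply/eqP; rewrite (exprS c); ring.
move=> s tsT; apply/eqP; rewrite eq_le phi0// andbT.
have := @cvg_exp_coeff R (c * (s - t)).
have -> : exp_coeff (c * (s - t)) = (fun k => c ^+ k * ((s - t) ^+ k / k`!%:R)).
  by apply/funext => k; rewrite /exp_coeff/= exprMn mulrA.
move=> cv; have {}cv : L * (c ^+ k * ((s - t) ^+ k / k`!%:R)) @[k --> \oo] --> (0 : R).
  by rewrite -(mulr0 L); apply: cvgMr.
apply: (cvgr_to_ge cv); apply: nearW => k; exact: step.
Qed.

Lemma cvg_within_seq (f : R -> R) (t s : R) (u : nat -> R) :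
  {within `[t, +oo[, continuous f} -> t <= s -> (forall k, t <= u k) ->
  u k @[k --> \oo] --> s -> f (u k) @[k --> \oo] --> f s.
Proof.
move=> /subspace_continuousP cf ts tu us.
have /cf cfs : `[t, +oo[%classic s by rewrite /= in_itv/= ts.
apply: (cvg_comp _ _ _ cfs) => A; rewrite /within/= => nA.
have h : \forall k \near \oo, `[t, +oo[%classic (u k) -> A (u k) := us _ nA.
apply: filterS h => k /=; apply.
by rewrite in_itv/= tu.
Qed.

Lemma continuous_within_integrable (f : R -> R) (t s : R) :
  {within `[t, +oo[, continuous f} -> leb.-integrable `[t, s] (EFin \o f).
Proof.
move=> cf; apply: continuous_compact_integrable; first exact: segment_compact.
by apply: continuous_subspaceW cf; apply: subset_itvl.
Qed.

(** Countably many intervals are involved, so that for random paths the exceptional null sets can be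
    united. Were [f s] nonzero, [f] would keep its sign and half of its size just to the right of
    [s], and a short interval there would have a nonzero integral. *)
Lemma continuous_zero_integral (f : R -> R) (t s del : R) :
  {within `[t, +oo[, continuous f} -> t <= s -> 0 < del ->
  \int[leb]_(r in `[t, s]) f r = 0 ->
  (forall k : nat, \int[leb]_(r in `[t, s + del / k.+1%:R]) f r = 0) ->
  f s = 0.
Proof.
have key (g : R -> R) : {within `[t, +oo[, continuous g} -> t <= s -> 0 < del ->
    \int[leb]_(r in `[t, s]) g r = 0 ->
    (forall k : nat, \int[leb]_(r in `[t, s + del / k.+1%:R]) g r = 0) ->
    g s <= 0.
  move=> cg ts del0 I0 Ik; rewrite leNgt; apply/negP => gs0.
  have ig u := continuous_within_integrable u cg.
  have : \forall k \near \oo, forall r, s <= r <= s + del / k.+1%:R -> g s / 2 <= g r.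
    move/subspace_continuousP : cg => /(_ s); rewrite /= in_itv/= ts => /(_ isT).
    move/cvgrPdist_lt => /(_ (g s / 2)); rewrite divr_gt0// => /(_ isT).
    move=> /nbhs_ballP[e /= e0 he0].
    have he r : `|s - r| < e -> t <= r -> `|g s - g r| < g s / 2.
      by move=> sr tr; apply: he0 => //; rewrite /= in_itv/= tr.
    have : del * k.+1%:R^-1 @[k --> \oo] --> (0 : R).
      rewrite -[X in _ --> X](mulr0 del); apply: cvgMr; exact: cvg_harmonic.
    move/cvgrPdist_lt => /(_ _ e0); apply: filterS => k.
    rewrite sub0r normrN ger0_norm ?divr_ge0 ?ltW// => hk r /andP[sr rs].
    have : `|g s - g r| < g s / 2.
      apply: he; last exact: le_trans sr.
      rewrite distrC ger0_norm ?subr_ge0// ltrBlDl (le_lt_trans rs)//.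
      by rewrite ltrD2l.
    by rewrite ltr_norml => /andP[_]; lra.
  move=> [k _ /(_ k (leqnn k)) hk].
  pose u := s + del / k.+1%:R; have su : s < u by rewrite ltrDl divr_gt0.
  have := Rintegral_itvB (ig u) (a := BLeft t) (b := BRight u) (x := s).
  rewrite !bnd_simp ts (ltW su) Ik I0 subrr => /(_ isT isT) I0'.
  have isu : leb.-integrable `]s, u] (EFin \o g).
    by apply: integrableS (ig u) => //; apply: subset_itvr; rewrite bnd_simp.
  have : \int[leb]_(r in `]s, u]) (g s / 2) <= \int[leb]_(r in `]s, u]) g r.
    apply: le_Rintegral => //.
    - have cc : {within `[s, +oo[, continuous (cst (g s / 2))}.
        by apply: continuous_subspaceT => x; exact: cvg_cst.
      apply: integrableS (continuous_within_integrable u cc) => //.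
      by move=> r /=; rewrite !in_itv/= => /andP[/ltW -> ->].
    - move=> r /=; rewrite in_itv/= => /andP[sr ru].
      by apply: hk; rewrite ru ltW.
  have lsu : leb `]s, u]%classic = (u - s)%:E.
    by rewrite lebesgue_measure_itv/= lte_fin su -EFinB.
  rewrite -I0' Rintegral_cst// [X in fine X]lsu/= leNgt => /negP; apply.
  by rewrite mulr_gt0 ?subr_gt0 ?divr_gt0.
move=> cf ts del0 I0 Ik; apply/eqP; rewrite eq_le key//=.
have ig u := continuous_within_integrable u cf.
have IN u : \int[leb]_(r in `[t, u]) f r = 0 -> \int[leb]_(r in `[t, u]) (- f r) = 0.
  move=> I; under eq_Rintegral do rewrite -mulN1r.
  by rewrite RintegralZl// I mulr0.
rewrite -oppr_le0; apply: (key (fun x => - f x)) => //.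
- by move=> x; apply: (@cvgN _ R^o); exact: cf.
- exact: IN.
- by move=> k; exact: IN.
Qed.

(** A set of full measure meets every interval []s, s + e[]. The approach is from the right because
    it will be used for functions continuous on a half-line whose left end may be [s]. *)
Lemma ae_right_seq (Q : R -> Prop) (s T : R) : s < T ->
  {ae leb, forall r, Q r} ->
  exists u : nat -> R, [/\ forall k, s < u k < T, forall k, Q (u k) &
    u k @[k --> \oo] --> s].
Proof.
move=> sT aQ.
have ex (e : R) : 0 < e -> exists r, s < r < s + e /\ Q r.
  move=> e0; apply: contrapT => nex.
  have : leb.-negligible `]s, (s + e)[%classic.
    apply: negligibleS aQ => r /=; rewrite in_itv/= => sr Qr.
    by apply: nex; exists r.
  move=> /negligibleP/=; rewrite lebesgue_measure_itv/= lte_fin ltrDl e0.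
  move=> /(_ (measurable_itv _)) /eqP; rewrite -EFinB eqe addrAC subrr add0r.
  by rewrite gt_eqF.
have Ts : 0 < T - s by rewrite subr_gt0.
have /choice[u hu] : forall k : nat, exists r, s < r < s + (T - s) / k.+1%:R /\ Q r.
  by move=> k; apply: ex; rewrite divr_gt0.
exists u; split.
- move=> k; have [/andP[-> uk] _] := hu k; apply: (lt_le_trans uk).
  rewrite -lerBrDl ler_pdivrMr// ler_peMr ?ler1n// ltW//.
- by move=> k; have [] := hu k.
- apply: (@squeeze_cvgr _ _ _ _ (fun=> s) (fun k => s + (T - s) * k.+1%:R^-1)).
  + by apply: nearW => k; have [/andP[h1 h2] _] := hu k; rewrite !ltW.
  + exact: cvg_cst.
  + rewrite -[X in _ --> X]addr0 -[X in _ --> s + X](mulr0 (T - s)).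
    apply: (@cvgD _ R^o); first exact: cvg_cst.
    by apply: cvgMr; exact: cvg_harmonic.
Qed.

(* Each halving of [s, u] halves the bound on [g u - g s]. *)
Lemma le_of_quadratic_increment (g al : R -> R) (t T : R) :
  (forall s u, t <= s -> s <= u -> u < T -> g u - g s <= (u - s) * (al u - al s)) ->
  forall s u, t <= s -> s <= u -> u < T -> g u <= g s.
Proof.
move=> h.
have step k : forall s u, t <= s -> s <= u -> u < T ->
    g u - g s <= (2^-1) ^+ k * ((u - s) * (al u - al s)).
  elim: k => [|k IH] s u ts su uT; first by rewrite expr0 mul1r; exact: h.
  pose m := (s + u) / 2.
  have sm : s <= m by rewrite /m; lra.
  have mu : m <= u by rewrite /m; lra.
  have h1 := IH s m ts sm (le_lt_trans mu uT).
  have h2 := IH m u (le_trans ts sm) mu uT.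
  have -> : g u - g s = (g m - g s) + (g u - g m) by ring.
  apply: (le_trans (lerD h1 h2)); rewrite le_eqVlt; apply/orP; left; apply/eqP.
  by rewrite exprS /m; field.
move=> s u ts su uT; rewrite -subr_le0.
have : (2^-1) ^+ k * ((u - s) * (al u - al s)) @[k --> \oo] --> (0 : R).
  have half : `|2^-1| < 1 :> R by rewrite ger0_norm ?invf_lt1 ?ltr1n.
  have -> : (fun k => (2^-1) ^+ k * ((u - s) * (al u - al s))) =
      geometric ((u - s) * (al u - al s)) 2^-1.
    by apply/funext => k; rewrite /geometric/= mulrC.
  exact: cvg_geometric.
move=> cv; apply: (cvgr_to_ge cv); apply: nearW => k; exact: step.
Qed.

End real_analysis.

(** * The subspaces [U_k], [V_k] and the Kalman matrix *)

Section linear_algebra.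
Context {R : realType}.

Lemma limg_mulmxP {p q : nat} (M : 'M[R]_(p, q)) (v : 'cV[R]_p) :
  reflect (exists k, v = M *m k) (v \in limg (mulmx_lfun M)).
Proof.
apply: (iffP memv_imgP) => [[k _ ->]|[k ->]]; exists k; rewrite ?memvf ?lfunE//.
Qed.

Lemma memv_mulmx {p q : nat} (M : 'M[R]_(p, q)) (V : {vspace 'cV[R]_q}) v :
  v \in V -> M *m v \in (mulmx_lfun M @: V)%VS.
Proof. by move=> vV; apply/memv_imgP; exists v; rewrite ?lfunE. Qed.

Lemma dim_cV {n : nat} : \dim {:'cV[R]_n} = n.
Proof. by rewrite dimvf; exact: muln1. Qed.

Definition annihilates {n : nat} (x : 'rV[R]_n) (V : {vspace 'cV[R]_n}) :=
  forall v, v \in V -> x *m v = 0.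

Lemma annihilatesS {n : nat} (x : 'rV[R]_n) (V V' : {vspace 'cV[R]_n}) :
  (V <= V')%VS -> annihilates x V' -> annihilates x V.
Proof. by move=> /subvP VV' xV v vV; apply/xV/VV'. Qed.

Lemma annihilatesD {n : nat} (x : 'rV[R]_n) (V V' : {vspace 'cV[R]_n}) :
  annihilates x (V + V') <-> annihilates x V /\ annihilates x V'.
Proof.
split=> [h|[h1 h2] _ /memv_addP[v vV [v' vV' ->]]].
  by split; apply: annihilatesS h; [exact: addvSl|exact: addvSr].
by rewrite mulmxDr h1// h2// addr0.
Qed.

Lemma annihilates_img {n p : nat} (x : 'rV[R]_n) (M : 'M[R]_(n, p))
    (V : {vspace 'cV[R]_p}) :
  annihilates x (mulmx_lfun M @: V) <-> annihilates (x *m M) V.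
Proof.
split=> [h v vV|h _ /memv_imgP[v vV ->]].
  by rewrite -mulmxA; apply: h; exact: memv_mulmx.
by rewrite lfunE/= mulmxA; exact: h.
Qed.

Lemma annihilates_limg {n p : nat} (x : 'rV[R]_n) (M : 'M[R]_(n, p)) :
  annihilates x (limg (mulmx_lfun M)) <-> x *m M = 0.
Proof.
split=> [h|h v /limg_mulmxP[k ->]]; last by rewrite mulmxA h mul0mx.
apply/rowP => j; have : M *m delta_mx j 0 \in limg (mulmx_lfun M).
  by apply/limg_mulmxP; exists (delta_mx j 0).
by move=> /h; rewrite mulmxA -colE => /colP/(_ 0); rewrite !mxE.
Qed.

Lemma basis_mx {n : nat} (V : {vspace 'cV[R]_n}) :
  exists M : 'M[R]_(n, \dim V),
    (forall v, v \in V -> exists k, v = M *m k) /\ (forall k, M *m k \in V).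
Proof.
exists (\matrix_(i, j) (vbasis V)`_j i 0); split=> [v vV|k].
  exists (\col_j coord (vbasis V) j v); rewrite {1}(coord_vbasis vV).
  apply/colP => i; rewrite summxE !mxE; apply: eq_bigr => j _.
  by rewrite !mxE mulrC.
suff -> : \matrix_(i, j) (vbasis V)`_j i 0 *m k = \sum_j k j 0 *: (vbasis V)`_j.
  by apply: memv_suml => j _; apply: memvZ; apply: vbasis_mem; rewrite mem_nth// size_tuple.
apply/colP => i; rewrite summxE !mxE; apply: eq_bigr => j _.
by rewrite !mxE mulrC.
Qed.

Lemma factor_mx {n p q : nat} (M : 'M[R]_(n, p)) (N : 'M[R]_(n, q)) :
  (forall k : 'cV[R]_q, exists k', N *m k = M *m k') -> exists K, N = M *m K.
Proof.
move=> h; have [f hf] := @boolp.choice 'I_q 'cV[R]_p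
  (fun j k' => N *m delta_mx j 0 = M *m k') (fun j => h _).
exists (\matrix_(i, j) f j i 0); apply/matrixP => i j.
have /colP/(_ i) := hf j; rewrite -colE mxE => ->; rewrite !mxE.
by apply: eq_bigr => k _; rewrite mxE.
Qed.

(** A basis matrix of a proper subspace has rank below [n], hence a nonzero row in its left
    kernel. *)
Lemma annihilator_exists {n : nat} (V : {vspace 'cV[R]_n}) :
  V <> fullv -> exists2 x : 'rV[R]_n, x != 0 & annihilates x V.
Proof.
move=> Vf; have [M [VM MV]] := basis_mx V.
have : ~~ row_free M.
  apply/negP => /eqP fM; apply: Vf; apply/eqP.
  by rewrite eqEdim subvf dim_cV -[leqLHS]fM rank_leq_col.
rewrite -kermx_eq0 => /rowV0Pn[x /sub_kermxP xM x0]; exists x => // v /VM[k ->].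
by rewrite mulmxA xM mul0mx.
Qed.

(** A chain that still moves at [N] has moved at every earlier index, because it never restarts.
    Each move adds a dimension, so [S N.+1] would have dimension greater than [N]. *)
Lemma chain_stable {vT : vectType R} (S : nat -> {vspace vT}) (N : nat) :
  (\dim {:vT} <= N)%N -> (forall k, (S k <= S k.+1)%VS) ->
  (forall k, S k = S k.+1 -> S k.+1 = S k.+2) -> S N = S N.+1.
Proof.
move=> dN Sle Sst; apply/eqP; apply: contraT => SN.
have st k : (k <= N)%N -> S k != S k.+1.
  move=> kN; apply: contra SN => /eqP Sk.
  suff h j : S (k + j)%N = S (k + j).+1 by rewrite -(subnKC kN) h.
  by elim: j => [|j IH]; rewrite ?addn0// addnS; exact: Sst.
have dS k : (k <= N.+1)%N -> (k <= \dim (S k))%N.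
  elim: k => // k IH kN; apply: (leq_ltn_trans (IH (ltnW kN))).
  rewrite ltn_neqAle dimvS// andbT; apply: contra (st k kN) => /eqP dk.
  by rewrite eqEdim Sle dk leqnn.
have := leq_trans (dS N.+1 (leqnn _)) (leq_trans (dimvS (subvf (S N.+1))) dN).
by rewrite ltnn.
Qed.

(** * Stabilisation of the two chains and the rank condition *)

Section kalman.
Variables (n m : nat) (A Abar C Cbar : 'M[R]_n) (B Bbar : 'M[R]_(n, m)).
Notation V := (V_space A C B).
Notation U := (U_space A Abar C Cbar B Bbar).

Lemma V_space_le k : (V k <= V k.+1)%VS.
Proof.
elim: k => [|k IH] /=; first exact: addvSr.
by apply: addvS => //; apply: addvS; exact: limgS.
Qed.

Lemma U_space_le k : (U k <= U k.+1)%VS.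
Proof.
elim: k => [|k IH] /=; first exact: addvSr.
by apply: addvS => //; apply: addvS; apply: limgS => //; exact: V_space_le.
Qed.

Lemma V_space_stable k : (n.-1 <= k)%N -> V k = V k.+1.
Proof.
have st j : V j = V j.+1 -> V j.+1 = V j.+2.
  move=> h; rewrite -[V j.+2]/(mulmx_lfun A @: V j.+1 + mulmx_lfun C @: V j.+1
    + limg (mulmx_lfun B))%VS -h; exact: h.
have h0 : V n.-1 = V n.-1.+1.
  (* With the zero space in front, the count starts at dimension 0 and one index is gained; the form
     [n.-1.+1] also covers [n = 0]. *)
  pose S k := if k is k'.+1 then V k' else 0%VS.
  apply: (@chain_stable _ S n.-1.+1).
  - by rewrite dim_cV leqSpred.
  - by case=> [|j]; [exact: sub0v|exact: V_space_le].
  - case=> [|j] /= h; last exact: st.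
    by rewrite -h !limg0 !add0v.
move=> /subnKC <-; elim: (k - n.-1)%N => [|j IH]; first by rewrite addn0.
by rewrite addnS; exact: st.
Qed.

(* [V] is stationary from index [n - 1] on; from there [U] is an increasing chain
   that never moves again once it stops, so [n] further steps suffice. *)
Lemma U_space_stable : (0 < n)%N -> U (2 * n - 1) = U (2 * n).
Proof.
move=> n0; pose S k := U (n.-1 + k).
have -> : (2 * n - 1 = n.-1 + n)%N by lia.
have -> : (2 * n = n.-1 + n.+1)%N by lia.
apply: (@chain_stable _ S n).
- by rewrite dim_cV.
- by move=> k; rewrite /S addnS; exact: U_space_le.
move=> k; rewrite /S !addnS => h.
rewrite -[U (n.-1 + k).+2]/(mulmx_lfun (A + Abar) @: U (n.-1 + k).+1
  + mulmx_lfun (C + Cbar) @: V (n.-1 + k).+1 + limg (mulmx_lfun (B + Bbar)))%VS.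
by rewrite -h -V_space_stable ?leq_addr// -h.
Qed.

(** [V N] gathers the images of all blocks up to [N], since every step adds [V 0] again, whereas
    [calB k] alone holds the words of length [k]. The induction varies [x]: annihilating the image
    of a space under [A] means that [x A] annihilates the space. *)
Lemma annihilates_V_space (x : 'rV[R]_n) N :
  annihilates x (V N) <-> forall k, (k <= N)%N -> x *m calB A C B k = 0.
Proof.
elim: N x => [|N IH] x /=.
  rewrite annihilates_limg; split=> [h k|/(_ 0%N)]; last exact.
  by rewrite leqn0 => /eqP ->.
rewrite !annihilatesD annihilates_limg !annihilates_img !IH; split.
  move=> [[h1 h2] h3] [|k] //= kN.
  by rewrite mul_mx_row !mulmxA h1// h2// row_mx0.
move=> h; split; last exact: (h 0%N).
split=> k kN; have := h k.+1 kN; rewrite /= mul_mx_row !mulmxA => /eqP;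
  by rewrite row_mx_eq0 => /andP[/eqP h1 /eqP h2]; rewrite ?h1 ?h2.
Qed.

Lemma annihilates_U_space (x : 'rV[R]_n) N :
  annihilates x (U N) <->
  forall k, (k <= N)%N -> x *m calA A Abar C Cbar B Bbar k = 0.
Proof.
elim: N x => [|N IH] x /=.
  rewrite annihilates_limg; split=> [h k|/(_ 0%N)]; last exact.
  by rewrite leqn0 => /eqP ->.
rewrite !annihilatesD annihilates_limg !annihilates_img IH annihilates_V_space; split.
  move=> [[h1 h2] h3] [|k] //= kN.
  by rewrite mul_mx_row !mulmxA h1// h2// row_mx0.
move=> h; split; last exact: (h 0%N).
split=> k kN; have := h k.+1 kN; rewrite /= mul_mx_row !mulmxA => /eqP;
  by rewrite row_mx_eq0 => /andP[/eqP h1 /eqP h2]; rewrite ?h1 ?h2.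
Qed.

Lemma annihilates_kalman (x : 'rV[R]_n) N :
  annihilates x (U N) <-> x *m kalman_mx A Abar C Cbar B Bbar N.+1 = 0.
Proof.
rewrite annihilates_U_space /kalman_mx mul_mxrow; split=> [h|h k kN].
  rewrite -[RHS]mxrow0; by apply: eq_mxrow => k; apply: h; rewrite -ltnS ltn_ord.
have := congr1 (fun M => submxrow M (Ordinal (kN : (k < N.+1)%N))) h.
by rewrite mxrowK submxrow0.
Qed.

(** A subspace is everything, and a matrix has full row rank, exactly when no nonzero row
    annihilates it. The blocks [0] to [N] make up [kalman_mx] at [N.+1]. *)
Lemma U_space_full N : U N = fullv <->
  \rank (kalman_mx A Abar C Cbar B Bbar N.+1) = n.
Proof.
split=> [Uf|rk].
  apply/eqP; rewrite -[_ == _]/(row_free _) -kermx_eq0; apply/rowV0P => x.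
  move=> /sub_kermxP/(annihilates_kalman x N).2; rewrite Uf => h.
  apply/rowP => j; have /colP/(_ 0) := h (delta_mx j 0) (memvf _).
  by rewrite -colE !mxE.
apply: contrapT => /annihilator_exists[x x0].
move=> /(annihilates_kalman x N).1 xk; move/negP: x0; apply.
have fr : row_free (kalman_mx A Abar C Cbar B Bbar N.+1) by apply/eqP.
by rewrite -(mulmx_free_eq0 x fr) xk.
Qed.

End kalman.

End linear_algebra.

(** * Second moments of the solution *)

Section window_facts.
Context {R : realType} {d : measure_display} {Omega : measurableType d}.
Variable P : probability Omega R.
Notation leb := (@lebesgue_measure R).
Notation Q := (leb \x P)%E.
Implicit Types (a b : R) (X Y : R -> Omega -> R).

Lemma inner_cst11 : inner P (cst 1) (cst 1) = 1.
Proof.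
transitivity (\int[P]_(w in setT) (1 : R)).
  by apply: eq_Rintegral => w _; rewrite /= mulr1.
have PT : P setT = 1%E by exact: probability_setT.
by rewrite Rintegral_cst// mul1r [X in fine X]PT.
Qed.

Lemma windowE_in a b X (r : R) (w : Omega) : a <= r <= b ->
  window a b X (r, w) = X r w.
Proof. by move=> rab; rewrite /window indicE mem_set ?mulr1//= in_itv. Qed.

Lemma windowE_out a b X (r : R) (w : Omega) : ~~ (a <= r <= b) ->
  window a b X (r, w) = 0.
Proof.
move=> rab; rewrite /window indicE memNset ?mulr0//= in_itv/=.
exact/negP.
Qed.

Lemma windowD a b X Y :
  window a b (fun r w => X r w + Y r w) = window a b X \+ window a b Y.
Proof. by apply/funext => p; rewrite /window/= mulrDl. Qed.

Lemma windowN a b X : window a b (fun r w => - X r w) = \- window a b X.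
Proof. by apply/funext => p; rewrite /window/= mulNr. Qed.

Lemma windowZ a b (k : R) X :
  window a b (fun r w => k * X r w) = (fun p => k * window a b X p).
Proof. by apply/funext => p; rewrite /window/= mulrA. Qed.

Lemma window_sum (I : Type) (s : seq I) a b (X : I -> R -> Omega -> R) :
  window a b (fun r w => \sum_(i <- s) X i r w) =
  (fun p => \sum_(i <- s) window a b (X i) p).
Proof. by apply/funext => p; rewrite /window/= mulr_suml. Qed.

Lemma window_window a b a' b' X p : a <= a' -> b' <= b ->
  window a b X p * window a' b' X p = window a' b' X p * window a' b' X p.
Proof.
case: p => r w aa' bb'; have [h|h] := boolP (a' <= r <= b').
  have h' : a <= r <= b.
    by case/andP: h => h1 h2; rewrite (le_trans aa' h1) (le_trans h2).
  by rewrite !windowE_in.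
by rewrite [window a' b' _ _]windowE_out// !mulr0.
Qed.

Lemma expectation_time_integral_window a b X :
  Q.-integrable setT (EFin \o window a b X) ->
  measurable_fun setT (fun w => \int[leb]_(s in `[a, b]) X s w) /\
  \int[P]_w (\int[leb]_(s in `[a, b]) X s w) = \int[Q]_p window a b X p.
Proof.
move=> iX; have mG := measurable_fubini_G iX.
have mI : measurable_fun setT (fun w => \int[leb]_(s in `[a, b]) X s w).
  under eq_fun do rewrite Rintegral_window.
  by apply: measurableT_comp => //; exact: mG.
split=> //; apply: (congr1 fine).
rewrite -(integral21_prod_meas1 iX); apply: ae_eq_integral => //.
  exact/measurable_EFinP.
have := ae_integrable2 iX; apply: filterS => w iw _.
by rewrite Rintegral_window /fubini_G fineK//; exact: integrable_fin_num iw.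
Qed.

Lemma Rintegral_fubini a b X : Q.-integrable setT (EFin \o window a b X) ->
  \int[Q]_p window a b X p = \int[leb]_r \int[P]_w window a b X (r, w).
Proof.
move=> iX; apply: (congr1 fine); rewrite -(integral12_prod_meas1 iX).
have mF := measurable_fubini_F iX.
apply: ae_eq_integral => //.
- by apply/measurable_EFinP; apply: measurableT_comp.
- have := ae_integrable1 iX; apply: filterS => s iXs _.
  by rewrite fineK//; exact: integrable_fin_num iXs.
Qed.

Lemma integrable_sqr_window a b X Y : sq_integrable Q (window a b X) ->
  sq_integrable Q (window a b Y) ->
  Q.-integrable setT (EFin \o window a b (fun r w => X r w * Y r w)).
Proof.
move=> sX sY; have := integrable_mul sX sY.
congr (_.-integrable _ _); apply/funext => -[r w] /=.
by rewrite /window/= indicE; case: (_ \in _); rewrite ?mulr1 ?mulr0.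
Qed.

Lemma inner_windowE a b X Y :
  inner Q (window a b X) (window a b Y) =
  \int[Q]_p window a b (fun r w => X r w * Y r w) p.
Proof.
apply: eq_Rintegral => -[r w] _.
by rewrite /window/= indicE; case: (_ \in _); rewrite ?mulr1 ?mulr0.
Qed.

Lemma inner_window_fubini a b X :
  sq_integrable Q (window a b X) ->
  (forall r, a <= r <= b -> sq_integrable P (X r)) ->
  leb.-integrable `[a, b] (fun r => (inner P (X r) (X r))%:E) /\
  inner Q (window a b X) (window a b X) =
  \int[leb]_(r in `[a, b]) inner P (X r) (X r).
Proof.
move=> sX sXr; have iXX := integrable_sqr_window sX sX.
have FE : fubini_F P (EFin \o window a b (fun r w => X r w * X r w)) =
    (fun r => (inner P (X r) (X r))%:E) \_ `[a, b].
  apply/funext => r; rewrite /fubini_F patchE; case: ifPn => rab.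
    rewrite inE/= in_itv/= in rab.
    rewrite -inner_sqE; last exact: sXr.
    by apply: eq_integral => w _; rewrite /= windowE_in// expr2.
  rewrite notin_setE/= in_itv/= in rab.
  rewrite integral0_eq// => w _ /=; rewrite windowE_out//; exact/negP.
have iF := integrable_fubini_F iXX; rewrite FE in iF.
split.
  by apply/integrable_mkcond.
rewrite inner_windowE /Rintegral -(integral12_prod_meas1 iXX) FE.
by rewrite -integral_mkcond.
Qed.

(** Additivity of the time integral of the second moment. It is run on the extended-valued [e],
    which makes sense at every time, whether or not the section there is square-integrable. *)
Lemma inner_window_split a b c X : a <= b -> b <= c ->
  sq_integrable Q (window a c X) ->
  sq_integrable Q (window a b X) -> sq_integrable Q (window b c X) ->
  inner Q (window b c X) (window b c X) =
  inner Q (window a c X) (window a c X) - inner Q (window a b X) (window a b X).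
Proof.
move=> ab bc sac sab sbc; apply/eqP; rewrite eq_sym subr_eq; apply/eqP.
pose e (r : R) := (\int[P]_w ((X r w) ^+ 2)%:E)%E.
have E x y : x <= y -> sq_integrable Q (window x y X) ->
    measurable_fun (`[x, y] : set R) e /\
    (\int[leb]_(r in `[x, y]) e r)%E = (inner Q (window x y X) (window x y X))%:E.
  move=> xy sxy.
  have msq : measurable_fun setT (fun p => ((window x y X p) ^+ 2)%:E).
    by apply/measurable_EFinP; apply: measurable_funX; exact: sxy.1.
  have sq0 p : (0 <= ((window x y X p) ^+ 2)%:E)%E by rewrite lee_fin sqr_ge0.
  have FE : fubini_F P (fun p => ((window x y X p) ^+ 2)%:E) = e \_ `[x, y].
    apply/funext => r; rewrite /fubini_F patchE; case: ifPn => rab.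
      rewrite inE/= in_itv/= in rab.
      by apply: eq_integral => w _; rewrite /= windowE_in.
    rewrite notin_setE/= in_itv/= in rab.
    rewrite integral0_eq// => w _ /=; rewrite windowE_out ?expr0n//; exact/negP.
  split.
    have mI : measurable (`[x, y] : set R) by exact: measurable_itv.
    apply/(measurable_restrictT e mI); rewrite -FE.
    exact: measurable_fun_fubini_tonelli_F.
  rewrite -inner_sqE// fubini_tonelli1// FE.
  by rewrite -integral_mkcond.
have e0 r : (0 <= e r)%E by apply: integral_ge0 => w _; rewrite lee_fin sqr_ge0.
have [m1 e1] := E _ _ (le_trans ab bc) sac.
have [m2 e2] := E _ _ ab sab.
have [m3 e3] := E _ _ bc sbc.
apply: EFin_inj; rewrite EFinD -e1 -e2 -e3.
have -> : `[a, c]%classic = `[a, b]%classic `|` `]b, c]%classic :> set R.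
  by rewrite -itv_bndbnd_setU ?bnd_simp.
have m4 : measurable_fun (`]b, c] : set R) e.
  by apply: measurable_funS m3 => //; apply: subset_itvr; rewrite bnd_simp.
rewrite ge0_integral_setU//.
- by rewrite addeC integral_itv_obnd_cbnd.
- by rewrite -itv_bndbnd_setU ?bnd_simp.
- apply/disj_setPS => r [/=]; rewrite !in_itv/= => /andP[_ rb] /andP[].
  by rewrite ltNge rb.
Qed.

Lemma inner_window_ae0 a b X : sq_integrable Q (window a b X) ->
  inner Q (window a b X) (window a b X) = 0 ->
  {ae leb, forall r : R, {ae P, forall w, window a b X (r, w) = 0}}.
Proof.
move=> sX X0.
have msq : measurable_fun setT (fun p => ((window a b X p) ^+ 2)%:E).
  by apply/measurable_EFinP; apply: measurable_funX; exact: sX.1.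
have sq0 p : (0 <= ((window a b X p) ^+ 2)%:E)%E by rewrite lee_fin sqr_ge0.
have := inner_sqE sX; rewrite X0 fubini_tonelli1// => F0.
have mF : measurable_fun setT (fubini_F P (fun p => ((window a b X p) ^+ 2)%:E)).
  exact: measurable_fun_fubini_tonelli_F.
have F_ge0 r : (0 <= fubini_F P (fun p => ((window a b X p) ^+ 2)%:E) r)%E.
  by apply: integral_ge0 => w _; exact: sq0.
have := (@ae_eq_integral_abs _ _ _ leb setT measurableT _ mF).1.
move=> /(_ _)/wrap[|].
  by rewrite -[RHS]F0; apply: eq_integral => r _; rewrite gee0_abs.
apply: filterS2 (ae_sq_integrable_section sX) => r sr /(_ I) Fr.
apply: inner_eq0_ae => //.
by apply: EFin_inj; rewrite -inner_sqE.
Qed.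

(** Jensen's inequality for the square, as Cauchy-Schwarz against the constant 1 at almost every
    time. *)
Lemma sq_integrable_mean a b X : sq_integrable Q (window a b X) ->
  sq_integrable leb (fun r => \int[P]_w window a b X (r, w)).
Proof.
move=> sX; have iX := integrable_window sX.
have mF := measurable_fubini_F iX.
have mM : measurable_fun setT (fun r => \int[P]_w window a b X (r, w)).
  by apply: measurableT_comp mF.
apply/(sq_integrable_ltP leb mM).
have msq : measurable_fun setT (fun p => ((window a b X p) ^+ 2)%:E).
  by apply/measurable_EFinP; apply: measurable_funX; exact: sX.1.
have sq0 p : (0 <= ((window a b X p) ^+ 2)%:E)%E by rewrite lee_fin sqr_ge0.
have /(sq_integrable_ltP Q sX.1) := sX; rewrite fubini_tonelli1//.
apply: le_lt_trans; apply: ae_ge0_le_integral => //.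
- by move=> r _; rewrite lee_fin sqr_ge0.
- by apply/measurable_EFinP; exact: measurable_funX.
- by move=> r _; apply: integral_ge0 => w _; exact: sq0.
- exact: measurable_fun_fubini_tonelli_F.
apply: filterS (ae_sq_integrable_section sX) => r sr _.
have s1 : sq_integrable P (cst 1) := sq_integrable_cst P 1.
rewrite /fubini_F (inner_sqE sr) lee_fin.
have := cauchy_schwarz s1 sr.
rewrite inner_cst11 mul1r; congr (_ ^+ 2 <= _).
by apply: eq_Rintegral => w _; rewrite /= mul1r.
Qed.

End window_facts.

Lemma continuous_Rintegral {R : realType} (f : R -> R) (t : R) :
  (forall s, t <= s -> lebesgue_measure.-integrable `[t, s] (EFin \o f)) ->
  {within `[t, +oo[, continuous (fun s => \int[lebesgue_measure]_(r in `[t, s]) f r)}.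
Proof.
move=> intf; apply/continuous_within_itvcyP; split.
  move=> s; rewrite in_itv/= andbT => ts.
  have ts1 : t < s + 1 by rewrite (lt_trans ts)// ltrDl.
  have := parameterized_integral_continuous (ltW ts1) (intf _ (ltW ts1)).
  move=> /(continuous_within_itvP _ ts1)[+ _ _] => /(_ s); apply.
  by rewrite in_itv/= ts ltrDl/=.
have t1 : t < t + 1 by rewrite ltrDl.
have := parameterized_integral_continuous (ltW t1) (intf _ (ltW t1)).
by move=> /(continuous_within_itvP _ t1)[_ + _].
Qed.

(** * Square-integrability and mean of the solution *)

Section solution.
Context {R : realType} {d : measure_display} {Omega : measurableType d}.
Variable P : probability Omega R.
Hypothesis hP : measure_is_complete P.
Variable W : R -> Omega -> R.
Hypothesis hW : brownian_motion P W.
Variables (n : nat) (A Abar C Cbar : 'M[R]_n) (t : R).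
Hypothesis t0 : 0 <= t.
Variable Phi : R -> Omega -> 'M[R]_n.
Hypothesis hPhi : mf_sde_solution P W A Abar C Cbar t Phi.

Notation NF := (natural_filtration W).
Notation F := (usual_augmentation P NF).
Notation leb := (@lebesgue_measure R).
Notation Q := (leb \x P)%E.
Notation mean r := (expect_mx P (Phi r)).

Lemma meanE r i j : mean r i j = \int[P]_w Phi r w i j.
Proof. by rewrite mxE unlock. Qed.

Lemma sq_integrable_window_Phi s i j : t <= s ->
  sq_integrable Q (window t s (fun r w => Phi r w i j)).
Proof.
by move=> ts; apply: (L2_process_window hP hW ts); case: hPhi => + _ _; exact.
Qed.

Lemma mean_window s r i j : t <= r <= s ->
  \int[P]_w window t s (fun r w => Phi r w i j) (r, w) = mean r i j.
Proof.
by move=> trs; rewrite meanE; apply: eq_Rintegral => w _; rewrite windowE_in.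
Qed.

Lemma sq_integrable_mean_seg s i j : t <= s ->
  sq_integrable leb (fun r => mean r i j * \1_`[t, s] r).
Proof.
move=> ts; have := sq_integrable_mean (sq_integrable_window_Phi i j ts).
congr sq_integrable; apply/funext => r; have [rts|rts] := boolP (t <= r <= s).
  by rewrite mean_window// indicE mem_set ?mulr1//= in_itv.
rewrite indicE memNset ?mulr0/= ?in_itv/=; last exact/negP.
by under eq_Rintegral do rewrite windowE_out//; rewrite /Rintegral integral0.
Qed.

Lemma sq_integrable_window_mean s i j : t <= s ->
  sq_integrable Q (window t s (fun r _ => mean r i j)).
Proof.
move=> ts; have s1 := sq_integrable_cst P 1.
have := sq_integrable_tensor (sq_integrable_mean_seg i j ts) s1.
by congr sq_integrable; apply/funext => p; rewrite mulr1.
Qed.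

Lemma mean_fieldE {p : nat} (M N : 'M[R]_(n, p)) r w i j :
  mean_field P Phi M N r w i j =
  \sum_(k < n) M k j * Phi r w i k + \sum_(k < n) N k j * mean r i k.
Proof.
rewrite !mxE; congr (_ + _); apply: eq_bigr => k _; rewrite mulrC//.
Qed.

Lemma sq_integrable_window_mean_field {p : nat} (M N : 'M[R]_(n, p)) s i j : t <= s ->
  sq_integrable Q (window t s (fun r w => mean_field P Phi M N r w i j)).
Proof.
move=> ts; have -> : (fun r w => mean_field P Phi M N r w i j) = (fun r w =>
    \sum_(k < n) M k j * Phi r w i k + \sum_(k < n) N k j * mean r i k).
  by apply/funext => r; apply/funext => w; rewrite mean_fieldE.
rewrite windowD; apply: sq_integrableD; rewrite window_sum;
  apply: sq_integrable_sum => k _; rewrite windowZ; apply: sq_integrableZ.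
- exact: sq_integrable_window_Phi.
- exact: sq_integrable_window_mean.
Qed.

Lemma sde_ito : exists I : R -> Omega -> 'M[R]_n,
  (forall s i j, t <= s -> is_ito_integral P F W t s
     (fun r w => - mean_field P Phi C Cbar r w i j) (fun w => I s w i j)) /\
  (forall s, t <= s -> {ae P, forall w, forall i j, Phi s w i j = 1%:M i j +
     \int[leb]_(r in `[t, s]) (- mean_field P Phi A Abar r w i j) + I s w i j}).
Proof.
case: hPhi => _ _ [I hI]; exists I; split=> s.
  move=> i j ts; have [+ _] := hI s ts => /(_ i j).
  have -> // : (fun r w => (- mean_field P Phi C Cbar r w) i j) =
    (fun r w => - mean_field P Phi C Cbar r w i j).
  by apply/funext => r; apply/funext => w; rewrite mxE.
move=> ts; have [_] := hI s ts; apply: filterS => w -> i j.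
rewrite !mxE; congr (_ + _ + _); apply: eq_Rintegral => r _; rewrite mxE//.
Qed.

Lemma sq_integrable_window_opp_mean_field {p : nat} (M N : 'M[R]_(n, p)) s i j :
  t <= s ->
  sq_integrable Q (window t s (fun r w => - mean_field P Phi M N r w i j)).
Proof.
move=> ts; rewrite windowN; apply: sq_integrableN.
exact: sq_integrable_window_mean_field.
Qed.

(** Membership in L2 of the product space speaks of almost every time only. At a given [s] the
    equation itself writes [Phi s] as a constant plus a time integral plus an Ito integral, each of
    them in L2. *)
Lemma sq_integrable_Phi s i j : t <= s -> sq_integrable P (fun w => Phi s w i j).
Proof.
move=> ts; have [I [hI hE]] := sde_ito.
have [sI _] := ito_approximation hP hW t0 ts (hI s i j ts).
have sD := sq_integrable_time_integral ts
  (sq_integrable_window_opp_mean_field A Abar i j ts).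
have sS := sq_integrableD (sq_integrableD (sq_integrable_cst P (1%:M i j)) sD) sI.
apply: (sq_integrable_ae _ sS).
  have := measurable_window_section (sq_integrable_window_Phi i j ts) s.
  by under eq_fun do rewrite windowE_in ?ts ?lexx//.
by have := hE s ts; apply: filterS => w ->.
Qed.

Lemma expectation_Phi s i j : t <= s ->
  \int[P]_w Phi s w i j = inner P (cst 1) (fun w => Phi s w i j).
Proof. by move=> ts; apply: eq_Rintegral => w _; rewrite /= mul1r. Qed.

Lemma expectation_mean_field {p : nat} (M N : 'M[R]_(n, p)) r i j : t <= r ->
  \int[P]_w mean_field P Phi M N r w i j = (mean r *m (M + N)) i j.
Proof.
move=> tr; have s1 := sq_integrable_cst P 1.
transitivity (inner P (cst 1) ((fun w => \sum_(k < n) M k j * Phi r w i k) \+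
    cst (\sum_(k < n) N k j * mean r i k))).
  by apply: eq_Rintegral => w _; rewrite /= mul1r mean_fieldE.
have sS : sq_integrable P (fun w => \sum_(k < n) M k j * Phi r w i k).
  by apply: sq_integrable_sum => k _; apply: sq_integrableZ; exact: sq_integrable_Phi.
rewrite innerC innerDl//; last exact: sq_integrable_cst.
rewrite inner_suml//; last first.
  by move=> k; apply: sq_integrableZ; exact: sq_integrable_Phi.
rewrite mulmxDr !mxE; congr (_ + _).
  apply: eq_bigr => k _; rewrite innerZl//; last exact: sq_integrable_Phi.
  by rewrite innerC -expectation_Phi// -meanE mulrC.
rewrite -[cst _](_ : (fun w => (\sum_(k < n) N k j * mean r i k) * cst 1 w) = _); last first.
  by apply/funext => w; rewrite mulr1.
rewrite innerZl// inner_cst11 mulr1; apply: eq_bigr => k _.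
by rewrite mulrC.
Qed.

Lemma sq_integrable_mean_field {p : nat} (M N : 'M[R]_(n, p)) r i j : t <= r ->
  sq_integrable P (fun w => mean_field P Phi M N r w i j).
Proof.
move=> tr; have -> : (fun w => mean_field P Phi M N r w i j) =
    (fun w => \sum_(k < n) M k j * Phi r w i k) \+
    cst (\sum_(k < n) N k j * mean r i k).
  by apply/funext => w; rewrite mean_fieldE.
apply: sq_integrableD; last exact: sq_integrable_cst.
by apply: sq_integrable_sum => k _; apply: sq_integrableZ; exact: sq_integrable_Phi.
Qed.

Lemma integrable_mean s i j : t <= s ->
  leb.-integrable `[t, s] (EFin \o (fun r => mean r i j)).
Proof.
move=> ts; have := integrable_mul (sq_integrable_mean_seg i j ts)
  (sq_integrable_seg t s).
have -> : (fun r => (mean r i j * \1_`[t, s] r * \1_`[t, s] r)%:E) =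
    (EFin \o (fun r => mean r i j)) \_ `[t, s].
  apply/funext => r; rewrite patchE indicE.
  by case: (_ \in _); rewrite ?mulr1 ?mulr0.
by move=> h; apply/integrable_mkcond.
Qed.

Lemma integrable_mean_mul {p : nat} (M : 'M[R]_(n, p)) s i j : t <= s ->
  leb.-integrable `[t, s] (EFin \o (fun r => (mean r *m M) i j)).
Proof.
move=> ts; have -> : EFin \o (fun r => (mean r *m M) i j) =
    (fun r => \sum_(k < n) ((M k j)%:E * (mean r i k)%:E))%E.
  apply/funext => r; rewrite /= mxE -sumEFin; apply: eq_bigr => k _.
  by rewrite mulrC EFinM.
apply: integrable_sum => // k _; apply: integrableZl => //.
exact: integrable_mean.
Qed.

(** Expectation of the equation: the Ito part has mean zero, Fubini exchanges expectation and drift,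
    and on the mean [A] and [Abar] act together. *)
Lemma mean_eq s i j : t <= s ->
  mean s i j = 1%:M i j - \int[leb]_(r in `[t, s]) (mean r *m (A + Abar)) i j.
Proof.
move=> ts; have [I [hI hE]] := sde_ito; have s1 := sq_integrable_cst P 1.
have [sI _] := ito_approximation hP hW t0 ts (hI s i j ts).
have I0 := ito_mean0 hP hW t0 ts (hI s i j ts).
have smf := sq_integrable_window_opp_mean_field A Abar i j ts.
have sD := sq_integrable_time_integral ts smf.
have sc := sq_integrable_cst P (1%:M i j).
have sS := sq_integrableD (sq_integrableD sc sD) sI.
rewrite meanE expectation_Phi//.
rewrite (inner_aeE s1 (sq_integrable_Phi i j ts) s1 sS (aeW _ (fun=> erefl))); last first.
  by have := hE s ts; apply: filterS => w ->.
have sm : sq_integrable P (cst (1%:M i j) \+ (fun w =>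
    \int[leb]_(r in `[t, s]) (- mean_field P Phi A Abar r w i j))).
  exact: sq_integrableD.
rewrite innerC innerDl// innerDl// !(innerC _ _ (cst 1)) I0 addr0.
congr (_ + _).
  transitivity (\int[P]_(w in setT) (1%:M i j : R)).
    by apply: eq_Rintegral => w _; rewrite /= mul1r.
  have PT : P setT = 1%E by exact: probability_setT.
  by rewrite Rintegral_cst// [X in fine X]PT mulr1.
have [_ h] := expectation_time_integral_window (integrable_window smf).
transitivity (\int[P]_w \int[leb]_(r in `[t, s]) (- mean_field P Phi A Abar r w i j)).
  by apply: eq_Rintegral => w _; rewrite /= mul1r.
rewrite h Rintegral_fubini; last exact: integrable_window.
rewrite -[in RHS]mulN1r -RintegralZl//; last exact: integrable_mean_mul.
rewrite [RHS]Rintegral_mkcond; apply: eq_Rintegral => r _; rewrite patchE.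
case: ifPn => rts; rewrite ?inE ?notin_setE/= in_itv/= in rts; last first.
  have rts' : ~~ (t <= r <= s) by exact/negP.
  under eq_Rintegral do rewrite windowE_out//.
  by rewrite /Rintegral integral0.
have /andP[tr rs] := rts.
rewrite -(expectation_mean_field A Abar i j tr) -RintegralZl//.
  by apply: eq_Rintegral => w _; rewrite windowE_in// mulN1r.
by apply: integrable_sq_integrable; exact: sq_integrable_mean_field.
Qed.

(** Path continuity does not pass to expectations without domination; the mean is continuous because
    [mean_eq] presents it as a constant minus an integral up to [s]. *)
Lemma continuous_mean i j : {within `[t, +oo[, continuous (fun s => mean s i j)}.
Proof.
have h : {within `[t, +oo[, continuous (fun s => 1%:M i j -
    \int[leb]_(r in `[t, s]) (mean r *m (A + Abar)) i j)}.
  move=> x; apply: (@cvgB _ R^o); first exact: cvg_cst.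
  by apply: continuous_Rintegral => s ts; exact: integrable_mean_mul.
apply: (subspace_eq_continuous _ h) => s.
by rewrite inE/= in_itv/= andbT => ts; exact: (esym (mean_eq i j ts)).
Qed.

End solution.

Lemma Rintegral_sum {R : realType} {d : measure_display} {T : measurableType d}
    (mu : {measure set T -> \bar R}) (I : Type) (r : seq I) (D : set T)
    (f : I -> T -> R) :
  measurable D -> (forall i, mu.-integrable D (EFin \o f i)) ->
  mu.-integrable D (EFin \o (fun x => \sum_(i <- r) f i x)) /\
  \int[mu]_(x in D) (\sum_(i <- r) f i x) =
  \sum_(i <- r) \int[mu]_(x in D) f i x.
Proof.
move=> mD fi; elim: r => [|k r [IH1 IH2]].
  split.
    have -> : EFin \o (fun u => \sum_(k <- [::]) f k u) = cst 0%E.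
      by apply/funext => u; rewrite /= big_nil.
    exact: integrable0.
  under eq_Rintegral do rewrite big_nil.
  by rewrite big_nil /Rintegral integral0.
split.
  have -> : EFin \o (fun u => \sum_(l <- k :: r) f l u) =
      (EFin \o f k) \+ (EFin \o (fun u => \sum_(l <- r) f l u)).
    by apply/funext => u; rewrite /= big_cons.
  exact: integrableD.
under eq_Rintegral do rewrite big_cons.
by rewrite RintegralD// IH2 big_cons.
Qed.

(** The scalar test of a matrix process: the row [x] stays fixed, while the column [v] absorbs the
    coefficients that multiply the process on the right. *)
Definition bracket {R : realType} {p q : nat} (x : 'rV[R]_p) (v : 'cV[R]_q)
  (M : 'M[R]_(p, q)) : R := (x *m M *m v) 0 0.

Section bracket_theory.
Context {R : realType} {p q : nat}.
Implicit Types (x : 'rV[R]_p) (v : 'cV[R]_q) (M : 'M[R]_(p, q)).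

Lemma bracketE x v M :
  bracket x v M = \sum_(k : 'I_p * 'I_q) (x 0 k.1 * v k.2 0) * M k.1 k.2.
Proof.
rewrite /bracket mxE -(pair_bigA _ (fun i j => x 0 i * v j 0 * M i j))/= exchange_big/=.
apply: eq_bigr => j _; rewrite mxE mulr_suml; apply: eq_bigr => i _.
by rewrite mulrAC.
Qed.

Lemma bracketD x v M N : bracket x v (M + N) = bracket x v M + bracket x v N.
Proof. by rewrite /bracket mulmxDr mulmxDl mxE. Qed.

Lemma bracketB x v M N : bracket x v (M - N) = bracket x v M - bracket x v N.
Proof. by rewrite /bracket mulmxBr mulmxBl !mxE. Qed.

Lemma bracketDv x v v' M : bracket x (v + v') M = bracket x v M + bracket x v' M.
Proof. by rewrite /bracket mulmxDr mxE. Qed.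

End bracket_theory.

Lemma bracketMv {R : realType} {p q r : nat} (x : 'rV[R]_p) (v : 'cV[R]_r)
    (M : 'M[R]_(p, q)) (N : 'M[R]_(q, r)) :
  bracket x v (M *m N) = bracket x (N *m v) M.
Proof. by rewrite /bracket !mulmxA. Qed.

Section bracket_processes.
Context {R : realType} {d : measure_display} {Omega : measurableType d}.
Variable P : probability Omega R.
Notation leb := (@lebesgue_measure R).
Notation Q := (leb \x P)%E.
Variables (p q : nat) (x : 'rV[R]_p) (v : 'cV[R]_q).

Lemma window_bracket (a b : R) (X : R -> Omega -> 'M[R]_(p, q)) :
  window a b (fun r w => bracket x v (X r w)) = (fun z =>
    \sum_(k : 'I_p * 'I_q) (x 0 k.1 * v k.2 0) *
      window a b (fun r w => X r w k.1 k.2) z).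
Proof.
have -> : (fun r w => bracket x v (X r w)) = (fun r w =>
    \sum_(k : 'I_p * 'I_q) (x 0 k.1 * v k.2 0) * X r w k.1 k.2).
  by apply/funext => r; apply/funext => w; rewrite bracketE.
rewrite window_sum; apply/funext => z; apply: eq_bigr => k _.
by rewrite windowZ.
Qed.

Lemma sq_integrable_window_bracket (a b : R) (X : R -> Omega -> 'M[R]_(p, q)) :
  (forall i j, sq_integrable Q (window a b (fun r w => X r w i j))) ->
  sq_integrable Q (window a b (fun r w => bracket x v (X r w))).
Proof.
move=> sX; rewrite window_bracket; apply: sq_integrable_sum => k _.
exact: sq_integrableZ.
Qed.

Lemma sq_integrable_bracket {d' : measure_display} {T : measurableType d'}
    (mu : {measure set T -> \bar R}) (X : T -> 'M[R]_(p, q)) :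
  (forall i j, sq_integrable mu (fun w => X w i j)) ->
  sq_integrable mu (fun w => bracket x v (X w)).
Proof.
move=> sX; have -> : (fun w => bracket x v (X w)) = (fun w =>
    \sum_(k : 'I_p * 'I_q) (x 0 k.1 * v k.2 0) * X w k.1 k.2).
  by apply/funext => w; rewrite bracketE.
by apply: sq_integrable_sum => k _; exact: sq_integrableZ.
Qed.

Lemma bracket_Rintegral (t s : R) (f : R -> 'M[R]_(p, q)) :
  (forall i j, leb.-integrable `[t, s] (EFin \o (fun r => f r i j))) ->
  leb.-integrable `[t, s] (EFin \o (fun r => bracket x v (f r))) /\
  bracket x v (\matrix_(i, j) \int[leb]_(r in `[t, s]) f r i j) =
  \int[leb]_(r in `[t, s]) bracket x v (f r).
Proof.
move=> fi; have ik (k : 'I_p * 'I_q) : leb.-integrable `[t, s]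
    (EFin \o (fun u => (x 0 k.1 * v k.2 0) * f u k.1 k.2)).
  have -> : EFin \o (fun u => (x 0 k.1 * v k.2 0) * f u k.1 k.2) =
      (fun u => (x 0 k.1 * v k.2 0)%:E * (f u k.1 k.2)%:E)%E by apply/funext.
  by apply: integrableZl => //; exact: fi.
have bE : (fun r => bracket x v (f r)) =
    (fun u => \sum_k x 0 k.1 * v k.2 0 * f u k.1 k.2).
  by apply/funext => u; rewrite bracketE.
have [h1 h2] := @Rintegral_sum _ _ _ leb _ (index_enum _) _ _ (measurable_itv _) ik.
rewrite bE; split=> //; rewrite h2 bracketE; apply: eq_bigr => k _.
by rewrite mxE RintegralZl//; exact: fi.
Qed.

Lemma continuous_within_bracket (A : set R) (f : R -> 'M[R]_(p, q)) :
  (forall i j, {within A, continuous (fun s => f s i j)}) ->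
  {within A, continuous (fun s => bracket x v (f s))}.
Proof.
move=> cf.
pose g (r : seq ('I_p * 'I_q)) s := \sum_(k <- r) (x 0 k.1 * v k.2 0) * f s k.1 k.2.
have -> : (fun s => bracket x v (f s)) = g (index_enum _).
  by apply/funext => s; rewrite bracketE.
elim: (index_enum _) => [|k r IH].
  have -> : g [::] = cst 0 by apply/funext => s; rewrite /g big_nil.
  by move=> s; exact: cvg_cst.
have -> : g (k :: r) = (fun s => (x 0 k.1 * v k.2 0) * f s k.1 k.2 + g r s).
  by apply/funext => s; rewrite /g big_cons.
move=> s; apply: (@cvgD _ R^o); last exact: IH.
by apply: cvgMr; exact: cf.
Qed.

End bracket_processes.

Lemma sq_integrable_window_sub {R : realType} {d : measure_display}
    {Omega : measurableType d} (P : probability Omega R) (a b a' b' : R)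
    (X : R -> Omega -> R) : a <= a' -> b' <= b ->
  sq_integrable (@lebesgue_measure R \x P)%E (window a b X) ->
  sq_integrable (@lebesgue_measure R \x P)%E (window a' b' X).
Proof.
move=> aa' bb' sX.
have -> : window a' b' X = (fun z => \1_`[a', b'] z.1 * window a b X z).
  apply/funext => -[r w]; have [h|h] := boolP (a' <= r <= b').
    have h' : a <= r <= b.
      by case/andP: h => h1 h2; rewrite (le_trans aa' h1) (le_trans h2).
    by rewrite !windowE_in//= indicE mem_set ?mul1r//= in_itv.
  by rewrite windowE_out//= indicE memNset ?mul0r//= in_itv/=; exact/negP.
have mI : measurable (`[a', b'] : set R) by exact: measurable_itv.
apply: (@sq_integrable_mul_bounded _ _ _ _ _ _ 1) => //.
  by apply: measurableT_comp => //; exact: measurable_indic.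
by move=> z; rewrite indicE; case: (_ \in _); rewrite ?normr1 ?normr0.
Qed.

(** * Mean and fluctuation of [x Phi] *)

Lemma ae_integrable_path {R : realType} {d : measure_display}
    {Omega : measurableType d} (P : probability Omega R) (t s : R)
    (X : R -> Omega -> R) :
  sq_integrable (@lebesgue_measure R \x P)%E (window t s X) ->
  {ae P, forall w, lebesgue_measure.-integrable `[t, s] (EFin \o X^~ w)}.
Proof.
move=> sX; have := ae_sq_integrable_path sX; apply: filterS => w sw.
have := integrable_mul sw (sq_integrable_seg t s).
have -> : (fun r => (window t s X (r, w) * \1_`[t, s] r)%:E) =
    (EFin \o X^~ w) \_ `[t, s].
  apply/funext => r; rewrite patchE /window indicE.
  by case: (_ \in _); rewrite ?mulr1 ?mulr0.
by move=> h; apply/integrable_mkcond.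
Qed.

Section fluctuation.
Context {R : realType} {d : measure_display} {Omega : measurableType d}.
Variable P : probability Omega R.
Hypothesis hP : measure_is_complete P.
Variable W : R -> Omega -> R.
Hypothesis hW : brownian_motion P W.
Variables (n : nat) (A Abar C Cbar : 'M[R]_n) (t : R).
Hypothesis t0 : 0 <= t.
Variable Phi : R -> Omega -> 'M[R]_n.
Hypothesis hPhi : mf_sde_solution P W A Abar C Cbar t Phi.
Variable x : 'rV[R]_n.

Notation leb := (@lebesgue_measure R).
Notation Q := (leb \x P)%E.
Notation mean r := (expect_mx P (Phi r)).

Definition zeta (v : 'cV[R]_n) (s : R) : R := bracket x v (mean s).

Definition eta (v : 'cV[R]_n) (s : R) (w : Omega) : R :=
  bracket x v (Phi s w - mean s).

Lemma zetaD v v' s : zeta (v + v') s = zeta v s + zeta v' s.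
Proof. exact: bracketDv. Qed.

Lemma etaD v v' s w : eta (v + v') s w = eta v s w + eta v' s w.
Proof. exact: bracketDv. Qed.

Lemma bracket_mulmx {p : nat} (M : 'M[R]_(n, p)) (k : 'cV[R]_p) (N : 'M[R]_n) :
  bracket x (M *m k) N = \sum_j k j 0 * bracket x (col j M) N.
Proof.
rewrite /bracket mulmxA mxE; apply: eq_bigr => j _; rewrite mulrC; congr (_ * _).
by rewrite colE mulmxA -colE [RHS]mxE.
Qed.

Lemma zeta_mulmx {p : nat} (M : 'M[R]_(n, p)) (k : 'cV[R]_p) s :
  zeta (M *m k) s = \sum_j k j 0 * zeta (col j M) s.
Proof. exact: bracket_mulmx. Qed.

Lemma eta_mulmx {p : nat} (M : 'M[R]_(n, p)) (k : 'cV[R]_p) s w :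
  eta (M *m k) s w = \sum_j k j 0 * eta (col j M) s w.
Proof. exact: bracket_mulmx. Qed.

(** [N] multiplies the mean alone, hence the fluctuation meets [M] and the mean meets [M + N]: the
    origin of the sums [A + Abar], [B + Bbar] and [C + Cbar]. *)
Lemma bracket_mean_field {p : nat} (M N : 'M[R]_(n, p)) (v : 'cV[R]_p) s w :
  bracket x v (mean_field P Phi M N s w) =
  eta (M *m v) s w + zeta ((M + N) *m v) s.
Proof.
rewrite /mean_field bracketD !bracketMv /eta bracketB mulmxDl /zeta bracketDv.
by ring.
Qed.

Lemma sq_window_zeta v s : t <= s -> sq_integrable Q (window t s (fun r _ => zeta v r)).
Proof.
move=> ts; apply: sq_integrable_window_bracket => i j.
exact: (sq_integrable_window_mean hP hW hPhi).
Qed.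

Lemma sq_window_eta v a s : t <= a -> a <= s ->
  sq_integrable Q (window a s (eta v)).
Proof.
move=> ta as_; apply: (sq_integrable_window_sub ta (lexx s)).
have ts := le_trans ta as_.
apply: sq_integrable_window_bracket => i j.
have -> : (fun r w => (Phi r w - mean r) i j) =
    (fun r w => Phi r w i j + - mean r i j).
  by apply/funext => r; apply/funext => w; rewrite !mxE.
rewrite windowD windowN; apply: sq_integrableB.
- exact: (sq_integrable_window_Phi hP hW hPhi).
- exact: (sq_integrable_window_mean hP hW hPhi).
Qed.

Lemma sq_eta v s : t <= s -> sq_integrable P (eta v s).
Proof.
move=> ts; apply: sq_integrable_bracket => i j.
have -> : (fun w => (Phi s w - mean s) i j) =
    (fun w => Phi s w i j) \+ cst (- mean s i j).
  by apply/funext => w; rewrite !mxE.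
apply: sq_integrableD; last exact: sq_integrable_cst.
exact: (sq_integrable_Phi hP hW t0 hPhi).
Qed.

Lemma inner_cst_eta v s : t <= s -> inner P (cst 1) (eta v s) = 0.
Proof.
move=> ts; have s1 := sq_integrable_cst P 1.
have -> : eta v s = (fun w =>
    \sum_(k : 'I_n * 'I_n) (x 0 k.1 * v k.2 0) * (Phi s w - mean s) k.1 k.2).
  by apply/funext => w; rewrite /eta bracketE.
have sk (k : 'I_n * 'I_n) : sq_integrable P (fun w => (Phi s w - mean s) k.1 k.2).
  have -> : (fun w => (Phi s w - mean s) k.1 k.2) =
      (fun w => Phi s w k.1 k.2) \+ cst (- mean s k.1 k.2).
    by apply/funext => w; rewrite !mxE.
  apply: sq_integrableD; last exact: sq_integrable_cst.
  exact: (sq_integrable_Phi hP hW t0 hPhi).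
rewrite inner_sumr//; last by move=> k; exact: sq_integrableZ.
apply: big1 => k _; rewrite innerC innerZl//.
have sP := sq_integrable_Phi hP hW t0 hPhi k.1 k.2 ts.
have -> : (fun w => (Phi s w - mean s) k.1 k.2) =
    (fun w => Phi s w k.1 k.2) \- (fun w => mean s k.1 k.2 * cst 1 w).
  by apply/funext => w; move: (mean s) => M; rewrite !mxE /= mulr1.
rewrite innerBl//; last exact: sq_integrableZ.
rewrite innerZl// inner_cst11 mulr1 innerC -(expectation_Phi P Phi _ _ ts).
by rewrite -meanE subrr mulr0.
Qed.

Lemma continuous_zeta v : {within `[t, +oo[, continuous (zeta v)}.
Proof.
apply: continuous_within_bracket => i j.
exact: (continuous_mean hP hW t0 hPhi).
Qed.

Lemma continuous_eta v : {ae P, forall w,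
  {within `[t, +oo[, continuous (fun s => eta v s w)}}.
Proof.
case: hPhi => _ + _; apply: filterS => w cw.
apply: continuous_within_bracket => i j.
have -> : (fun s => (Phi s w - mean s) i j) =
    (fun s => Phi s w i j - mean s i j).
  by apply/funext => s; rewrite !mxE.
move=> s; apply: (@cvgB _ R^o); first exact: cw.
exact: (continuous_mean hP hW t0 hPhi).
Qed.

Lemma integrable_zeta v s : t <= s -> leb.-integrable `[t, s] (EFin \o zeta v).
Proof.
move=> ts; have [] // := @bracket_Rintegral R n n x v t s (fun r => mean r).
move=> i j; exact: (integrable_mean hP hW hPhi).
Qed.

Lemma zeta_eq v s : t <= s ->
  zeta v s = (x *m v) 0 0 - \int[leb]_(r in `[t, s]) zeta ((A + Abar) *m v) r.
Proof.
move=> ts; have [_ h] := @bracket_Rintegral R n n x v t s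
  (fun r => mean r *m (A + Abar)) (fun i j => integrable_mean_mul hP hW hPhi _ i j ts).
have -> : \int[leb]_(r in `[t, s]) zeta ((A + Abar) *m v) r =
    \int[leb]_(r in `[t, s]) bracket x v (mean r *m (A + Abar)).
  by apply: eq_Rintegral => r _; rewrite bracketMv.
rewrite -h.
have -> : (x *m v) 0 0 = bracket x v 1%:M by rewrite /bracket mulmx1.
rewrite -bracketB /zeta; congr bracket; apply/matrixP => i j.
by rewrite (mean_eq hP hW t0 hPhi)// !mxE.
Qed.

(** By [bracket_mean_field] this is, up to sign, the diffusion coefficient of the equation between
    [x] and [v]. *)
Definition theta (v : 'cV[R]_n) (s : R) (w : Omega) : R :=
  eta (C *m v) s w + zeta ((C + Cbar) *m v) s.

(** Subtracting the equation of the mean cancels the initial value and the mean part of the drift.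
    Of the martingale [J] only covariances are kept; that they depend on the earlier time alone
    encodes the orthogonality of increments. *)
Theorem eta_sde : exists J : 'cV[R]_n -> R -> Omega -> R,
  [/\ forall v s, t <= s -> sq_integrable P (J v s),
      forall v s u, t <= s -> s <= u -> inner P (J v s) (J v u) =
        inner Q (window t s (theta v)) (window t s (theta v)) &
      forall v s, t <= s -> {ae P, forall w, eta v s w =
        J v s w - \int[leb]_(r in `[t, s]) eta (A *m v) r w}].
Proof.
have [I [hI hE]] := sde_ito hPhi.
have sI s i j : t <= s -> sq_integrable P (fun w => I s w i j).
  by move=> ts; have [] := ito_approximation hP hW t0 ts (hI s i j ts).
exists (fun v s w => bracket x v (I s w)); split.
- by move=> v s ts; apply: sq_integrable_bracket => i j; exact: sI.
- move=> v s u ts su; have tu := le_trans ts su.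
  have thE s' : t <= s' -> window t s' (theta v) = (fun z =>
      \sum_(k : 'I_n * 'I_n) - (x 0 k.1 * v k.2 0) *
        window t s' (fun r w => - mean_field P Phi C Cbar r w k.1 k.2) z).
    move=> ts'; have -> : theta v = (fun r w => bracket x v (mean_field P Phi C Cbar r w)).
      by apply/funext => r; apply/funext => w; rewrite bracket_mean_field.
    rewrite window_bracket; apply/funext => z; apply: eq_bigr => k _.
    by rewrite windowN mulrNN.
  (* The product of a shorter and a longer window lives on the shorter one, so one factor may be
     prolonged to [u]; the isometry then applies with the end times [s] and [u]. *)
  have -> : inner Q (window t s (theta v)) (window t s (theta v)) =
      inner Q (window t s (theta v)) (window t u (theta v)).
    by rewrite innerC; apply: eq_Rintegral => z _; rewrite window_window.
  rewrite !thE// inner_lincomb; last 2 first.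
  + move=> k; exact: (sq_integrable_window_opp_mean_field hP hW hPhi).
  + move=> k; exact: (sq_integrable_window_opp_mean_field hP hW hPhi).
  have bE s' : (fun w => bracket x v (I s' w)) = (fun w =>
      \sum_(k : 'I_n * 'I_n) (x 0 k.1 * v k.2 0) * I s' w k.1 k.2).
    by apply/funext => w; rewrite bracketE.
  rewrite !bE inner_lincomb; last 2 first.
  + by move=> k; exact: sI.
  + by move=> k; exact: sI.
  apply: eq_bigr => k _; apply: eq_bigr => l _; rewrite mulrNN; congr (_ * _).
  exact: (ito_isometry hP hW t0 ts t0 tu (hI s k.1 k.2 ts) (hI u l.1 l.2 tu)).
move=> v s ts.
have smf i j := sq_integrable_window_opp_mean_field hP hW hPhi A Abar i j ts.
have imf : {ae P, forall w, forall k : 'I_n * 'I_n, leb.-integrable `[t, s]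
    (EFin \o (fun r => - mean_field P Phi A Abar r w k.1 k.2))}.
  by apply: filter_forall => k; exact: ae_integrable_path.
have ieta : {ae P, forall w, leb.-integrable `[t, s] (EFin \o (eta (A *m v))^~ w)}.
  by apply: ae_integrable_path; exact: sq_window_eta.
have [iz zE] := (integrable_zeta ((A + Abar) *m v) ts, zeta_eq v ts).
move: imf ieta (hE s ts); apply: filterS3 => w iw ie hw.
have [i j|_ hb] := @bracket_Rintegral R n n x v t s
  (fun r => - mean_field P Phi A Abar r w).
  have -> : (fun r => (- mean_field P Phi A Abar r w) i j) =
      (fun r => - mean_field P Phi A Abar r w i j).
    by apply/funext => r; rewrite mxE.
  exact: (iw (i, j)).
have PhiE : Phi s w = 1%:M + \matrix_(i, j) (\int[leb]_(r in `[t, s])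
    (- mean_field P Phi A Abar r w) i j) + I s w.
  apply/matrixP => i j; rewrite hw !mxE; congr (_ + _ + _).
      by apply: eq_Rintegral => r _; rewrite [RHS]mxE.
have intE : \int[leb]_(r in `[t, s]) bracket x v (- mean_field P Phi A Abar r w) =
    - (\int[leb]_(r in `[t, s]) eta (A *m v) r w +
       \int[leb]_(r in `[t, s]) zeta ((A + Abar) *m v) r).
  have is_ : leb.-integrable `[t, s]
      (EFin \o (fun r => eta (A *m v) r w + zeta ((A + Abar) *m v) r)).
    exact: (@integrableD _ _ _ leb _ _ _ _ ie iz).
  rewrite -RintegralD// -mulN1r -RintegralZl//.
  apply: eq_Rintegral => r _; rewrite -bracket_mean_field mulN1r.
  by rewrite /bracket mulmxN mulNmx mxE.
rewrite /eta bracketB -/(zeta v s) zE PhiE !bracketD hb intE.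
rewrite (_ : bracket x v 1%:M = (x *m v) 0 0); first by ring.
by rewrite /bracket mulmx1.
Qed.

End fluctuation.

Lemma right_points {R : realFieldType} (s T : R) : s < T ->
  exists2 del, 0 < del & forall k : nat, s < s + del / k.+1%:R < T.
Proof.
move=> sT; pose del := (T - s) / 2.
have del0 : 0 < del by rewrite /del; lra.
exists del => // k; have : del / k.+1%:R <= del.
  by rewrite ler_pdivrMr// ler_peMr ?ler1n// ltW.
have : 0 < del / k.+1%:R by rewrite divr_gt0.
have : s + del < T by rewrite /del; lra.
move: (del / _) => e; lra.
Qed.

(** * Propagation of null directions *)

Section null_directions.
Context {R : realType} {d : measure_display} {Omega : measurableType d}.
Variable P : probability Omega R.
Hypothesis hP : measure_is_complete P.
Variable W : R -> Omega -> R.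
Hypothesis hW : brownian_motion P W.
Variables (n : nat) (A Abar C Cbar : 'M[R]_n) (t T : R).
Hypothesis t0 : 0 <= t.
Variable Phi : R -> Omega -> 'M[R]_n.
Hypothesis hPhi : mf_sde_solution P W A Abar C Cbar t Phi.
Variable x : 'rV[R]_n.

Notation leb := (@lebesgue_measure R).
Notation Q := (leb \x P)%E.
Notation eta := (eta P Phi x).
Notation zeta := (zeta P Phi x).
Notation theta := (theta P C Cbar Phi x).

(** The interval is half-open: conclusions at [s] are drawn from times slightly to the right of [s],
    which must stay below [T]. *)
Definition null_eta (v : 'cV[R]_n) :=
  forall s, t <= s < T -> {ae P, forall w, eta v s w = 0}.

Definition null_zeta (u : 'cV[R]_n) := forall s, t <= s < T -> zeta u s = 0.

Lemma null_etaD v v' : null_eta v -> null_eta v' -> null_eta (v + v').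
Proof.
move=> h h' s sT; apply: filterS2 (h s sT) (h' s sT) => w e e'.
by rewrite etaD e e' addr0.
Qed.

Lemma null_zetaD v v' : null_zeta v -> null_zeta v' -> null_zeta (v + v').
Proof. by move=> h h' s sT; rewrite zetaD h// h'// addr0. Qed.

Lemma null_eta_mulmx {p : nat} (M : 'M[R]_(n, p)) k :
  (forall j, null_eta (col j M)) -> null_eta (M *m k).
Proof.
move=> h s sT; have : {ae P, forall w, forall j, eta (col j M) s w = 0}.
  by apply: filter_forall => j; exact: h.
apply: filterS => w hw; by rewrite eta_mulmx big1// => j _; rewrite hw mulr0.
Qed.

Lemma null_zeta_mulmx {p : nat} (M : 'M[R]_(n, p)) k :
  (forall j, null_zeta (col j M)) -> null_zeta (M *m k).
Proof.
move=> h s sT; by rewrite zeta_mulmx big1// => j _; rewrite h// mulr0.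
Qed.

(** A vanishing norm speaks of almost every time. At such a time the expectation separates the
    constant [zeta u] from the centred [eta v]; good times approaching [s] from the right, together
    with continuity, then reach every [s]. *)
Lemma null_window v u :
  (forall S, t <= S < T ->
     inner Q (window t S (fun r w => eta v r w + zeta u r))
       (window t S (fun r w => eta v r w + zeta u r)) = 0) ->
  null_eta v /\ null_zeta u.
Proof.
move=> h0; set Y := (fun r w => _) in h0.
have sY r : t <= r -> sq_integrable P (Y r).
  move=> tr; apply: sq_integrableD; last exact: sq_integrable_cst.
  exact: (sq_eta hP hW t0 hPhi).
have seq s : t <= s < T -> exists r : nat -> R,
    [/\ forall k, t <= r k, r k @[k --> \oo] --> s,
        forall k, zeta u (r k) = 0 &
        {ae P, forall w, forall k, eta v (r k) w = 0}].
  move=> /andP[ts sT]; pose S := (s + T) / 2.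
  have sS : s < S by rewrite /S; lra.
  have ST : t <= S < T by rewrite /S; lra.
  have tS : t <= S by case/andP: ST.
  have sw : sq_integrable Q (window t S Y).
    rewrite windowD; apply: sq_integrableD.
      exact: (sq_window_eta hP hW hPhi).
    exact: (sq_window_zeta hP hW hPhi).
  have [r [rS rY rs]] := ae_right_seq sS (inner_window_ae0 sw (h0 S ST)).
  have tr k : t <= r k by have /andP[h _] := rS k; lra.
  have Y0 k : {ae P, forall w, Y (r k) w = 0}.
    apply: filterS (rY k) => w; rewrite windowE_in//.
    by have /andP[h1 h2] := rS k; lra.
  have z0 k : zeta u (r k) = 0.
    have s1 := sq_integrable_cst P 1.
    have se := sq_eta hP hW t0 hPhi x v (tr k).
    have : inner P (Y (r k)) (cst 1) = inner P (cst 0) (cst 1).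
      apply: inner_aeE => //; [exact: sY|exact: sq_integrable_cst|exact: aeW].
    rewrite inner0l.
    have -> : Y (r k) = eta v (r k) \+ (fun w => zeta u (r k) * cst 1 w).
      by apply/funext => w; rewrite /= mulr1.
    rewrite innerDl//; last exact: sq_integrableZ.
    rewrite innerZl// inner_cst11 mulr1 innerC.
    by rewrite (inner_cst_eta hP hW t0 hPhi)// add0r.
  exists r; split=> //; apply: ae_foralln => k.
  by apply: filterS (Y0 k) => w; rewrite /Y z0 addr0.
split=> s sT; have [r [tr rs z0 e0]] := seq s sT; have /andP[ts _] := sT.
  apply: filterS2 (continuous_eta hP hW t0 hPhi x v) e0 => w cw hw.
  have := cvg_within_seq cw ts tr rs.
  under eq_fun do rewrite hw.
  move=> h; apply/esym; apply: (cvg_unique _ _ h) => //; exact: cvg_cst.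
have := cvg_within_seq (@continuous_zeta _ _ _ _ hP _ hW _ _ _ _ _ _ t0 _ hPhi x u) ts tr rs.
under eq_fun do rewrite z0.
move=> h; apply/esym; apply: (cvg_unique _ _ h) => //; exact: cvg_cst.
Qed.

(* [J] is the martingale part of [eta v] and [g], [al] are the squared L2-norms of
   the two integrands up to time [s]. *)
Lemma null_eta_theta v : t < T -> null_eta v ->
  [/\ null_eta (A *m v), null_eta (C *m v) & null_zeta ((C + Cbar) *m v)].
Proof.
move=> tT v0; have [J [sJ iJ eJ]] := eta_sde hP hW t0 hPhi x.
have JD s : t <= s < T -> {ae P, forall w,
    J v s w = \int[leb]_(r in `[t, s]) eta (A *m v) r w}.
  move=> sT; have /andP[ts _] := sT.
  apply: filterS2 (v0 s sT) (eJ v s ts) => w -> h.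
  by apply/eqP; rewrite -subr_eq0 -h.
pose g s := inner Q (window t s (theta v)) (window t s (theta v)).
pose al s := inner Q (window t s (eta (A *m v))) (window t s (eta (A *m v))).
have gE s u : t <= s -> s <= u -> u < T -> g u - g s <= (u - s) * (al u - al s).
  move=> ts su uT; have tu := le_trans ts su; have sT := le_lt_trans su uT.
  have -> : g u - g s = inner P (J v u \- J v s) (J v u \- J v s).
    (* When the square is expanded, the mixed term of [J v u] and [J v s] equals [g s] by [iJ]. *)
    rewrite inner_sqB; [|exact: sJ..]; rewrite (innerC _ (J v u)) !iJ//.
    by rewrite /g mulr2n; ring.
  have sD := sq_integrable_time_integral su (sq_window_eta hP hW hPhi x (A *m v) ts su).
  have JE : {ae P, forall w, (J v u \- J v s) w =
      \int[leb]_(r in `[s, u]) eta (A *m v) r w}.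
    have iw := ae_integrable_path (sq_window_eta hP hW hPhi x (A *m v) (lexx t) tu).
    have h1 := JD u _; have h2 := JD s _.
    move: (h1 ltac:(by rewrite tu uT)) (h2 ltac:(by rewrite ts sT)) iw.
    apply: filterS3 => w /= -> -> iw.
    rewrite Rintegral_itvB// ?bnd_simp//.
    rewrite Rintegral_itv_obnd_cbnd//.
    apply: integrableS iw; [exact: measurable_itv..|].
    by move=> r /=; rewrite !in_itv/= => /andP[h ->]; rewrite (le_trans ts (ltW h)).
  rewrite (inner_aeE _ _ sD sD JE JE); [|by apply: sq_integrableB; exact: sJ..].
  have -> : al u - al s = inner Q (window s u (eta (A *m v))) (window s u (eta (A *m v))).
    by apply/esym/inner_window_split => //; exact: (sq_window_eta hP hW hPhi).
  apply: inner_time_integral_le => //; exact: (sq_window_eta hP hW hPhi).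
have g0 u : t <= u < T -> g u = 0.
  move=> /andP[tu uT]; apply/eqP; rewrite eq_le inner_ge0 andbT.
  (* At time [t] the drift integral runs over a single point, so [J v t] vanishes. *)
  have gt : g t = 0.
    have s0 := sq_integrable_cst P 0.
    have h : {ae P, forall w, J v t w = cst 0 w}.
      have := JD t; rewrite lexx tT => /(_ isT); apply: filterS => w ->.
      by rewrite set_itv1 Rintegral_set1.
    rewrite /g -(iJ v t t)// -[RHS](inner0l P (cst 0)).
    by apply: inner_aeE => //; exact: sJ.
  by rewrite -gt; exact: (le_of_quadratic_increment gE).
(* [theta v] is the sum of [eta (C v)] and [zeta ((C + Cbar) v)], so its vanishing norm settles both
   at once. *)
have [cv0 ccv0] := null_window g0.
split=> // s /andP[ts sT]; have [del del0 sk] := right_points sT.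
(* With [g = 0] also [J v u] vanishes almost surely, hence so does the drift integral at each fixed
   time; countably many such times and path continuity give the drift integrand itself. *)
have D0 u : t <= u < T -> {ae P, forall w,
    \int[leb]_(r in `[t, u]) eta (A *m v) r w = 0}.
  move=> uT; have /andP[tu _] := uT.
  have := inner_eq0_ae (sJ v u tu); rewrite (iJ v u u)// => /(_ (g0 u uT)).
  by apply: filterS2 (JD u uT) => w -> ->.
have uk (k : nat) : t <= s + del / k.+1%:R < T.
  by have /andP[h ->] := sk k; rewrite (le_trans ts (ltW h)).
have Dk : {ae P, forall w, forall k : nat,
    \int[leb]_(r in `[t, s + del / k.+1%:R]) eta (A *m v) r w = 0}.
  by apply: ae_foralln => k; exact: D0.
have Ds := D0 s; rewrite ts sT in Ds.
move: (continuous_eta hP hW t0 hPhi x (A *m v)) (Ds isT) Dk.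
apply: filterS3 => w cw h1 h2; exact: (continuous_zero_integral cw ts del0 h1 h2).
Qed.

(** [zeta u] is a constant minus the integral of the continuous function [zeta ((A + Abar) u)], so
    that its vanishing on an interval forces the integrand to vanish. *)
Lemma null_zeta_mulA u : t < T -> null_zeta u -> null_zeta ((A + Abar) *m u).
Proof.
move=> tT u0 s /andP[ts sT]; have [del del0 sk] := right_points sT.
have xu : (x *m u) 0 0 = 0.
  have := zeta_eq hP hW t0 hPhi x u (lexx t); rewrite u0 ?lexx//.
  by rewrite set_itv1 Rintegral_set1 subr0.
have D0 r : t <= r < T -> \int[leb]_(r in `[t, r]) zeta ((A + Abar) *m u) r = 0.
  move=> rT; have /andP[tr _] := rT.
  have := zeta_eq hP hW t0 hPhi x u tr; rewrite u0// xu sub0r => /eqP.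
  by rewrite eq_sym oppr_eq0 => /eqP.
apply: (continuous_zero_integral (@continuous_zeta _ _ _ _ hP _ hW _ _ _ _ _ _ t0 _ hPhi x _) ts del0).
  by apply: D0; rewrite ts.
by move=> k; apply: D0; have /andP[h ->] := sk k; rewrite (le_trans ts (ltW h)).
Qed.

Lemma null_annihilates {m : nat} (B Bbar : 'M[R]_(n, m)) : t < T ->
  (forall j, null_eta (B *m delta_mx j 0)) ->
  (forall j, null_zeta ((B + Bbar) *m delta_mx j 0)) ->
  forall k, annihilates x (U_space A Abar C Cbar B Bbar k).
Proof.
move=> tT B0 Bb0.
have hB w : null_eta (B *m w) by apply: null_eta_mulmx => j; rewrite colE.
have hBb w : null_zeta ((B + Bbar) *m w).
  by apply: null_zeta_mulmx => j; rewrite colE.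
have hV k v : v \in V_space A C B k -> null_eta v.
  elim: k v => [|k IH] v /=; first by move=> /limg_mulmxP[w ->].
  move=> /memv_addP[v1 /memv_addP[_ /memv_imgP[a ak ->] [_ /memv_imgP[b bk ->] ->]]].
  move=> [_ /limg_mulmxP[w ->] ->]; apply: null_etaD => //; rewrite !lfunE.
  have [ha _ _] := null_eta_theta tT (IH a ak).
  by have [_ hb _] := null_eta_theta tT (IH b bk); exact: null_etaD.
have hU k u : u \in U_space A Abar C Cbar B Bbar k -> null_zeta u.
  elim: k u => [|k IH] u /=; first by move=> /limg_mulmxP[w ->].
  move=> /memv_addP[v1 /memv_addP[_ /memv_imgP[a ak ->] [_ /memv_imgP[b bk ->] ->]]].
  move=> [_ /limg_mulmxP[w ->] ->]; apply: null_zetaD => //; rewrite !lfunE.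
  have [_ _ hb] := null_eta_theta tT (hV k b bk).
  by apply: null_zetaD => //; apply: null_zeta_mulA => //; exact: IH.
move=> k u uk; have := zeta_eq hP hW t0 hPhi x u (lexx t).
rewrite (hU k u uk) ?lexx// set_itv1 Rintegral_set1 subr0 => h.
by apply/matrixP => i j; rewrite !ord1 -h mxE.
Qed.

End null_directions.

(** * The Gramian *)

(** The constant is chosen before [f], so that a single value serves all time windows, as Gronwall's
    lemma demands. *)
Lemma inner_lincomb_le {R : realType} {d : measure_display} {T : measurableType d}
    (mu : {measure set T -> \bar R}) (I : Type) (r : seq I) (a : I -> R) :
  exists2 c, 0 <= c & forall f : I -> T -> R, (forall k, sq_integrable mu (f k)) ->
    inner mu (fun z => \sum_(k <- r) a k * f k z)
      (fun z => \sum_(k <- r) a k * f k z) <=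
    c * \sum_(k <- r) inner mu (f k) (f k).
Proof.
elim: r => [|k r [c c0 IH]].
  exists 0 => // f sf; rewrite mul0r le_eqVlt; apply/orP; left; apply/eqP.
  rewrite -[RHS](inner0l mu (cst 0)); apply: eq_Rintegral => z _.
  by rewrite !big_nil.
exists (2 * a k ^+ 2 + 2 * c) => [|f sf]; first by rewrite addr_ge0// mulr_ge0// sqr_ge0.
have -> : (fun z => \sum_(l <- k :: r) a l * f l z) =
    (fun z => a k * f k z) \+ (fun z => \sum_(l <- r) a l * f l z).
  by apply/funext => z; rewrite /= big_cons.
have sk := sq_integrableZ (a k) (sf k).
have sr : sq_integrable mu (fun z => \sum_(l <- r) a l * f l z).
  by apply: sq_integrable_sum => l _; exact: sq_integrableZ.
apply: le_trans (inner_triangle sk sr) _.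
rewrite innerZl// innerC innerZl// big_cons.
have := IH f sf; have := inner_ge0 mu (f k).
have s0 : 0 <= \sum_(l <- r) inner mu (f l) (f l).
  by apply: sumr_ge0 => l _; exact: inner_ge0.
move: (\sum_(l <- r) inner mu _ _) s0 (inner _ _ _) => S S0 u v; have := sqr_ge0 (a k).
nra.
Qed.

(** * Homogeneous linear stochastic systems *)

Section linear_system.
Context {R : realType} {d : measure_display} {Omega : measurableType d}.
Variable P : probability Omega R.
Notation leb := (@lebesgue_measure R).
Notation Q := (leb \x P)%E.

(* Covers deterministic components too, as those with [J j = 0] and [b j = 0]. *)
Lemma linear_system0 (I : finType) (y J : I -> R -> Omega -> R) (a b : I -> I -> R)
    (t T : R) : t <= T ->
  (forall j s, t <= s <= T -> sq_integrable Q (window t s (y j))) ->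
  (forall j s, t <= s <= T -> sq_integrable P (y j s)) ->
  (forall j s, t <= s <= T -> sq_integrable P (J j s)) ->
  (forall j s, t <= s <= T -> {ae P, forall w, y j s w =
     J j s w - \int[leb]_(r in `[t, s]) \sum_k a j k * y k r w}) ->
  (forall j s, t <= s <= T -> inner P (J j s) (J j s) =
     inner Q (window t s (fun r w => \sum_k b j k * y k r w))
       (window t s (fun r w => \sum_k b j k * y k r w))) ->
  forall j s, t <= s <= T -> inner P (y j s) (y j s) = 0.
Proof.
move=> tT sQ sP sJ yE JE.
have bound (e : I -> I -> R) : exists2 c : I -> R, forall j, 0 <= c j &
    forall j f, (forall k, sq_integrable Q (f k)) ->
    inner Q (fun z => \sum_k e j k * f k z) (fun z => \sum_k e j k * f k z) <=
    c j * \sum_k inner Q (f k) (f k).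
  pose H j := cid2 (inner_lincomb_le Q (index_enum I) (e j)).
  by exists (fun j => s2val (H j)) => [j|j f]; [exact: (s2valP (H j))|exact: (s2valP' (H j))].
have [ca ca0 ha] := bound a; have [cb cb0 hb] := bound b.
pose phi s := \sum_j inner P (y j s) (y j s).
have phi0 s : 0 <= phi s by apply: sumr_ge0 => j _; exact: inner_ge0.
have fub j s : t <= s <= T -> leb.-integrable `[t, s] (EFin \o (fun r => inner P (y j r) (y j r))) /\
    inner Q (window t s (y j)) (window t s (y j)) =
    \int[leb]_(r in `[t, s]) inner P (y j r) (y j r).
  move=> sT; apply: inner_window_fubini; first exact: sQ.
  by move=> r tr; apply: sP; lra.
have iphi s : t <= s <= T -> leb.-integrable `[t, s] (EFin \o phi) /\
    \int[leb]_(r in `[t, s]) phi r = \sum_j inner Q (window t s (y j)) (window t s (y j)).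
  move=> sT.
  have [i1 i2] := @Rintegral_sum _ _ _ leb _ (index_enum I) _ _ (measurable_itv _) (fun j => (fub j s sT).1).
  by split=> //; rewrite i2; apply: eq_bigr => j _; rewrite (fub j s sT).2.
(* The decomposition [y = J - D] costs a factor 2; [cb j] comes from the isometry for [J], and
   [(T - t) * ca j] from Cauchy-Schwarz in time for [D]. *)
pose c := \sum_j (2 * cb j + 2 * ((T - t) * ca j)).
have c0 : 0 <= c.
  by apply: sumr_ge0 => j _; rewrite addr_ge0// !mulr_ge0// subr_ge0.
have phile s : t <= s <= T -> phi s <= c * \int[leb]_(r in `[t, s]) phi r.
  move=> sT; have [_ ->] := iphi s sT; rewrite /c mulr_suml; apply: ler_sum => j _.
  have /andP[ts _] := sT; have sW k := sQ k s sT.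
  have ws (e : I -> I -> R) : window t s (fun r w => \sum_k e j k * y k r w) =
      (fun z => \sum_k e j k * window t s (y k) z).
    by rewrite window_sum; apply/funext => z; apply: eq_bigr => k _; rewrite windowZ.
  have sD : sq_integrable Q (window t s (fun r w => \sum_k a j k * y k r w)).
    by rewrite ws; apply: sq_integrable_sum => k _; exact: sq_integrableZ.
  have sI := sq_integrable_time_integral ts sD.
  pose D w := \int[leb]_(r in `[t, s]) \sum_k a j k * y k r w.
  have -> : inner P (y j s) (y j s) = inner P (J j s \- D) (J j s \- D).
    have sB := sq_integrableB (sJ j s sT) sI.
    by apply: inner_aeE => //; [exact: sP..|exact: yE|exact: yE].
  apply: le_trans (inner_triangle (sJ j s sT) (sq_integrableN sI)) _.
  have -> : inner P (\- D) (\- D) = inner P D D.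
    by apply: eq_Rintegral => w _; rewrite /= mulrNN.
  rewrite JE// [leRHS]mulrDl; apply: lerD.
    by rewrite -mulrA ler_pM2l// ws; exact: hb.
  rewrite -mulrA ler_pM2l//; apply: le_trans (inner_time_integral_le ts sD) _.
  rewrite -mulrA; apply: ler_pM; [lra|exact: inner_ge0|lra|].
  by rewrite ws; exact: ha.
have tTT : t <= T <= T by rewrite tT lexx.
have := gronwall0 c0 tT (fun s _ => phi0 s) (iphi T tTT).1 phile.
move=> h j s sT; apply/eqP; move/eqP: (h s sT).
rewrite psumr_eq0 => [/allP/(_ j)|k _]; last exact: inner_ge0.
by rewrite mem_index_enum => /(_ isT).
Qed.

End linear_system.

(** * Kernel of the Gramian and invariant subspaces *)

Section gramian.
Context {R : realType} {d : measure_display} {Omega : measurableType d}.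
Variable P : probability Omega R.
Hypothesis hP : measure_is_complete P.
Variable W : R -> Omega -> R.
Hypothesis hW : brownian_motion P W.
Variables (n : nat) (A Abar C Cbar : 'M[R]_n) (t T : R).
Hypothesis t0 : 0 <= t.
Hypothesis tT : t < T.
Variable Phi : R -> Omega -> 'M[R]_n.
Hypothesis hPhi : mf_sde_solution P W A Abar C Cbar t Phi.

Notation leb := (@lebesgue_measure R).
Notation Q := (leb \x P)%E.

(** In bases of [U] and [V] the invariance hypotheses become the matrices [K1] to [K4], and the
    tested processes form a system for [linear_system0]. Annihilation concerns [U] only: [eta v]
    starts from zero for every [v], because [Phi] is deterministic at time [t]. *)
Lemma annihilates_null (x : 'rV[R]_n) (U V : {vspace 'cV[R]_n}) :
  annihilates x U ->
  (forall u, u \in U -> (A + Abar) *m u \in U) ->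
  (forall v, v \in V -> A *m v \in V) -> (forall v, v \in V -> C *m v \in V) ->
  (forall v, v \in V -> (C + Cbar) *m v \in U) ->
  forall s, t <= s <= T ->
  (forall u, u \in U -> zeta P Phi x u s = 0) /\
  (forall v, v \in V -> {ae P, forall w, eta P Phi x v s w = 0}).
Proof.
move=> xU UA VA VC VCU.
have [MU [UM MUU]] := basis_mx U; have [MV [VM MVV]] := basis_mx V.
have [K1 AV] : exists K, A *m MV = MV *m K.
  by apply: factor_mx => k; rewrite -mulmxA; apply/VM/VA.
have [K2 CV] : exists K, C *m MV = MV *m K.
  by apply: factor_mx => k; rewrite -mulmxA; apply/VM/VC.
have [K3 AU] : exists K, (A + Abar) *m MU = MU *m K.
  by apply: factor_mx => k; rewrite -mulmxA; apply/UM/UA.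
have [K4 CU] : exists K, (C + Cbar) *m MV = MU *m K.
  by apply: factor_mx => k; rewrite -mulmxA; apply/UM/VCU.
have [J [sJ iJ eJ]] := eta_sde hP hW t0 hPhi x.
pose I : finType := ('I_(\dim U) + 'I_(\dim V))%type.
pose y (i : I) (s : R) (w : Omega) := match i with
  | inl j => zeta P Phi x (col j MU) s | inr j => eta P Phi x (col j MV) s w end.
pose JJ (i : I) (s : R) (w : Omega) := match i with
  | inl j => 0 | inr j => J (col j MV) s w end.
(* The first index is the equation and the second the unknown. The entries of the [K] matrices
   appear transposed, since column [j] of [M K] combines the columns [l] of [M] with the
   coefficients [K l j]. *)
pose a (i k : I) : R := match i, k with
  | inl j, inl l => K3 l j | inr j, inr l => K1 l j | _, _ => 0 end.
pose b (i k : I) : R := match i, k with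
  | inr j, inl l => K4 l j | inr j, inr l => K2 l j | _, _ => 0 end.
have sumI (e : I -> R) : \sum_k e k =
    \sum_(l < \dim U) e (inl l) + \sum_(l < \dim V) e (inr l) by exact: big_sumType.
have aU j r w : \sum_k a (inl j) k * y k r w =
    zeta P Phi x ((A + Abar) *m col j MU) r.
  rewrite sumI [X in _ + X]big1 ?addr0 => [|l _]; last by rewrite mul0r.
  rewrite !colE mulmxA AU -mulmxA -!colE zeta_mulmx; apply: eq_bigr => l _.
  by rewrite !mxE.
have aV j r w : \sum_k a (inr j) k * y k r w = eta P Phi x (A *m col j MV) r w.
  rewrite sumI [X in X + _]big1 ?add0r => [|l _]; last by rewrite mul0r.
  rewrite !colE mulmxA AV -mulmxA -!colE eta_mulmx; apply: eq_bigr => l _.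
  by rewrite !mxE.
have bU j r w : \sum_k b (inl j) k * y k r w = 0.
  by rewrite big1// => -[l|l] _; rewrite mul0r.
have bV j r w : \sum_k b (inr j) k * y k r w = theta P C Cbar Phi x (col j MV) r w.
  rewrite sumI /theta addrC; congr (_ + _).
    rewrite !colE mulmxA CV -mulmxA -!colE eta_mulmx; apply: eq_bigr => l _.
    by rewrite !mxE.
  rewrite !colE mulmxA CU -mulmxA -!colE zeta_mulmx; apply: eq_bigr => l _.
  by rewrite !mxE.
have y0 := @linear_system0 _ _ _ P I y JJ a b t T (ltW tT).
have {}y0 : forall j s, t <= s <= T -> inner P (y j s) (y j s) = 0.
  apply: y0 => -[j|j] s /andP[ts sT].
  - exact: (sq_window_zeta hP hW hPhi).
  - exact: (sq_window_eta hP hW hPhi).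
  - exact: sq_integrable_cst.
  - exact: (sq_eta hP hW t0 hPhi).
  - exact: sq_integrable0.
  - exact: sJ.
  - apply: aeW => w; rewrite /y /JJ sub0r.
    under eq_Rintegral do rewrite aU.
    rewrite (zeta_eq hP hW t0 hPhi)//.
    (* The initial value of this component is [x] applied to a vector of [U], hence zero. *)
    have /xU -> : col j MU \in U by rewrite colE.
    by rewrite mxE sub0r.
  - apply: filterS (eJ (col j MV) s ts) => w hw.
    rewrite [LHS]hw; congr (_ - _); apply: eq_Rintegral => r _.
    by rewrite aV.
  - rewrite [LHS](inner0l P); have -> : window t s
        (fun r w => \sum_k b (inl j) k * y k r w) = cst 0.
      by apply/funext => -[r w]; rewrite /window (bU j) mul0r.
    by rewrite inner0l.
  - rewrite [LHS](iJ _ s s)//; have -> // : theta P C Cbar Phi x (col j MV) =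
        (fun r w => \sum_k b (inr j) k * y k r w).
    by apply/funext => r; apply/funext => w; rewrite bV.
move=> s sT; have /andP[ts _] := sT; split.
  move=> u /UM[k ->]; rewrite zeta_mulmx big1// => j _.
  have := y0 (inl j) s sT.
  have -> : inner P (y (inl j) s) (y (inl j) s) = zeta P Phi x (col j MU) s ^+ 2.
    transitivity (inner P (fun w => zeta P Phi x (col j MU) s * cst 1 w)
        (fun w => zeta P Phi x (col j MU) s * cst 1 w)).
      by apply: eq_Rintegral => w _; rewrite /= mulr1.
    have s1 := sq_integrable_cst P 1; have sz := sq_integrableZ (zeta P Phi x (col j MU) s) s1.
    by rewrite innerZl// innerC innerZl// inner_cst11 mulr1 expr2.
  by move=> /eqP; rewrite sqrf_eq0 => /eqP ->; rewrite mulr0.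
move=> v /VM[k ->].
have : {ae P, forall w, forall j, eta P Phi x (col j MV) s w = 0}.
  apply: filter_forall => j; apply: inner_eq0_ae; last exact: (y0 (inr j) s sT).
  exact: (sq_eta hP hW t0 hPhi).
by apply: filterS => w hw; rewrite eta_mulmx big1// => j _; rewrite hw mulr0.
Qed.

Variables (m : nat) (B Bbar : 'M[R]_(n, m)).

Notation q x l := (window t T (fun r w =>
  bracket x (delta_mx l 0) (mean_field P Phi B Bbar r w))).

(** For [z = x] this is a sum of square norms. The second row is kept free because [x G = 0] will be
    checked entry by entry, with [z] a unit row. *)
Lemma gramian_form (x z : 'rV[R]_n) :
  (x *m gramian P B Bbar Phi t T *m z^T) 0 0 = \sum_(l < m) inner Q (q x l) (q z l).
Proof.
have smf i l := sq_integrable_window_mean_field hP hW hPhi B Bbar i l (ltW tT).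
have GE i j : gramian P B Bbar Phi t T i j = \sum_(l < m)
    inner Q (window t T (fun r w => mean_field P Phi B Bbar r w i l))
      (window t T (fun r w => mean_field P Phi B Bbar r w j l)).
  pose X r w := \sum_(l < m) mean_field P Phi B Bbar r w i l * mean_field P Phi B Bbar r w j l.
  have wX : window t T X = (fun p => \sum_(l < m)
      window t T (fun r w => mean_field P Phi B Bbar r w i l) p *
      window t T (fun r w => mean_field P Phi B Bbar r w j l) p).
    apply/funext => p; rewrite /window /X mulr_suml; apply: eq_bigr => l _.
    by rewrite indicE; case: (_ \in _); rewrite ?mulr1 ?mulr0.
  have [iX sX] := @Rintegral_sum _ _ _ Q _ (index_enum 'I_m) setT _ measurableT
    (fun l => integrable_mul (smf i l) (smf j l)).
  transitivity (\int[P]_w (\int[leb]_(r in `[t, T]) X r w)).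
    rewrite /gramian mxE unlock; congr fine; apply: eq_integral => w _.
    congr EFin; rewrite mxE; apply: eq_Rintegral => r _.
    rewrite [LHS]mxE; apply: eq_bigr => l _; congr (_ * _); exact: mxE.
  have [] := @expectation_time_integral_window _ _ _ P t T X.
    by rewrite wX.
  by move=> _ ->; rewrite wX sX.
have qE x' l : q x' l = (fun p => \sum_(i < n) x' 0 i *
    window t T (fun r w => mean_field P Phi B Bbar r w i l) p).
  have -> : (fun r w => bracket x' (delta_mx l 0) (mean_field P Phi B Bbar r w)) =
      (fun r w => \sum_(i < n) x' 0 i * mean_field P Phi B Bbar r w i l).
    apply/funext => r; apply/funext => w.
    rewrite /bracket -colE mxE mxE; apply: eq_bigr => i _; done.
  by rewrite window_sum; apply/funext => p; apply: eq_bigr => i _; rewrite windowZ.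
transitivity (\sum_(l < m) \sum_(i < n) \sum_(j < n) (x 0 i * z 0 j) *
    inner Q (window t T (fun r w => mean_field P Phi B Bbar r w i l))
      (window t T (fun r w => mean_field P Phi B Bbar r w j l))); last first.
  by apply: eq_bigr => l _; rewrite !qE inner_lincomb// => i; exact: smf.
rewrite mxE; under eq_bigr do rewrite mxE mulr_suml.
rewrite exchange_big [RHS]exchange_big/=; apply: eq_bigr => i _.
rewrite [RHS]exchange_big/=; apply: eq_bigr => j _.
by rewrite GE mxE mulrAC mulr_sumr.
Qed.

Lemma sq_window_q x l : sq_integrable Q (q x l).
Proof.
apply: sq_integrable_window_bracket => i j.
exact: (sq_integrable_window_mean_field hP hW hPhi B Bbar i j (ltW tT)).
Qed.

Lemma bracket_mean_fieldE x l : (fun r w =>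
    bracket x (delta_mx l 0) (mean_field P Phi B Bbar r w)) =
  (fun r w => eta P Phi x (B *m delta_mx l 0) r w +
     zeta P Phi x ((B + Bbar) *m delta_mx l 0) r).
Proof.
by apply/funext => r; apply/funext => w; rewrite bracket_mean_field.
Qed.

Lemma gramian_ker_annihilates (x : 'rV[R]_n) :
  x *m gramian P B Bbar Phi t T = 0 ->
  forall k, annihilates x (U_space A Abar C Cbar B Bbar k).
Proof.
move=> xG; have q0 l : inner Q (q x l) (q x l) = 0.
  have := gramian_form x x; rewrite xG mul0mx mxE => /esym/eqP.
  rewrite psumr_eq0 => [/allP/(_ l)|k _]; last exact: inner_ge0.
  by rewrite mem_index_enum => /(_ isT)/eqP.
have null l : null_eta P t T Phi x (B *m delta_mx l 0) /\
    null_zeta P t T Phi x ((B + Bbar) *m delta_mx l 0).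
  (* [null_window] asks for every shorter window. Its square norm is that of [[t, T]], which is
     zero, minus that of [[S, T]], hence at most zero. *)
  apply: (null_window hP hW t0 hPhi) => S /andP[tS ST].
  rewrite -bracket_mean_fieldE; apply/eqP; rewrite eq_le inner_ge0 andbT.
  have := inner_ge0 Q (window S T (fun r w =>
    bracket x (delta_mx l 0) (mean_field P Phi B Bbar r w))).
  rewrite (inner_window_split tS (ltW ST)) ?q0 ?sub0r ?oppr_ge0//.
  - exact: sq_window_q.
  - exact: (sq_integrable_window_sub _ (ltW ST) (sq_window_q x l)).
  - exact: (sq_integrable_window_sub tS _ (sq_window_q x l)).
exact: (null_annihilates hP hW t0 hPhi tT (fun l => (null l).1) (fun l => (null l).2)).
Qed.

Lemma annihilates_gramian_ker (x : 'rV[R]_n) (U V : {vspace 'cV[R]_n}) :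
  annihilates x U ->
  (forall u, u \in U -> (A + Abar) *m u \in U) ->
  (forall v, v \in V -> A *m v \in V) -> (forall v, v \in V -> C *m v \in V) ->
  (forall v, v \in V -> (C + Cbar) *m v \in U) ->
  (forall k, B *m k \in V) -> (forall k, (B + Bbar) *m k \in U) ->
  x *m gramian P B Bbar Phi t T = 0.
Proof.
move=> xU UA VA VC VCU BV BU.
have null := annihilates_null xU UA VA VC VCU.
have q0 l : inner Q (q x l) (q x l) = 0.
  have sY r : t <= r <= T -> sq_integrable P (fun w =>
      bracket x (delta_mx l 0) (mean_field P Phi B Bbar r w)).
    move=> /andP[tr _]; apply: sq_integrable_bracket => i j.
    exact: (sq_integrable_mean_field hP hW t0 hPhi).
  have [_ ->] := inner_window_fubini (sq_window_q x l) sY.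
  transitivity (\int[leb]_(r in `[t, T]) (0 : R)); last by rewrite /Rintegral integral0.
  apply: eq_Rintegral => r; rewrite inE/= in_itv/= => tr.
  have s0 := sq_integrable_cst P 0; have sYr := sY r tr.
  have [z0 e0] := null r tr; rewrite -[RHS](inner0l P (cst 0)).
  have Y0 : {ae P, forall w,
      bracket x (delta_mx l 0) (mean_field P Phi B Bbar r w) = cst 0 w}.
    apply: filterS (e0 _ (BV (delta_mx l 0))) => w ew.
    by rewrite bracket_mean_field ew z0 ?addr0.
  exact: inner_aeE.
apply/rowP => j; rewrite [RHS]mxE.
have := gramian_form x (delta_mx 0 j); rewrite trmx_delta -colE mxE => ->.
(* By Cauchy-Schwarz a null [q x l] has zero inner product with every second factor. *)
rewrite big1// => l _; apply/eqP; rewrite -sqrf_eq0 eq_le sqr_ge0 andbT.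
apply: le_trans (cauchy_schwarz (sq_window_q x l) (sq_window_q _ l)) _.
by rewrite q0 mul0r.
Qed.

End gramian.

(** * Invertible Gramian, full subspace, full rank *)

Theorem theorem2p10 (R : realType) (d : measure_display)
  (Omega : measurableType d) (P : probability Omega R)
  (hP : measure_is_complete P)
  (W : R -> Omega -> R) (hW : brownian_motion P W)
  (n m : nat) (hn : (0 < n)%N)
  (A Abar C Cbar : 'M[R]_n) (B Bbar : 'M[R]_(n, m))
  (t T : R) (ht : 0 <= t) (htT : t < T)
  (Phi : R -> Omega -> 'M[R]_n)
  (hPhi : mf_sde_solution P W A Abar C Cbar t Phi) :
  [<-> gramian P B Bbar Phi t T \in unitmx;
       U_space A Abar C Cbar B Bbar (2 * n - 1) = fullv;
       \rank (kalman_mx A Abar C Cbar B Bbar (2 * n)) = n].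
Proof.
(* [kalman_mx] counts blocks while [U_space] is indexed by the last one: the blocks [0] to [2 n - 1]
   are [2 n] in number. *)
have kn : (2 * n = (2 * n - 1).+1)%N by lia.
tfae.
(* A proper subspace has a nonzero annihilator [x]. As both chains have stopped, the two spaces are
   invariant, so that [x] lies in the left kernel of an invertible matrix. *)
- move=> Gu; apply: contrapT => /annihilator_exists[x x0 xU].
  have VE := V_space_stable A C B (k := (2 * n - 1)%N) ltac:(lia).
  have UE := U_space_stable A Abar C Cbar B Bbar hn; rewrite {2}kn in UE.
  have [VA VC VCU UA] : [/\ forall v, v \in V_space A C B (2 * n - 1) ->
      A *m v \in V_space A C B (2 * n - 1), forall v,
      v \in V_space A C B (2 * n - 1) -> C *m v \in V_space A C B (2 * n - 1),
      forall v, v \in V_space A C B (2 * n - 1) ->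
        (C + Cbar) *m v \in U_space A Abar C Cbar B Bbar (2 * n - 1) &
      forall u, u \in U_space A Abar C Cbar B Bbar (2 * n - 1) ->
        (A + Abar) *m u \in U_space A Abar C Cbar B Bbar (2 * n - 1)].
    split=> v vV; rewrite ?VE ?UE /=.
    + exact: (subvP (subv_trans (addvSl _ _) (addvSl _ _)) _ (memv_mulmx _ vV)).
    + exact: (subvP (subv_trans (addvSr _ _) (addvSl _ _)) _ (memv_mulmx _ vV)).
    + exact: (subvP (subv_trans (addvSr _ _) (addvSl _ _)) _ (memv_mulmx _ vV)).
    + exact: (subvP (subv_trans (addvSl _ _) (addvSl _ _)) _ (memv_mulmx _ vV)).
  have BV k : B *m k \in V_space A C B (2 * n - 1).
    by rewrite VE /=; apply: (subvP (addvSr _ _)); apply/limg_mulmxP; exists k.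
  have BU k : (B + Bbar) *m k \in U_space A Abar C Cbar B Bbar (2 * n - 1).
    by rewrite UE /=; apply: (subvP (addvSr _ _)); apply/limg_mulmxP; exists k.
  have xG := annihilates_gramian_ker hP hW ht htT hPhi xU UA VA VC VCU BV BU.
  by move/eqP: x0; apply; rewrite -[x](mulmxK Gu) xG mul0mx.
- by move=> /U_space_full; rewrite -kn.
(* A row in the left kernel of the Gramian annihilates the full space, in particular all unit
   columns, and hence is zero. *)
- rewrite kn => /U_space_full Uf; rewrite -row_free_unit -kermx_eq0.
  apply/rowV0P => x /sub_kermxP xG; apply/rowP => j.
  have := gramian_ker_annihilates hP hW ht htT hPhi xG (k := (2 * n - 1)%N) (v := delta_mx j 0).
  by rewrite Uf memvf => /(_ isT); rewrite -colE => /matrixP/(_ 0 0); rewrite !mxE.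
Qed.
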